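(* Let $l>0$ be real, $s\ge1$ an integer, and let $A,u,v,b,t,d,B,r\ge 1$ be real numbers. There is a constant $C>0$ depending only on $l,s,A,u,v,b,t,d,B,r$ (and not on $N$) such that the following holds for every integer $N\ge 2$. Let $f(x,\zeta)$ be a function on $I^s\times\mathbb{C}^N$ which is entire with respect to $\zeta\in\mathbb{C}^N$ and continuous (resp. integrable) with respect to $x\in I^s$, and such that $$\forall\,\zeta\in\mathbb{C}^N,\qquad \|f(\cdot,\zeta)\|\le A\,e^{uN^v}\,e^{bN^t\|\zeta\|_1^d},$$ where $\|\cdot\|=\|\cdot\|_\infty$ (resp. $\|\cdot\|=\|\cdot\|_{L^1}$). Then there exists $h\in\Lambda_{l,s}$ such that for all $\zeta\in\mathbb{R}^N$ with $|\zeta_j|\le BN^r$ for $j=1,\ldots,N$, $$\|h-f(\cdot,\zeta)\|\ \ge\ \frac{C}{(N\log N)^{l/s}} .$$ Equivalently, denoting by $\mathcal{E}_N$ the class of all such functions $f$, $$D_N(\Lambda_{l,s}):=\inf_{f\in\mathcal{E}_N}\ \sup_{h\in\Lambda_{l,s}}\ \inf_{\zeta\in\mathbb{R}^N,\ |\zeta_j|\le BN^r}\|h-f(\cdot,\zeta)\|\ \ge\ \frac{C}{(N\log N)^{l/s}} .$$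
   Context: $I=[0,1]$; $\log$ is the base-2 logarithm; $\|\zeta\|_1=|\zeta_1|+\cdots+|\zeta_N|$. The constant $C$ may be different in the continuous case and in the $L^1$ case. Write $l=m+\alpha$ with $m\in\mathbb{N}$ and $0<\alpha\le 1$ (so $m=\lceil l\rceil-1$). $\Lambda_{l,s}=\Lambda_l(I^s)$ is the set of real functions $f$ of class $C^m$ on $I^s$ such that every partial derivative of $f$ of order $\le m$ has sup norm $\le 1$ on $I^s$, and every partial derivative $g$ of order $m$ satisfies $\|g\|_\alpha:=\sup_{x\ne y}\frac{|g(x)-g(y)|}{\|x-y\|^\alpha}\le 1$, where $\|\cdot\|$ is the Euclidean norm on $\mathbb{R}^s$. *)

(* Defs.v *)
From HB Require Import structures.
From mathcomp Require Import all_boot all_order all_algebra.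
From mathcomp Require Import all_classical all_reals all_analysis.
From mathcomp Require Import complex.

Set Implicit Arguments.
Unset Strict Implicit.
Unset Printing Implicit Defensive.

Import Order.TTheory GRing.Theory Num.Theory.
Import numFieldNormedType.Exports.
Import ComplexField.Normc.

Local Open Scope classical_set_scope.
Local Open Scope ring_scope.
Local Open Scope complex_scope.

Definition log2 {R : realType} (x : R) : R := ln x / ln 2.

(* Functions on the cube I^s are represented by total functions on 'rV_s, of
   which only the values on the cube are ever used. *)
Definition cube (R : realType) (s : nat) : set 'rV[R]_s :=
  [set x | forall i, 0 <= x ord0 i <= 1].

(* Lebesgue measure on R^n. The library puts the product sigma-algebra on
   n.-tuple R but has no n-fold product of measures: we iterate the binary
   product and transport it along (x, t) |-> x :: t. *)
Section lebesgue_step.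
Context {R : realType} (n : nat).
Local Notation Rm := (measurableTypeR R).
Local Open Scope ereal_scope.

Definition tcons (p : Rm * n.-tuple Rm) : n.+1.-tuple Rm :=
  [the n.+1.-tuple Rm of p.1 :: p.2].

Lemma measurable_tcons : measurable_fun setT tcons.
Proof. exact: measurable_cons. Qed.

Context (mu : {sigma_finite_measure set (n.-tuple Rm) -> \bar R}).
Local Notation lprod := ((lebesgue_measure : set Rm -> \bar R) \x mu).

Definition lebesgue_step : set (n.+1.-tuple Rm) -> \bar R :=
  pushforward lprod tcons.

Let lebesgue_step0 : lebesgue_step set0 = 0.
Proof. by rewrite /lebesgue_step /pushforward preimage_set0 measure0. Qed.

Let lebesgue_step_ge0 A : 0 <= lebesgue_step A.
Proof. by rewrite /lebesgue_step /pushforward measure_ge0. Qed.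

Let lebesgue_step_sigma_additive : semi_sigma_additive lebesgue_step.
Proof.
have mpre B : measurable B -> measurable (tcons @^-1` B).
  by move=> mB; rewrite -[X in measurable X]setTI; exact: measurable_tcons.
move=> F mF tF mUF; rewrite /lebesgue_step /pushforward preimage_bigcup.
apply: measure_semi_sigma_additive.
- by move=> i; exact: mpre.
- apply/trivIsetP => i j _ _ ij; rewrite -preimage_setI.
  by move/trivIsetP : tF => /(_ _ _ _ _ ij) ->//; rewrite preimage_set0.
- by rewrite -preimage_bigcup; exact: mpre.
Qed.

HB.instance Definition _ := isMeasure.Build _ _ _ lebesgue_step
  lebesgue_step0 lebesgue_step_ge0 lebesgue_step_sigma_additive.

Let lebesgue_step_sigma_finite : sigma_finite setT lebesgue_step.
Proof.
have /sigma_finiteP[F [TF ndF Foo]] :=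
  sigma_finiteT (@lebesgue_measure R : {sigma_finite_measure set _ -> \bar R}).
have /sigma_finiteP[G [TG ndG Goo]] := sigma_finiteT mu.
pose g (t : n.+1.-tuple Rm) : Rm * n.-tuple Rm :=
  (thead t, [tuple of behead t]).
have tconsK : cancel tcons g.
  by move=> [x t]; congr pair; apply: val_inj.
have mg : measurable_fun setT g.
  apply: measurable_fun_pair; first exact: measurable_tnth.
  exact: measurable_behead.
exists (fun i => g @^-1` (F i `*` G i)).
  rewrite -preimage_bigcup (_ : \bigcup_i _ = setT) ?preimage_setT//.
  apply/seteqP; split=> // -[x t] _.
  have [i _ Fx] : (\bigcup_i F i) x by rewrite -TF.
  have [j _ Gt] : (\bigcup_i G i) t by rewrite -TG.
  exists (maxn i j) => //; split.
  - by move: x Fx; exact/subsetPset/ndF/leq_maxl.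
  - by move: t Gt; exact/subsetPset/ndG/leq_maxr.
move=> i; have [mFi Fioo] := Foo i; have [mGi Gioo] := Goo i; split.
  by rewrite -[X in measurable X]setTI; apply: mg => //; exact: measurableX.
rewrite /lebesgue_step /pushforward (_ : _ @^-1` _ = F i `*` G i).
  by rewrite product_measure1E// lte_mul_pinfty// ge0_fin_numE.
by apply/funext => p; rewrite -[RHS]/((F i `*` G i) p) -[in RHS](tconsK p).
Qed.

HB.instance Definition _ := Measure_isSigmaFinite.Build _ _ _ lebesgue_step
  lebesgue_step_sigma_finite.

End lebesgue_step.

Fixpoint lebesgue_tuple (R : realType) (n : nat) :
    {sigma_finite_measure set (n.-tuple (measurableTypeR R)) -> \bar R} :=
  match n with
  | 0 => dirac [tuple]
  | n'.+1 => lebesgue_step (lebesgue_tuple R n')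
  end.

(* Its completion, whose measurable sets are the Lebesgue measurable sets. *)
Definition lebesgue (R : realType) (n : nat) :=
  @completed_measure_extension _ _ _ (lebesgue_tuple R n).
Arguments lebesgue : clear implicits.

HB.instance Definition _ (R : realType) (n : nat) :=
  Measure.on (lebesgue R n).

Definition row_of_tuple (R : realType) (n : nat) (x : n.-tuple R) : 'rV[R]_n :=
  \row_i tnth x i.

(* Partial derivative along the i-th axis of a function on the cube, taken
   within the cube (hence one-sided on the faces orthogonal to that axis). *)
Section partial.
Context {R : realType} {s : nat}.
Implicit Types (f : 'rV[R]_s -> R) (x : 'rV[R]_s) (i : 'I_s) (w : seq 'I_s).

Definition cube_dnbhs i x : set_system R :=
  within [set h : R | cube (x + h *: delta_mx ord0 i)] 0^'.

Definition diff_quotient f i x (h : R) : R :=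
  h^-1 * (f (x + h *: delta_mx ord0 i) - f x).

Definition partial i f x : R := lim (diff_quotient f i x @ cube_dnbhs i x).

Definition partials w f : 'rV[R]_s -> R := foldr partial f w.

Definition class_C (m : nat) f : Prop :=
  (forall w, (size w <= m)%N -> {within @cube R s, continuous (partials w f)})
  /\ (forall w i x, (size w < m)%N -> cube x ->
        cvg (diff_quotient (partials w f) i x @ cube_dnbhs i x)).

(* The norm provided by the library on 'rV_s is the max norm. *)
Definition enorm x : R := Num.sqrt (\sum_i x ord0 i ^+ 2).

Definition sup_norm f : \bar R := ereal_sup [set `|f x|%:E | x in @cube R s].

Definition holder_seminorm (alpha : R) f : \bar R :=
  ereal_sup [set r | exists x y, [/\ cube x, cube y, x != y &
    r = (`|f x - f y| / enorm (x - y) `^ alpha)%:E]].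

Definition Lambda (l : R) : set ('rV[R]_s -> R) :=
  [set f | exists (m : nat) (alpha : R),
    [/\ l = m%:R + alpha, 0 < alpha <= 1, class_C m f,
        forall w, (size w <= m)%N -> (sup_norm (partials w f) <= 1)%E &
        forall w, size w = m ->
          (holder_seminorm alpha (partials w f) <= 1)%E]].

End partial.
Arguments Lambda {R} s l.

Unset Implicit Arguments.

Section approximation.
Context {R : realType} {s : nat}.

(* The two cases of the theorem: continuous in x with the sup norm, and
   integrable in x with the L^1 norm. *)
Inductive setting := ContinuousCase | IntegrableCase.

Definition tuple_cube : set (s.-tuple R) := @row_of_tuple R s @^-1` @cube R s.

Definition admissible (k : setting) (g : 'rV[R]_s -> R[i]) : Prop :=
  match k with
  | ContinuousCase => {within @cube R s, continuous (g : _ -> (R[i])^o)}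
  | IntegrableCase =>
      (lebesgue R s).-integrable tuple_cube
        (fun x => (complex.Re (g (row_of_tuple x)))%:E) /\
      (lebesgue R s).-integrable tuple_cube
        (fun x => (complex.Im (g (row_of_tuple x)))%:E)
  end.

Definition fnorm (k : setting) (g : 'rV[R]_s -> R[i]) : \bar R :=
  match k with
  | ContinuousCase => ereal_sup [set (normc (g x))%:E | x in @cube R s]
  | IntegrableCase =>
      (\int[lebesgue R s]_(x in tuple_cube) (normc (g (row_of_tuple x)))%:E)%E
  end.

(* Holomorphic on all of C^N: Frechet differentiability is C-linear, since
   'rV[R[i]]_N and (R[i])^o are normed modules over R[i]. *)
Definition entire {N : nat} (g : 'rV[R[i]]_N -> R[i]) : Prop :=
  forall z, differentiable (g : 'rV[R[i]]_N -> (R[i])^o) z.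

Definition norm1 {N : nat} (z : 'rV[R[i]]_N) : R := \sum_j normc (z ord0 j).

Definition class_E (k : setting) (A u v b t d : R) (N : nat) :
    set ('rV[R]_s -> 'rV[R[i]]_N -> R[i]) :=
  [set f | [/\ forall x, cube x -> entire (f x),
    forall z, admissible k (f ^~ z) &
    forall z, (fnorm k (f ^~ z) <=
      (A * expR (u * N%:R `^ v)
         * expR (b * N%:R `^ t * norm1 z `^ d))%:E)%E]].

Definition param_box (B r : R) (N : nat) : set 'rV[R]_N :=
  [set z | forall j, `|z ord0 j| <= B * N%:R `^ r].

Definition distance (k : setting) {N : nat} (h : 'rV[R]_s -> R)
    (f : 'rV[R]_s -> 'rV[R[i]]_N -> R[i]) (z : 'rV[R]_N) : \bar R :=
  fnorm k (fun x => (h x)%:C - f x (map_mx (real_complex R) z)).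

Definition DN (k : setting) (A u v b t d B r : R) (N : nat)
    (H : set ('rV[R]_s -> R)) : \bar R :=
  ereal_inf [set
    ereal_sup [set
      ereal_inf [set distance k h f z | z in param_box B r N]
    | h in H]
  | f in class_E k A u v b t d N].

End approximation.

(* Main.v *)
Require Import Defs.
From mathcomp Require Import all_boot all_order all_algebra.
From mathcomp Require Import all_classical all_reals all_analysis.
From mathcomp Require Import measurable_realfun complex ring lra zify.

(** The proof is a counting argument. Cut the cube into [n ^ s] cells and
    attach to each family [e] of signs the function [h_e] that carries on every
    cell a bump of height of the order of [n ^ - l] and of the prescribed sign;
    with the right constant all the [h_e] lie in [Lambda] ([bump_fun_Lambda]).
    Were the lower bound false for [f], with a threshold small compared to the
    height of the bumps, then each [h_e] would be close to some [f (., z_e)].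
    This is impossible once [n ^ s] is a large multiple of [N log N], because
    [z] has only [N] coordinates and [f] depends on them almost polynomially,
    with degrees polynomial in [N].

    The growth condition enters through approximation. On the box of parameters
    [f] is replaced by its tensor interpolant at [T] real nodes in each variable,
    a polynomial of degree less than [T] in each [z_j]. In one variable the
    error is a multiple of [(3 / 4) ^ T] ([interp_error_bound]), by bounds on
    divided differences that follow from the mean value inequality
    [mean_value_ineq]. Since [log] of the growth bound is polynomial in [N],
    a [T] polynomial in [N] makes the error negligible ([parameters]).
    The mean value inequality is proved for functions that are only assumed
    differentiable, by Goursat's bisection argument applied to midpoint sums.
    It compares a value with finite sums of values, hence can be integrated
    over [x] by Fatou's lemma; so the uniform and the [L^1] case are treated
    together, through the four properties recorded in [norm_bound].

    For the counting itself ([sign_patterns_bound]), let [M = n ^ s] and take a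
    code of at least [2 ^ (M / 2)] sign families that differ pairwise in at
    least [M / 16] places ([large_code]). Pairing the interpolant with [e], by
    functionals that read the signs of the bumps, gives a polynomial [U_e] in
    [z] whose value at [z_e'] is close to the normalised scalar product of [e]
    and [e']. The [k]-th powers of [(1 + U_e) / 2], with [k] of the order of
    [M], therefore have a diagonally dominant matrix of values at the points
    [z_e']. These powers are polynomials of degree less than [k * T + 1] in
    each variable, so that there are at most [(k * T + 1) ^ N] of them
    ([dominant_card]). Hence [2 ^ (M / 2) <= (k * T + 1) ^ N], that is,
    [M = O(N log N)]. *)
Set Implicit Arguments.
Unset Strict Implicit.
Unset Printing Implicit Defensive.
Import Order.TTheory GRing.Theory Num.Theory.
Import numFieldNormedType.Exports.
Import ComplexField.Normc.

Local Open Scope classical_set_scope.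
Local Open Scope ring_scope.
Local Open Scope complex_scope.

(** * Complex differentiability *)

Section normc_facts.
Context {R : realType}.
Implicit Types z w : R[i].

Lemma normc_ge0 z : 0 <= normc z.
Proof. by case: z => a b; exact: sqrtr_ge0. Qed.

Lemma normcB_sym z w : normc (z - w) = normc (w - z).
Proof. by rewrite -opprB normcN. Qed.

Lemma normc_real (x : R) : normc x%:C = `|x|.
Proof. by rewrite /normc /= expr0n addr0 sqrtr_sqr. Qed.

Lemma normc_i : normc ('i%C : R[i]) = 1.
Proof. by rewrite /normc /= expr0n add0r expr1n sqrtr1. Qed.

Lemma normc_gt0 z : (0 < normc z) = (z != 0).
Proof.
rewrite lt0r normc_ge0 andbT; congr (~~ _); apply/eqP/eqP => [|->].
  exact: eq0_normc.
exact: normc0.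
Qed.

Lemma normc_sum (I : Type) (s : seq I) (P : pred I) (F : I -> R[i]) :
  normc (\sum_(i <- s | P i) F i) <= \sum_(i <- s | P i) normc (F i).
Proof.
elim/big_ind2 : _ => [|x1 x2 y1 y2 h1 h2|//]; first by rewrite normc0.
by rewrite (le_trans (le_normcD _ _))// lerD.
Qed.

Lemma ler_normc_sub z w : normc z - normc w <= normc (z - w).
Proof. by rewrite lerBlDr -{1}(subrK w z) le_normcD. Qed.

Lemma normr_Re z : `|complex.Re z| <= normc z.
Proof.
case: z => a b /=; rewrite -sqrtr_sqr ler_wsqrtr//.
by rewrite lerDl sqr_ge0.
Qed.

Lemma normr_Im z : `|complex.Im z| <= normc z.
Proof.
case: z => a b /=; rewrite -sqrtr_sqr ler_wsqrtr//.
by rewrite lerDr sqr_ge0.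
Qed.

Lemma normc_le_ReIm z : normc z <= `|complex.Re z| + `|complex.Im z|.
Proof.
rewrite {1}[z]complexE (le_trans (le_normcD _ _))// normcM normc_i mul1r.
by rewrite !normc_real.
Qed.

End normc_facts.

Section cdiff.
Context {R : realType}.
Implicit Types (f g q : R[i] -> R[i]) (p w z : R[i]).

Definition ccont f p := forall e : R, 0 < e ->
  exists2 d : R, 0 < d & forall z, normc (z - p) < d -> normc (f z - f p) <= e.

Lemma ccontP f p : ccont f p <-> {for p, continuous (f : R[i]^o -> R[i]^o)}.
Proof.
have nE z : `|z : R[i]^o| = (normc z)%:C by case: z.
have F : Filter (nbhs (p : R[i]^o)) by exact: nbhs_filter.
have H := @cvgrPdist_le R[i] R[i]^o _ (nbhs (p : R[i]^o)) F f (f p).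
split=> [fp|/H fp].
  apply/H => -[e e'] /=.
  rewrite ltcE /= => /andP[/eqP -> e0].
  have [d d0 fd] := fp e e0.
  apply/nbhs_ballP; exists d%:C => /=; first by rewrite ltcR.
  move=> z; rewrite -ball_normE/= nE ltcR normcB_sym => zd.
  by rewrite nE -[X in _ <= X]/(e%:C) lecR normcB_sym fd.
move=> e e0; have /fp : 0 < e%:C by rewrite ltcR.
rewrite nearE => /nbhs_ballP[[d d'] /=]; rewrite ltcE/= => /andP[/eqP -> d0] h.
exists d => // z zd; have /h/= : ball (p : R[i]^o) d%:C z.
  by rewrite -ball_normE/= nE ltcR normcB_sym.
by rewrite nE lecR normcB_sym.
Qed.

(** Caratheodory's form of differentiability. The slope function [u] is itself a
    divided difference, and products and quotients need only continuity. *)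
Definition cdiff f p := exists2 u, ccont u p & forall z, f z = f p + u z * (z - p).

Lemma ccont_eq f g p : (exists2 d : R, 0 < d & forall z, normc (z - p) < d -> f z = g z) ->
  ccont f p -> ccont g p.
Proof.
move=> [d d0 fg] fp e e0; have [d' d'0 fe] := fp e e0.
exists (Num.min d d'); first by rewrite lt_min d0.
move=> z; rewrite lt_min => /andP[zd zd']; rewrite -fg// -fg ?fe//.
by rewrite subrr normc0.
Qed.

Lemma ccont_cst c p : ccont (cst c) p.
Proof.
move=> e e0; exists 1 => // z _.
by rewrite (_ : cst c z - cst c p = 0) ?subrr// normc0 ltW.
Qed.

Lemma ccont_id p : ccont id p.
Proof. by move=> e e0; exists e => // z /ltW. Qed.

Lemma ccontD f g p : ccont f p -> ccont g p -> ccont (fun z => f z + g z) p.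
Proof.
move=> /ccontP h1 /ccontP h2; apply/ccontP.
exact: (@cvgD _ R[i]^o _ (nbhs (p : R[i]^o)) _ f g (f p) (g p) h1 h2).
Qed.

Lemma ccontB f g p : ccont f p -> ccont g p -> ccont (fun z => f z - g z) p.
Proof.
move=> /ccontP h1 /ccontP h2; apply/ccontP.
exact: (@cvgB _ R[i]^o _ (nbhs (p : R[i]^o)) _ f g (f p) (g p) h1 h2).
Qed.

Lemma ccontM f g p : ccont f p -> ccont g p -> ccont (fun z => f z * g z) p.
Proof.
move=> /ccontP h1 /ccontP h2; apply/ccontP.
exact: (@cvgM R[i] _ (nbhs (p : R[i]^o)) _ f g (f p) (g p) h1 h2).
Qed.

Lemma ccontV f p : f p != 0 -> ccont f p -> ccont (fun z => (f z)^-1) p.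
Proof.
move=> fp /ccontP h1; apply/ccontP.
exact: (@cvgV R[i] _ (nbhs (p : R[i]^o)) _ f (f p) fp h1).
Qed.

Lemma cdiff_ccont f p : cdiff f p -> ccont f p.
Proof.
move=> [u uc uE]; apply: (@ccont_eq (fun z => f p + u z * (z - p))).
  by exists 1 => // z _; rewrite -uE.
apply: ccontD; first exact: ccont_cst.
by apply: ccontM => //; apply: ccontB; [exact: ccont_id|exact: ccont_cst].
Qed.

Lemma cdiffD f g p : cdiff f p -> cdiff g p -> cdiff (fun z => f z + g z) p.
Proof.
move=> [u uc uE] [v vc vE]; exists (fun z => u z + v z); first exact: ccontD.
by move=> z; rewrite uE vE; ring.
Qed.

Lemma cdiffZ c f p : cdiff f p -> cdiff (fun z => c * f z) p.
Proof.
move=> [u uc uE]; exists (fun z => c * u z).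
  by apply: ccontM => //; exact: ccont_cst.
by move=> z; rewrite uE; ring.
Qed.

Lemma cdiff_cst c p : cdiff (fun=> c) p.
Proof. by exists (cst 0); [exact: ccont_cst|move=> z; rewrite mul0r addr0]. Qed.

Lemma cdiff_sum (I : Type) (s : seq I) (F : I -> R[i] -> R[i]) p :
  (forall i, cdiff (F i) p) -> cdiff (fun z => \sum_(i <- s) F i z) p.
Proof.
move=> h; elim: s => [|i s ih].
  have := cdiff_cst 0 p; congr cdiff; apply/funext => z; rewrite big_nil//.
have := cdiffD (h i) ih; congr cdiff; apply/funext => z; rewrite big_cons//.
Qed.

(** The removable singularity that matters: dividing out a point [w] where
    [q] is differentiable costs only the differentiability at [w]. *)
Lemma quotient_extension q w : cdiff q w -> exists g,
  [/\ forall z, z != w -> g z = (q z - q w) / (z - w),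
      ccont g w,
      forall p, p != w -> ccont q p -> ccont g p &
      forall p, p != w -> cdiff q p -> cdiff g p].
Proof.
move=> [u uc uE]; exists (fun z => if z == w then u w else (q z - q w) / (z - w)).
set g := (fun z => _).
have gE z : z != w -> g z = (q z - q w) / (z - w) by rewrite /g => /negPf ->.
have away p : p != w -> exists2 d : R, 0 < d &
    forall z, normc (z - p) < d -> z != w.
  move=> pw; exists (normc (w - p)); first by rewrite normc_gt0 subr_eq0 eq_sym.
  by move=> z; apply: contraTneq => ->; rewrite ltxx.
split => //.
- apply: (@ccont_eq u) => //; exists 1 => // z _; rewrite /g; case: eqP => [->//|/eqP zw].
  by rewrite uE addrAC subrr add0r mulfK// subr_eq0.
- move=> p pw qp; have [d d0 dw] := away _ pw.
  apply: (@ccont_eq (fun z => (q z - q w) / (z - w))).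
    by exists d => // z /dw zw; rewrite gE.
  apply: ccontM; first by apply: ccontB => //; exact: ccont_cst.
  apply: ccontV; first by rewrite subr_eq0.
  by apply: ccontB; [exact: ccont_id|exact: ccont_cst].
- move=> p pw [v vc vE]; have [d d0 dw] := away _ pw.
  pose v' z := (v z * (p - w) - (q p - q w)) / ((z - w) * (p - w)).
  have pw0 : p - w != 0 by rewrite subr_eq0.
  exists (fun z => if z == p then v' p else (g z - g p) / (z - p)).
    apply: (@ccont_eq v').
      exists d => // z /dw zw; case: eqP => [->//|/eqP zp].
      rewrite !gE// /v' (vE z).
      have zw0 : z - w != 0 by rewrite subr_eq0.
      have zp0 : z - p != 0 by rewrite subr_eq0.
      by field; rewrite zp0 pw0 zw0.
    apply: ccontM.
      apply: ccontB; last exact: ccont_cst.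
      by apply: ccontM => //; exact: ccont_cst.
    apply: ccontV; first by rewrite mulf_neq0.
    apply: ccontM; last exact: ccont_cst.
    by apply: ccontB; [exact: ccont_id|exact: ccont_cst].
  move=> z; case: eqP => [->|/eqP zp]; first by rewrite subrr mulr0 addr0.
  by rewrite divfK ?subr_eq0// addrC subrK.
Qed.

End cdiff.

(** * Contour sums *)

Section riemann_sums.
Context {R : realType}.
Implicit Types (f g : R[i] -> R[i]) (x y l : R) (p z : R[i]) (n : nat).

Definition pt x y : R[i] := x%:C + 'i%C * y%:C.

Lemma Re_pt x y : complex.Re (pt x y) = x.
Proof. by rewrite /pt /=; ring. Qed.

Lemma Im_pt x y : complex.Im (pt x y) = y.
Proof. by rewrite /pt /=; ring. Qed.

(** Midpoints of the [2 ^ n] equal parts of a horizontal or a vertical side, by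
    repeated halving, so that quartering a square is a computation. *)
Fixpoint hpts x y l n : seq R[i] :=
  if n is n'.+1 then hpts x y (l / 2) n' ++ hpts (x + l / 2) y (l / 2) n'
  else [:: pt (x + l / 2) y].

Fixpoint vpts x y l n : seq R[i] :=
  if n is n'.+1 then vpts x y (l / 2) n' ++ vpts x (y + l / 2) (l / 2) n'
  else [:: pt x (y + l / 2)].

(** The whole boundary: bottom, right, top, left. *)
Definition bpts x y l n : seq R[i] :=
  hpts x y l n ++ vpts (x + l) y l n ++ hpts x (y + l) l n ++ vpts x y l n.

(** The midpoint sum for the contour integral of [f] around the square with
    lower left corner [(x, y)] and side [l]. *)
Definition contour_sum f x y l n : R[i] := (l / 2 ^+ n)%:C *
  (\sum_(p <- hpts x y l n) f p + 'i%C * \sum_(p <- vpts (x + l) y l n) f p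
   - \sum_(p <- hpts x (y + l) l n) f p - 'i%C * \sum_(p <- vpts x y l n) f p).

Lemma size_hpts x y l n : size (hpts x y l n) = (2 ^ n)%N.
Proof. by elim: n x y l => //= n ih x y l; rewrite size_cat !ih addnn -mul2n -expnS. Qed.

Lemma size_vpts x y l n : size (vpts x y l n) = (2 ^ n)%N.
Proof. by elim: n x y l => //= n ih x y l; rewrite size_cat !ih addnn -mul2n -expnS. Qed.

Lemma size_bpts x y l n : size (bpts x y l n) = (4 * 2 ^ n)%N.
Proof.
by rewrite /bpts !size_cat !size_hpts !size_vpts !mulSn mul0n addn0.
Qed.

Lemma mem_hpts x y l n p : 0 <= l -> p \in hpts x y l n ->
  x <= complex.Re p <= x + l /\ complex.Im p = y.
Proof.
elim: n x y l => [|n ih] x y l l0 /=.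
  rewrite inE => /eqP ->; rewrite Re_pt Im_pt; split => //.
  by apply/andP; split; lra.
have l20 : 0 <= l / 2 by rewrite divr_ge0.
rewrite mem_cat => /orP[/(ih _ _ _ l20)|/(ih _ _ _ l20)] [/andP[h1 h2] ->].
  by split=> //; apply/andP; split; lra.
by split=> //; apply/andP; split; lra.
Qed.

Lemma mem_vpts x y l n p : 0 <= l -> p \in vpts x y l n ->
  y <= complex.Im p <= y + l /\ complex.Re p = x.
Proof.
elim: n x y l => [|n ih] x y l l0 /=.
  rewrite inE => /eqP ->; rewrite Re_pt Im_pt; split => //.
  by apply/andP; split; lra.
have l20 : 0 <= l / 2 by rewrite divr_ge0.
rewrite mem_cat => /orP[/(ih _ _ _ l20)|/(ih _ _ _ l20)] [/andP[h1 h2] ->].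
  by split=> //; apply/andP; split; lra.
by split=> //; apply/andP; split; lra.
Qed.

Lemma mem_bpts x y l n p : 0 <= l -> p \in bpts x y l n ->
  [/\ x <= complex.Re p <= x + l, y <= complex.Im p <= y + l &
    [\/ complex.Re p = x, complex.Re p = x + l, complex.Im p = y |
        complex.Im p = y + l]].
Proof.
move=> l0; rewrite /bpts !mem_cat => /or4P[] h.
- by have [-> ->] := mem_hpts l0 h; rewrite lexx lerDl l0; split=> //; constructor 3.
- by have [-> ->] := mem_vpts l0 h; rewrite lexx lerDl l0; split=> //; constructor 2.
- by have [-> ->] := mem_hpts l0 h; rewrite lexx lerDl l0; split=> //; constructor 4.
- by have [-> ->] := mem_vpts l0 h; rewrite lexx lerDl l0; split=> //; constructor 1.
Qed.

Lemma contour_sumD f g x y l n :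
  contour_sum (fun z => f z + g z) x y l n = contour_sum f x y l n + contour_sum g x y l n.
Proof. by rewrite /contour_sum !big_split /=; ring. Qed.

Lemma contour_sumZ c f x y l n :
  contour_sum (fun z => c * f z) x y l n = c * contour_sum f x y l n.
Proof. by rewrite /contour_sum -!mulr_sumr; ring. Qed.

Lemma eq_contour_sum f g x y l n : (forall p, p \in bpts x y l n -> f p = g p) ->
  contour_sum f x y l n = contour_sum g x y l n.
Proof.
move=> fg; rewrite /contour_sum; congr (_ * (_ + _ * _ - _ - _ * _)); apply: eq_big_seq => p hp;
  by rewrite fg// /bpts !mem_cat hp ?orbT.
Qed.

Lemma normc_contour_sum f x y l n : 0 <= l ->
  normc (contour_sum f x y l n) <= l / 2 ^+ n * \sum_(p <- bpts x y l n) normc (f p).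
Proof.
move=> l0; rewrite /contour_sum normcM normc_real ger0_norm; last first.
  by rewrite divr_ge0// exprn_ge0.
apply: ler_wpM2l; first by rewrite divr_ge0// exprn_ge0.
rewrite /bpts !big_cat/= !addrA.
do 3 (apply: le_trans (le_normcD _ _) _; rewrite ?normcN; apply: lerD;
  last by rewrite ?normcM ?normc_i ?mul1r normc_sum).
exact: normc_sum.
Qed.

Lemma normc_contour_sum_le f x y l n (M : R) : 0 <= l ->
  (forall p, p \in bpts x y l n -> normc (f p) <= M) ->
  normc (contour_sum f x y l n) <= 4 * l * M.
Proof.
move=> l0 fM; apply: le_trans (normc_contour_sum _ _ _ _ l0) _.
apply: (@le_trans _ _ (l / 2 ^+ n * \sum_(p <- bpts x y l n) M)).
  apply: ler_wpM2l; first by rewrite divr_ge0// exprn_ge0.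
  by rewrite big_seq [leRHS]big_seq; apply: ler_sum.
rewrite big_const_seq count_predT size_bpts iter_addr addr0 -[M *+ _]mulr_natr natrM natrX.
have h : (2 : R) ^+ n != 0 by rewrite expf_neq0.
by rewrite le_eqVlt; apply/orP; left; apply/eqP; field.
Qed.

Lemma halfC : (2^-1 : R)%:C = 2^-1 :> R[i].
Proof. by rewrite fmorphV rmorph_nat. Qed.

Lemma hpts_affine A B x y l n : (l / 2 ^+ n)%:C * \sum_(p <- hpts x y l n) (A + B * p) =
  l%:C * (A + B * pt (x + l / 2) y).
Proof.
elim: n x y l => [|n ih] x y l /=; first by rewrite big_seq1 expr0 divr1.
rewrite big_cat/= mulrDr.
rewrite (_ : l / 2 ^+ n.+1 = l / 2 / 2 ^+ n); last by rewrite exprS invfM mulrA.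
rewrite !ih /pt.
rewrite (_ : l%:C = (l / 2)%:C * 2); last by rewrite rmorphM/= halfC divfK// pnatr_eq0.
rewrite !(rmorphD, rmorphM)/=.
rewrite halfC.
by field.
Qed.

Lemma vpts_affine A B x y l n : (l / 2 ^+ n)%:C * \sum_(p <- vpts x y l n) (A + B * p) =
  l%:C * (A + B * pt x (y + l / 2)).
Proof.
elim: n x y l => [|n ih] x y l /=; first by rewrite big_seq1 expr0 divr1.
rewrite big_cat/= mulrDr.
rewrite (_ : l / 2 ^+ n.+1 = l / 2 / 2 ^+ n); last by rewrite exprS invfM mulrA.
rewrite !ih /pt.
rewrite (_ : l%:C = (l / 2)%:C * 2); last by rewrite rmorphM/= halfC divfK// pnatr_eq0.
rewrite !(rmorphD, rmorphM)/=.
rewrite halfC.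
by field.
Qed.

(** Midpoint sums are exact on affine functions, and these have a primitive. *)
Lemma contour_sum_affine A B x y l n : contour_sum (fun z => A + B * z) x y l n = 0.
Proof.
rewrite /contour_sum !mulrBr mulrDr !(mulrCA _ 'i%C) !hpts_affine !vpts_affine /pt.
by rewrite !(rmorphD, rmorphM)/=; ring.
Qed.

Lemma contour_sumS f x y l n : contour_sum f x y l n.+1 =
  contour_sum f x y (l / 2) n + contour_sum f (x + l / 2) y (l / 2) n +
  contour_sum f x (y + l / 2) (l / 2) n + contour_sum f (x + l / 2) (y + l / 2) (l / 2) n.
Proof.
rewrite /contour_sum /= !big_cat/=.
rewrite (_ : l / 2 ^+ n.+1 = l / 2 / 2 ^+ n); last by rewrite exprS invfM mulrA.
have E t : t + l / 2 + l / 2 = t + l by field.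
by rewrite !E; ring.
Qed.

Lemma normc_pt_le x y l z p : 0 <= l ->
  x <= complex.Re z <= x + l -> y <= complex.Im z <= y + l ->
  x <= complex.Re p <= x + l -> y <= complex.Im p <= y + l ->
  normc (z - p) <= 2 * l.
Proof.
move=> l0 zx zy px py; apply: (le_trans (normc_le_ReIm _)).
case: z p zx zy px py => [a b] [c d]/=.
move=> /andP[h1 h2] /andP[h3 h4] /andP[h5 h6] /andP[h7 h8].
have k1 : `|a - c| <= l by rewrite ler_norml; apply/andP; split; lra.
have k2 : `|b - d| <= l by rewrite ler_norml; apply/andP; split; lra.
lra.
Qed.

(** Constants have zero sum, so only the oscillation of [f] counts. *)
Lemma contour_sum_ccont f p : ccont f p -> forall e : R, 0 < e ->
  exists2 d : R, 0 < d & forall x y l n, 0 < l -> l < d ->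
  x <= complex.Re p <= x + l -> y <= complex.Im p <= y + l ->
  normc (contour_sum f x y l n) <= e * l.
Proof.
move=> fp e e0; have [d d0 fd] := fp (e / 4) (divr_gt0 e0 (ltr0n _ 4)).
exists (d / 2); first by rewrite divr_gt0.
move=> x y l n l0 ld px py.
rewrite (_ : contour_sum f x y l n = contour_sum (fun z => f z - f p) x y l n); last first.
  rewrite contour_sumD [X in _ + X](_ : _ = 0) ?addr0//.
  rewrite -(contour_sum_affine (- f p) 0 x y l n); apply: eq_contour_sum => z _.
  by rewrite mul0r addr0.
rewrite (_ : e * l = 4 * l * (e / 4)); last by field.
apply: normc_contour_sum_le; first exact: ltW.
move=> z /(mem_bpts (ltW l0))[zx zy _]; apply: fd.
by apply: (le_lt_trans (normc_pt_le (ltW l0) zx zy px py)); lra.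
Qed.

(** Affine functions have zero sum, so only the remainder of [f] counts. *)
Lemma contour_sum_cdiff f p : cdiff f p -> forall e : R, 0 < e ->
  exists2 d : R, 0 < d & forall x y l n, 0 < l -> l < d ->
  x <= complex.Re p <= x + l -> y <= complex.Im p <= y + l ->
  normc (contour_sum f x y l n) <= e * l ^+ 2.
Proof.
move=> [u uc uE] e e0; have [d d0 ud] := uc (e / 8) (divr_gt0 e0 (ltr0n _ 8)).
exists (d / 2); first by rewrite divr_gt0.
move=> x y l n l0 ld px py.
rewrite (_ : contour_sum f x y l n = contour_sum (fun z => (u z - u p) * (z - p)) x y l n); last first.
  rewrite -[RHS]addr0 -(contour_sum_affine (f p - u p * p) (u p) x y l n) -contour_sumD.
  by apply: eq_contour_sum => z _; rewrite uE; ring.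
rewrite (_ : e * l ^+ 2 = 4 * l * (e / 8 * (2 * l))); last by field.
apply: normc_contour_sum_le; first exact: ltW.
move=> z /(mem_bpts (ltW l0))[zx zy _]; rewrite normcM.
have h := normc_pt_le (ltW l0) zx zy px py.
apply: ler_pM => //; [exact: normc_ge0|exact: normc_ge0|].
by apply: ud; apply: (le_lt_trans h); lra.
Qed.

End riemann_sums.

(** * Goursat's lemma and the mean value inequality *)

Section goursat.
Context {R : realType}.
Implicit Types (f g q : R[i] -> R[i]) (x y l : R) (p z : R[i]) (n : nat).

Lemma nested_intervals (x l : nat -> R) : (forall k, 0 <= l k) ->
  (forall k, x k <= x k.+1) -> (forall k, x k.+1 + l k.+1 <= x k + l k) ->
  exists a : R, forall k, x k <= a <= x k + l k.
Proof.
move=> l0 xS xlS.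
have xm i j : (i <= j)%N -> x i <= x j.
  by apply: (homo_leq (@lexx _ _) le_trans).
have xlm i j : (i <= j)%N -> x j + l j <= x i + l i.
  apply: (@homo_leq _ (fun k => x k + l k) (fun a b => b <= a) (@lexx _ _)) => //.
  by move=> ? ? ? /[swap]; exact: le_trans.
have ub k : ubound [set x j | j in setT] (x k + l k).
  move=> _ [j _ <-]; have [jk|/ltnW kj] := leqP j k.
    by rewrite (le_trans (xm _ _ jk))// lerDl.
  by rewrite (le_trans _ (xlm _ _ kj))// lerDl.
have hs : has_sup [set x j | j in setT].
  by split; [exists (x 0), 0|exists (x 0 + l 0)].
exists (sup [set x j | j in setT]) => k; apply/andP; split.
  by apply: sup_upper_bound => //; exists k.
by apply: ge_sup => //; exists (x 0), 0.
Qed.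

(** A function whose increment over an interval containing [0] is at least the
    square root of the length: a product of two such increments is additive
    under quartering and detects a point to the first order. *)
Definition signed_sqrt (t : R) := if 0 <= t then Num.sqrt t else - Num.sqrt (- t).

Lemma signed_sqrt_sub (t u : R) : t <= 0 -> 0 <= u ->
  Num.sqrt (u - t) <= signed_sqrt u - signed_sqrt t.
Proof.
move=> t0 u0; rewrite /signed_sqrt u0.
have -> : (if 0 <= t then Num.sqrt t else - Num.sqrt (- t)) = - Num.sqrt (- t).
  case: ifPn => // t0'; have -> : t = 0 by apply/eqP; rewrite eq_le t0.
  by rewrite oppr0 sqrtr0 oppr0.
rewrite opprK -(@ler_pXn2r _ 2) ?nnegrE ?sqrtr_ge0 ?addr_ge0 ?sqrtr_ge0//.
rewrite sqrrD !sqr_sqrtr ?oppr_ge0//; last by rewrite subr_ge0 (le_trans t0).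
have : 0 <= Num.sqrt u * Num.sqrt (- t) by rewrite mulr_ge0 ?sqrtr_ge0.
lra.
Qed.

Lemma signed_sqrt_homo : {homo signed_sqrt : t u / t <= u}.
Proof.
move=> t u tu; rewrite /signed_sqrt; case: ifPn => [t0|].
  by rewrite (le_trans t0 tu) ler_wsqrtr.
rewrite -ltNge => t0; case: ifPn => [u0|].
  by rewrite (@le_trans _ _ 0)// ?oppr_le0 ?sqrtr_ge0.
by move=> _; rewrite lerN2 ler_wsqrtr// lerN2.
Qed.

Definition sqrt_incr (a x l : R) := signed_sqrt (x + l - a) - signed_sqrt (x - a).

Lemma sqrt_incr_split a x l : sqrt_incr a x l = sqrt_incr a x (l / 2) + sqrt_incr a (x + l / 2) (l / 2).
Proof. by rewrite /sqrt_incr (_ : x + l / 2 + l / 2 = x + l); [ring|field]. Qed.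

Lemma sqrt_incr_ge0 a x l : 0 <= l -> 0 <= sqrt_incr a x l.
Proof. by move=> l0; rewrite /sqrt_incr subr_ge0; apply: signed_sqrt_homo; lra. Qed.

Lemma sqrt_incr_ge a x l : x <= a <= x + l -> Num.sqrt l <= sqrt_incr a x l.
Proof.
move=> /andP[h1 h2]; rewrite /sqrt_incr.
rewrite {1}(_ : l = (x + l - a) - (x - a)); last by ring.
by apply: signed_sqrt_sub; lra.
Qed.

(** A set function on squares that is additive under quartering, bounds the
    area, and is at least the side length of any square meeting [P]. *)
Definition weight (P : seq R[i]) x y l := l ^+ 2 +
  \sum_(p <- P) sqrt_incr (complex.Re p) x l * sqrt_incr (complex.Im p) y l.

Lemma weight_split P x y l : weight P x y l =
  weight P x y (l / 2) + weight P (x + l / 2) y (l / 2) +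
  weight P x (y + l / 2) (l / 2) + weight P (x + l / 2) (y + l / 2) (l / 2).
Proof.
rewrite /weight.
have E p : sqrt_incr (complex.Re p) x l * sqrt_incr (complex.Im p) y l =
    sqrt_incr (complex.Re p) x (l / 2) * sqrt_incr (complex.Im p) y (l / 2) +
    sqrt_incr (complex.Re p) (x + l / 2) (l / 2) * sqrt_incr (complex.Im p) y (l / 2) +
    sqrt_incr (complex.Re p) x (l / 2) * sqrt_incr (complex.Im p) (y + l / 2) (l / 2) +
    sqrt_incr (complex.Re p) (x + l / 2) (l / 2) * sqrt_incr (complex.Im p) (y + l / 2) (l / 2).
  by rewrite (sqrt_incr_split _ x l) (sqrt_incr_split _ y l); ring.
by under eq_bigr do rewrite E; rewrite !big_split/=; field.
Qed.

Lemma weight_ge_sqr P x y l : 0 <= l -> l ^+ 2 <= weight P x y l.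
Proof.
by move=> l0; rewrite lerDl sumr_ge0// => p _; rewrite mulr_ge0 ?sqrt_incr_ge0.
Qed.

Lemma weight_ge_side P x y l p : p \in P -> 0 <= l ->
  x <= complex.Re p <= x + l -> y <= complex.Im p <= y + l ->
  l <= weight P x y l.
Proof.
move=> pP l0 px py; rewrite /weight (big_rem p)//=.
have h : l <= sqrt_incr (complex.Re p) x l * sqrt_incr (complex.Im p) y l.
  rewrite -{1}(sqr_sqrtr l0) expr2.
  by apply: ler_pM; rewrite ?sqrtr_ge0 ?sqrt_incr_ge.
have h2 : 0 <= \sum_(i <- rem p P) sqrt_incr (complex.Re i) x l * sqrt_incr (complex.Im i) y l.
  by apply: sumr_ge0 => i _; rewrite mulr_ge0 ?sqrt_incr_ge0.
have := sqr_ge0 l; lra.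
Qed.

Section bisection.
Variables (f : R[i] -> R[i]) (P : seq R[i]) (e : R).

Let small x y l := exists n0, forall n, (n0 <= n)%N ->
  normc (contour_sum f x y l n) <= e * weight P x y l.

(** Smallness relative to [weight] passes from the four quarters to the square,
    since both sides are additive. *)
Lemma small_split x y l :
  small x y (l / 2) -> small (x + l / 2) y (l / 2) ->
  small x (y + l / 2) (l / 2) -> small (x + l / 2) (y + l / 2) (l / 2) ->
  small x y l.
Proof.
move=> [n1 h1] [n2 h2] [n3 h3] [n4 h4].
exists (maxn (maxn n1 n2) (maxn n3 n4)).+1 => -[//|n].
rewrite ltnS !geq_max => /andP[/andP[k1 k2] /andP[k3 k4]].
rewrite contour_sumS.
have -> : e * weight P x y l =
    e * weight P x y (l / 2) + e * weight P (x + l / 2) y (l / 2) +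
    e * weight P x (y + l / 2) (l / 2) + e * weight P (x + l / 2) (y + l / 2) (l / 2).
  by rewrite (weight_split P x y l); ring.
by do 3 (apply: (le_trans (le_normcD _ _)); apply: lerD; last by auto); auto.
Qed.

(** Goursat's argument: a square that is not small contains arbitrarily small
    squares that are not, all of them around a common point. *)
Lemma bisection x y l : 0 < l -> ~ small x y l -> exists p,
  forall d, 0 < d -> exists x' y' l', [/\ 0 < l', l' < d,
    x' <= complex.Re p <= x' + l', y' <= complex.Im p <= y' + l' &
    ~ small x' y' l'].
Proof.
move=> l0 bad0.
pose next (s : R * R) (h : R) : R * R :=
  if `[< ~ small s.1 s.2 h >] then s else
  if `[< ~ small (s.1 + h) s.2 h >] then (s.1 + h, s.2) else
  if `[< ~ small s.1 (s.2 + h) h >] then (s.1, s.2 + h) else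
  (s.1 + h, s.2 + h).
pose L k := l / 2 ^+ k.
have L0 k : 0 < L k by rewrite divr_gt0// exprn_gt0.
have LS k : L k.+1 = L k / 2 by rewrite /L exprS invfM mulrA mulrAC.
pose s := fix s k := if k is k'.+1 then next (s k') (L k) else (x, y).
have sS k : s k.+1 = next (s k) (L k.+1) by [].
have bad k : ~ small (s k).1 (s k).2 (L k).
  elim: k => [|k ih]; first by rewrite /L expr0 divr1.
  rewrite sS /next; case: asboolP => [//|/contrapT h1].
  case: asboolP => [//|/contrapT h2].
  case: asboolP => [//|/contrapT h3] h4; apply: ih; rewrite LS in h1 h2 h3 h4.
  exact: small_split.
have mono k : [/\ (s k).1 <= (s k.+1).1, (s k).2 <= (s k.+1).2,
    (s k.+1).1 + L k.+1 <= (s k).1 + L k & (s k.+1).2 + L k.+1 <= (s k).2 + L k].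
  rewrite sS /next; have := L0 k; rewrite LS => Lk.
  by do 3 (case: ifP => _ /=; first by split; lra); split; lra.
have [p1 hp1] := @nested_intervals (fun k => (s k).1) L (fun k => ltW (L0 k))
  (fun k => let: And4 h _ _ _ := mono k in h) (fun k => let: And4 _ _ h _ := mono k in h).
have [p2 hp2] := @nested_intervals (fun k => (s k).2) L (fun k => ltW (L0 k))
  (fun k => let: And4 _ h _ _ := mono k in h) (fun k => let: And4 _ _ _ h := mono k in h).
exists (p1 +i* p2) => d d0.
have [k kd] : exists k, L k < d.
  exists (Num.trunc (l / d)).+1; rewrite /L ltr_pdivrMr ?exprn_gt0//.
  rewrite -ltr_pdivrMl// mulrC (lt_trans (truncnS_gt _))//.
  by rewrite -natrX ltr_nat ltn_expl.
by exists (s k).1, (s k).2, (L k); split.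
Qed.

End bisection.

(** At a point of [P] mere continuity suffices: there the sums are small compared
    to the side of the square, which [weight] dominates. *)
Lemma goursat f (P : seq R[i]) : (forall p, ccont f p) ->
  (forall p, p \notin P -> cdiff f p) -> forall x y l, 0 < l ->
  forall e, 0 < e -> exists n0, forall n, (n0 <= n)%N ->
    normc (contour_sum f x y l n) <= e.
Proof.
move=> fc fd x y l l0 e e0.
have w0 : 0 < weight P x y l.
  by rewrite (lt_le_trans _ (weight_ge_sqr _ _ _ (ltW l0)))// exprn_gt0.
suff [n0 h] : exists n0, forall n, (n0 <= n)%N ->
    normc (contour_sum f x y l n) <= e / weight P x y l * weight P x y l.
  by exists n0 => n /h; rewrite divfK// gt_eqF.
apply: contrapT => /(bisection l0)[p hp].
have e'0 : 0 < e / weight P x y l by rewrite divr_gt0.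
have [pP|pP] := boolP (p \in P).
  have [d d0 hd] := contour_sum_ccont (fc p) e'0.
  have [x' [y' [l' [l'0 l'd px py]]]] := hp d d0; apply; exists 0%N => n _.
  rewrite (le_trans (hd _ _ _ _ l'0 l'd px py))// ler_pM2l//.
  exact: weight_ge_side (ltW l'0) px py.
have [d d0 hd] := contour_sum_cdiff (fd p pP) e'0.
have [x' [y' [l' [l'0 l'd px py]]]] := hp d d0; apply; exists 0%N => n _.
rewrite (le_trans (hd _ _ _ _ l'0 l'd px py))// ler_pM2l//.
exact: weight_ge_sqr (ltW l'0).
Qed.

Lemma ImD z w : complex.Im (z + w) = complex.Im z + complex.Im w.
Proof. by case: z w => [a b] [c d]. Qed.

Lemma ReD z w : complex.Re (z + w) = complex.Re z + complex.Re w.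
Proof. by case: z w => [a b] [c d]. Qed.

Lemma ImN z : complex.Im (- z) = - complex.Im z.
Proof. by case: z. Qed.

Lemma Im_sum (s : seq R[i]) f :
  complex.Im (\sum_(p <- s) f p) = \sum_(p <- s) complex.Im (f p).
Proof. by apply: (big_morph (fun z : R[i] => complex.Im z)) => //; exact: ImD. Qed.

Lemma Re_sum (s : seq R[i]) f :
  complex.Re (\sum_(p <- s) f p) = \sum_(p <- s) complex.Re (f p).
Proof. by apply: (big_morph (fun z : R[i] => complex.Re z)) => //; exact: ReD. Qed.

Lemma Im_iM z : complex.Im ('i%C * z) = complex.Re z.
Proof. by case: z => a b /=; ring. Qed.

Lemma ReV z : complex.Re z^-1 = complex.Re z / (complex.Re z ^+ 2 + complex.Im z ^+ 2).
Proof. by case: z. Qed.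

Lemma ImV z : complex.Im z^-1 = - complex.Im z / (complex.Re z ^+ 2 + complex.Im z ^+ 2).
Proof. by case: z => a b /=; rewrite mulNr. Qed.

(** The sums for the winding number of a square about its centre [p] have
    imaginary part at least [4], each of the four sides contributing at
    least [1]. *)
Lemma contour_sum_inv p (a : R) n : 0 < a ->
  4 <= normc (contour_sum (fun z => (z - p)^-1) (complex.Re p - a) (complex.Im p - a) (2 * a) n).
Proof.
move=> a0; apply: le_trans (normr_Im _); apply: le_trans (ler_norm _).
rewrite /contour_sum; set h := _ / _; have h0 : 0 < h by rewrite divr_gt0 ?mulr_gt0 ?exprn_gt0.
have ImC w : complex.Im (h%:C * w) = h * complex.Im w by case: w => c d /=; ring.
rewrite ImC 3!ImD !ImN !Im_iM !Im_sum !Re_sum.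
have bound (u v : R) : -a <= u <= a -> v = a -> (2 * a)^-1 <= v / (u ^+ 2 + v ^+ 2).
  move=> /andP[u1 u2] ->.
  have u2a : u ^+ 2 <= a ^+ 2.
    rewrite -subr_ge0 (_ : _ - _ = (a - u) * (a + u)); last by ring.
    by apply: mulr_ge0; lra.
  have p0 : 0 < u ^+ 2 + a ^+ 2 by rewrite ltr_wpDl ?sqr_ge0// exprn_gt0.
  rewrite ler_pdivlMr// mulrC ler_pdivrMr ?mulr_gt0//.
  by rewrite (_ : a * (2 * a) = a ^+ 2 + a ^+ 2); [rewrite lerD2r|ring].
have S (s : seq R[i]) (F : R[i] -> R) : size s = (2 ^ n)%N ->
    (forall z, z \in s -> (2 * a)^-1 <= F z) ->
    2 ^+ n * (2 * a)^-1 <= \sum_(z <- s) F z.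
  move=> ss sF; apply: (@le_trans _ _ (\sum_(z <- s) (2 * a)^-1)).
    rewrite big_const_seq count_predT ss iter_addr addr0 -[_ *+ (2 ^ n)]mulr_natl.
    by rewrite natrX.
  by rewrite big_seq [leRHS]big_seq; apply: ler_sum.
have a20 : 0 <= 2 * a by rewrite mulr_ge0// ltW.
have B : forall z w : R[i], (complex.Re (z - w) = complex.Re z - complex.Re w) *
   (complex.Im (z - w) = complex.Im z - complex.Im w) by move=> [? ?] [? ?].
rewrite -!sumrN.
have S1 := S _ (fun z => complex.Im (z - p)^-1)
  (size_hpts (complex.Re p - a) (complex.Im p - a) (2 * a) n).
have S2 := S _ (fun z => complex.Re (z - p)^-1)
  (size_vpts (complex.Re p - a + 2 * a) (complex.Im p - a) (2 * a) n).
have S3 := S _ (fun z => - complex.Im (z - p)^-1)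
  (size_hpts (complex.Re p - a) (complex.Im p - a + 2 * a) (2 * a) n).
have S4 := S _ (fun z => - complex.Re (z - p)^-1)
  (size_vpts (complex.Re p - a) (complex.Im p - a) (2 * a) n).
have E : 4 = h * (4 * (2 ^+ n * (2 * a)^-1)).
  by rewrite /h; field; rewrite gt_eqF// expf_neq0.
rewrite {1}E ler_pM2l//.
suff [K1 K2 K3 K4] : [/\
  (forall z, z \in hpts (complex.Re p - a) (complex.Im p - a) (2 * a) n ->
     (2 * a)^-1 <= complex.Im (z - p)^-1),
  (forall z, z \in vpts (complex.Re p - a + 2 * a) (complex.Im p - a) (2 * a) n ->
     (2 * a)^-1 <= complex.Re (z - p)^-1),
  (forall z, z \in hpts (complex.Re p - a) (complex.Im p - a + 2 * a) (2 * a) n ->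
     (2 * a)^-1 <= - complex.Im (z - p)^-1) &
  (forall z, z \in vpts (complex.Re p - a) (complex.Im p - a) (2 * a) n ->
     (2 * a)^-1 <= - complex.Re (z - p)^-1)].
  have := S1 K1; have := S2 K2; have := S3 K3; have := S4 K4; lra.
split=> z hz.
- have [/andP[z1 z2] z3] := mem_hpts a20 hz; rewrite ImV !B z3.
  have -> : complex.Im p - a - complex.Im p = - a by ring.
  by rewrite opprK sqrrN; apply: bound => //; apply/andP; split; lra.
- have [/andP[z1 z2] z3] := mem_vpts a20 hz; rewrite ReV !B z3.
  have -> : complex.Re p - a + 2 * a - complex.Re p = a by ring.
  by rewrite [X in _ / X]addrC; apply: bound => //; apply/andP; split; lra.
- have [/andP[z1 z2] z3] := mem_hpts a20 hz; rewrite ImV !B z3 mulNr opprK.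
  have -> : complex.Im p - a + 2 * a - complex.Im p = a by ring.
  by apply: bound => //; apply/andP; split; lra.
- have [/andP[z1 z2] z3] := mem_vpts a20 hz; rewrite ReV !B z3 -mulNr.
  have -> : complex.Re p - a - complex.Re p = - a by ring.
  by rewrite opprK sqrrN [X in _ / X]addrC; apply: bound => //; apply/andP; split; lra.
Qed.

Lemma bpts_dist p (a : R) n z : 0 < a ->
  z \in bpts (complex.Re p - a) (complex.Im p - a) (2 * a) n ->
  a <= normc (z - p) <= 2 * a.
Proof.
move=> a0 hz; have a20 : 0 <= 2 * a by rewrite mulr_ge0// ltW.
have B : (complex.Re (z - p) = complex.Re z - complex.Re p) *
     (complex.Im (z - p) = complex.Im z - complex.Im p).
  by move: (z) (p) => [? ?] [? ?].
have [/andP[z1 z2] /andP[z3 z4] {}hz] := mem_bpts a20 hz.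
apply/andP; split; last first.
  apply: (le_trans (normc_le_ReIm _)); rewrite !B.
  have k1 : `|complex.Re z - complex.Re p| <= a by rewrite ler_norml; apply/andP; split; lra.
  have k2 : `|complex.Im z - complex.Im p| <= a by rewrite ler_norml; apply/andP; split; lra.
  lra.
case: hz => hz.
- by apply: le_trans (normr_Re _); rewrite -normrN; apply: le_trans (ler_norm _); rewrite B; lra.
- by apply: le_trans (normr_Re _); apply: le_trans (ler_norm _); rewrite B; lra.
- by apply: le_trans (normr_Im _); rewrite -normrN; apply: le_trans (ler_norm _); rewrite B; lra.
- by apply: le_trans (normr_Im _); apply: le_trans (ler_norm _); rewrite B; lra.
Qed.

(** Goursat's lemma for the slope function of [q] at [p] gives Cauchy's formula
    up to a vanishing error, hence an inequality between a value and finite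
    sums of values, which can be integrated in a parameter. *)
Lemma mean_value_ineq q (P : seq R[i]) : (forall p, ccont q p) ->
  (forall p, p \notin P -> cdiff q p) -> forall p (a : R), p \notin P -> 0 < a ->
  forall e, 0 < e -> exists n0, forall n, (n0 <= n)%N ->
  normc (q p) <= 2 / (4 * 2 ^ n)%:R *
    (\sum_(z <- bpts (complex.Re p - a) (complex.Im p - a) (2 * a) n) normc (q z)) + e.
Proof.
move=> qc qd p a pP a0 e e0.
have a20 : 0 < 2 * a by rewrite mulr_gt0.
have [g [gE gp gc gd]] := quotient_extension (qd p pP).
have gcont z : ccont g z.
  by have [->//|zp] := eqVneq z p; exact: gc.
have gdiff z : z \notin p :: P -> cdiff g z.
  by rewrite inE negb_or => /andP[zp zP]; apply: gd => //; exact: qd.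
have [n0 h] := goursat gcont gdiff (complex.Re p - a) (complex.Im p - a) a20 e0.
exists n0 => n /h; set x := complex.Re p - a; set y := complex.Im p - a => hn.
have far z : z \in bpts x y (2 * a) n -> a <= normc (z - p) by move=> /(bpts_dist a0)/andP[].
have E : q p * contour_sum (fun z => (z - p)^-1) x y (2 * a) n =
    contour_sum (fun z => q z / (z - p)) x y (2 * a) n - contour_sum g x y (2 * a) n.
  have N : - contour_sum g x y (2 * a) n = contour_sum (fun z => -1 * g z) x y (2 * a) n.
    by rewrite contour_sumZ mulN1r.
  rewrite -contour_sumZ N -contour_sumD; apply: eq_contour_sum => z /far zp.
  have zp0 : z != p.
    by apply: contraTneq zp => ->; rewrite subrr normc0 -ltNge.
  by rewrite gE//; field; rewrite subr_eq0.
have h4 := contour_sum_inv p n a0.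
have : normc (q p) * 4 <= normc (q p * contour_sum (fun z => (z - p)^-1) x y (2 * a) n).
  by rewrite normcM ler_wpM2l// normc_ge0.
rewrite E => h5.
have h6 : normc (contour_sum (fun z => q z / (z - p)) x y (2 * a) n) <=
    2 / 2 ^+ n * \sum_(z <- bpts x y (2 * a) n) normc (q z).
  apply: le_trans (normc_contour_sum _ _ _ _ (ltW a20)) _.
  rewrite (_ : 2 / 2 ^+ n = 2 * a / 2 ^+ n * a^-1); last first.
    by field; rewrite gt_eqF// expf_neq0.
  rewrite -[leRHS]mulrA ler_pM2l ?divr_gt0 ?exprn_gt0// mulr_sumr.
  rewrite big_seq [leRHS]big_seq; apply: ler_sum => z /far zp.
  rewrite normcM normcV mulrC ler_wpM2r ?normc_ge0//.
  by rewrite lef_pV2 ?posrE// (lt_le_trans a0).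
have h7 := le_trans h5 (le_normcD _ _); rewrite normcN in h7.
rewrite natrM natrX (_ : 2 / (4 * 2 ^+ n) = 4^-1 * (2 / 2 ^+ n)); last first.
  by field; rewrite expf_neq0.
rewrite -mulrA; set S := _ * \sum_(z <- _) _ in h6 *; lra.
Qed.

End goursat.

(** * Divided differences and interpolation of families of entire functions *)

Section interpolation.
Context {R : realType}.
Implicit Types (g : R[i] -> R[i]) (ws : seq R[i]) (z w p : R[i]).

(** Divided differences, the nodes being listed last one first. *)
Fixpoint divided_diff ws g z : R[i] :=
  if ws is w :: ws' then (divided_diff ws' g z - divided_diff ws' g w) / (z - w) else g z.

(** The formula for divided differences is meaningless at the nodes; this
    extension makes the mean value inequality available. *)
Lemma divided_diff_extension ws g : (forall p, cdiff g p) -> uniq ws -> exists q,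
  [/\ forall p, ccont q p, forall p, p \notin ws -> cdiff q p &
      forall z, z \notin ws -> q z = divided_diff ws g z].
Proof.
move=> gd; elim: ws => [_|w ws ih /= /andP[wws uws]].
  by exists g; split=> // p; exact: cdiff_ccont.
have [q [qc qd qE]] := ih uws.
have [h [hE hw hc hd]] := quotient_extension (qd w wws).
exists h; split.
- by move=> p; have [->//|pw] := eqVneq p w; exact: hc.
- by move=> p; rewrite inE negb_or => /andP[pw pws]; apply: hd => //; exact: qd.
- by move=> z; rewrite inE negb_or => /andP[zw zws]; rewrite hE// !qE.
Qed.

(** Newton's interpolation polynomial. *)
Fixpoint newton ws g : {poly R[i]} :=
  if ws is w :: ws' then newton ws' g + divided_diff ws' g w *: \prod_(v <- ws') ('X - v%:P)
  else 0.

Lemma size_newton ws g : (size (newton ws g) <= size ws)%N.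
Proof.
elim: ws => [|w ws ih] /=; first by rewrite size_poly0.
apply: (leq_trans (size_polyD _ _)); rewrite geq_max (leq_trans ih)//=.
by apply: (leq_trans (size_scale_leq _ _)); rewrite size_prod_XsubC.
Qed.

(** At a new node the last factor vanishes: this is [newton_node]. *)
Lemma newton_remainder ws g z : z \notin ws ->
  g z = (newton ws g).[z] + \prod_(v <- ws) (z - v) * divided_diff ws g z.
Proof.
elim: ws => [_|w ws ih] /=; first by rewrite horner0 big_nil mul1r add0r.
rewrite inE negb_or => /andP[zw zws].
rewrite {1}ih// hornerD hornerZ horner_prod big_cons.
under [X in _ = _ + _ * X + _]eq_bigr do rewrite hornerXsubC.
by field; rewrite subr_eq0.
Qed.

Lemma newton_node ws g z : uniq ws -> z \in ws -> (newton ws g).[z] = g z.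
Proof.
elim: ws => [//|w ws ih] /= /andP[wws uws]; rewrite inE => /orP[/eqP ->|zws].
  rewrite hornerD hornerZ horner_prod [RHS](newton_remainder g wws) mulrC.
  by under eq_bigr do rewrite hornerXsubC.
rewrite hornerD ih// hornerZ horner_prod (big_rem z)//= hornerXsubC.
by rewrite subrr mul0r mulr0 addr0.
Qed.

Definition lagrange_basis (ts : seq R) (t : R) : {poly R} :=
  (\prod_(u <- rem t ts) (t - u))^-1 *: \prod_(u <- rem t ts) ('X - u%:P).

Lemma size_lagrange_basis ts t : t \in ts ->
  (size (lagrange_basis ts t) <= size ts)%N.
Proof.
move=> tts; apply: (leq_trans (size_scale_leq _ _)).
by rewrite size_prod_XsubC size_rem// prednK//; case: (ts) tts.
Qed.

Lemma lagrange_basisE ts t u : uniq ts -> t \in ts -> u \in ts ->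
  (lagrange_basis ts t).[u] = (u == t)%:R.
Proof.
move=> uts tts uin; rewrite hornerZ horner_prod.
under [X in _ * X]eq_bigr do rewrite hornerXsubC.
have [->|ut] := eqVneq u t.
  rewrite mulVf//; rewrite prodf_seq_neq0; apply/allP => v.
  by rewrite mem_rem_uniq// inE => /andP[vt _]; rewrite /= subr_eq0 eq_sym.
have uin' : u \in rem t ts by rewrite mem_rem_uniq// inE ut.
by rewrite [X in _ * X](big_rem u)//= subrr mul0r mulr0.
Qed.

(** Interpolation at real nodes, evaluated at real points. *)
Definition interp (ts : seq R) (g : R -> R[i]) (t : R) : R[i] :=
  \sum_(u <- ts) ((lagrange_basis ts u).[t])%:C * g u.

Lemma interp_newton ts g t : uniq ts ->
  interp ts (fun u => g u%:C) t = (newton [seq u%:C | u <- ts] g).[t%:C].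
Proof.
move=> uts; set ws := [seq _ | _ <- _].
have uws : uniq ws by rewrite map_inj_uniq//; exact: complexI.
pose P : {poly R[i]} := \sum_(u <- ts) g u%:C *: map_poly (real_complex R) (lagrange_basis ts u).
have PE v : P.[v%:C] = interp ts (fun u => g u%:C) v.
  rewrite /P horner_sum; apply: eq_bigr => u _.
  by rewrite hornerZ horner_map mulrC.
rewrite -PE; congr (_.[_]); apply/eqP; rewrite -subr_eq0; apply/eqP.
apply: (@roots_geq_poly_eq0 _ _ ws) => //.
  apply/allP => _ /mapP[v vts ->]; rewrite /root hornerD hornerN subr_eq0 PE.
  rewrite newton_node// ?map_f// /interp (big_rem v)//= lagrange_basisE// eqxx mul1r.
  rewrite big_seq big1 ?addr0// => u; rewrite mem_rem_uniq// inE => /andP[uv uin].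
  by rewrite lagrange_basisE// eq_sym (negPf uv) mul0r.
rewrite size_map; apply: (leq_trans (size_polyD _ _)); rewrite size_polyN geq_max.
rewrite -(size_map (real_complex R) ts) size_newton andbT.
rewrite /P big_seq; elim/big_rec : _ => [|u Q uts' ih]; first by rewrite size_poly0.
apply: (leq_trans (size_polyD _ _)); rewrite geq_max ih andbT.
apply: (leq_trans (size_scale_leq _ _)); rewrite size_map_poly size_map.
exact: size_lagrange_basis.
Qed.

(** A relation [B u K], to be read: the norm of [u] is at most [K]. The last
    axiom is a form of Fatou's lemma, for a function that is asymptotically
    dominated by twice the means of finite families. *)
Record norm_bound (X : Type) (D : set X) (B : (X -> R[i]) -> R -> Prop) := NormBound {
  nb_add : forall u v K L, B u K -> B v L -> B (fun x => u x + v x) (K + L) ;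
  nb_scale : forall c u K, B u K -> B (fun x => c * u x) (normc c * K) ;
  nb_le : forall u K L, K <= L -> B u K -> B u L ;
  nb_mean : forall u L K (s : nat -> seq R[i]) (v : R[i] -> X -> R[i]),
    B u L -> (forall n, (0 < size (s n))%N) ->
    (forall n z, z \in s n -> B (v z) K) ->
    (forall x, D x -> forall e, 0 < e -> exists n0, forall n, (n0 <= n)%N ->
       normc (u x) <= 2 / (size (s n))%:R * (\sum_(z <- s n) normc (v z x)) + e) ->
    B u (2 * K) }.

Section family.
Variables (X : Type) (D : set X) (B : (X -> R[i]) -> R -> Prop).
Hypothesis nb : norm_bound D B.

Lemma nb_sub u v K L : B u K -> B v L -> B (fun x => u x - v x) (K + L).
Proof.
move=> uK vL; rewrite (_ : (fun x => _) = fun x => u x + (-1) * v x).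
  apply: (nb_add nb) => //; have := nb_scale nb (-1) vL.
  by rewrite normcN normc1 mul1r.
by apply/funext => x; rewrite mulN1r.
Qed.

Lemma nb_zero u K : B u K -> B (fun=> 0) 0.
Proof.
move=> /(nb_scale nb 0); rewrite normc0 mul0r.
by congr B; apply/funext => x; rewrite mul0r.
Qed.

Lemma nb_sum (I : eqType) (r : seq I) (c : I -> R[i]) (u : I -> X -> R[i]) :
  (exists v K, B v K) ->
  (forall i, i \in r -> exists L, B (u i) L) ->
  exists L, B (fun x => \sum_(i <- r) c i * u i x) L.
Proof.
move=> [v [K vK]]; elim: r => [_|i r ih h].
  by exists 0; have := nb_zero vK; congr B; apply/funext => x; rewrite big_nil.
have [L1 h1] := ih (fun j jr => h j (mem_behead (s := i :: r) jr)).
have [L2 h2] := h i (mem_head _ _).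
eexists; have := nb_add nb (nb_scale nb (c i) h2) h1.
by congr B; apply/funext => x; rewrite big_cons.
Qed.

Variables (g : X -> R[i] -> R[i]).
Hypothesis gd : forall x, D x -> forall p, cdiff (g x) p.
Hypothesis gB : forall z, exists L, B (g ^~ z) L.

(** Each new divided difference is first bounded far from the nodes, where its
    denominator is at least [8 * rho], and then near them by the mean value
    inequality, at the price of a factor [2]. *)
Lemma divided_diff_bounded ws z : exists L, B (fun x => divided_diff ws (g x) z) L.
Proof.
elim: ws z => [|w ws ih] z //=; have [L1 h1] := ih z; have [L2 h2] := ih w.
eexists; have := nb_scale nb (z - w)^-1 (nb_sub h1 h2).
by congr B; apply/funext => x; rewrite mulrC.
Qed.

Lemma divided_diff_bound (rho K : R) : 0 < rho -> 0 <= K ->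
  (forall z, normc z <= 21 * rho -> B (g ^~ z) K) ->
  forall ws, uniq ws -> (forall w, w \in ws -> normc w <= rho) ->
  (forall z, 9 * rho <= normc z <= 21 * rho ->
    B (fun x => divided_diff ws (g x) z) (K * (3 / (8 * rho)) ^+ size ws)) /\
  (forall z, normc z <= rho -> z \notin ws ->
    B (fun x => divided_diff ws (g x) z) (2 * (K * (3 / (8 * rho)) ^+ size ws))).
Proof.
move=> rho0 K0 gK; elim=> [_ _|w ws ih /= /andP[wws uws] wr].
  have gK' z : normc z <= 21 * rho -> B (g ^~ z) (2 * (K * 1)).
    move=> zr; rewrite mulr1; apply: (@nb_mean _ _ _ nb _ K _ (fun=> [:: z]) (fun z x => g x z)) => //.
    - exact: gK.
    - by move=> _ y; rewrite inE => /eqP ->; exact: gK.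
    - move=> x _ e e0; exists 0%N => _ _; rewrite big_seq1 divr1.
      by have := normc_ge0 (g x z); lra.
  split => [z /andP[_ zr]|z zr _]; rewrite /= expr0 ?mulr1.
    exact: gK.
  by have := gK' z; rewrite mulr1; apply; apply: (le_trans zr); lra.
have [far near] := ih uws (fun v vws => wr v (mem_behead (s := w :: ws) vws)).
have wr' : normc w <= rho by apply: wr; rewrite mem_head.
have ann z : 9 * rho <= normc z <= 21 * rho ->
    B (fun x => (divided_diff ws (g x) z - divided_diff ws (g x) w) / (z - w))
      (K * (3 / (8 * rho)) ^+ (size ws).+1).
  move=> zr; have := nb_scale nb (z - w)^-1 (nb_sub (far z zr) (near w wr' wws)).
  rewrite (_ : (fun x => _) = fun x => (divided_diff ws (g x) z - divided_diff ws (g x) w) / (z - w)); last first.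
    by apply/funext => x; rewrite mulrC.
  apply: (nb_le nb); rewrite normcV.
  set K' := K * (3 / (8 * rho)) ^+ size ws; have K'0 : 0 <= K'.
    by rewrite mulr_ge0// exprn_ge0// divr_ge0// mulr_ge0// ltW.
  rewrite (_ : K' + 2 * K' = 3 * K'); last by ring.
  rewrite exprS [leRHS](_ : _ = 3 * ((8 * rho)^-1 * K')); last by rewrite /K'; ring.
  rewrite mulrCA ler_pM2l// ler_wpM2r//.
  rewrite lef_pV2 ?posrE ?mulr_gt0//.
    by move/andP: zr => [z1 _]; apply: le_trans (ler_normc_sub _ _); lra.
  by move/andP: zr => [z1 _]; apply: lt_le_trans (ler_normc_sub _ _); lra.
split; first exact: ann.
move=> z zr zws; have [L hL] := divided_diff_bounded (w :: ws) z.
pose s n := bpts (complex.Re z - 10 * rho) (complex.Im z - 10 * rho) (2 * (10 * rho)) n.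
have r10 : 0 < 10 * rho by rewrite mulr_gt0.
apply: (@nb_mean _ _ _ nb _ L _ s (fun v x => divided_diff (w :: ws) (g x) v)) => //.
- by move=> n; rewrite size_bpts muln_gt0 expn_gt0.
- move=> n v /(bpts_dist r10)/andP[v1 v2]; apply: ann; apply/andP; split.
    have : normc (v - z) <= normc v + normc z by rewrite -(normcN z) le_normcD.
    lra.
  have : normc v <= normc (v - z) + normc z by rewrite -{1}(subrK z v) le_normcD.
  lra.
- move=> x Dx e e0.
  have [q [qc qd qE]] := @divided_diff_extension (w :: ws) (g x) (gd Dx) (introT andP (conj wws uws)).
  have [n0 h] := mean_value_ineq qc qd zws r10 e0.
  exists n0 => n /h; rewrite qE// size_bpts.
  rewrite [X in _ <= _ * X + _ -> _](_ : _ = \sum_(v <- s n) normc (divided_diff (w :: ws) (g x) v))//.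
  apply: eq_big_seq => v /(bpts_dist r10)/andP[v1 v2]; rewrite qE//.
  apply/negP => vws; have := wr _ vws.
  have : normc (v - z) <= normc v + normc z by rewrite -(normcN z) le_normcD.
  lra.
Qed.

(** The remainder is a product of [size ts] factors of modulus at most
    [2 * rho] with a divided difference, so each node gains a factor [3 / 4]. *)
Lemma interp_error_bound (rho K : R) : 0 < rho -> 0 <= K ->
  (forall z, normc z <= 21 * rho -> B (g ^~ z) K) ->
  forall ts, uniq ts -> (forall u, u \in ts -> `|u| <= rho) ->
  forall t, `|t| <= rho ->
  B (fun x => g x t%:C - interp ts (fun u => g x u%:C) t)
    (2 * K * (3 / 4) ^+ size ts).
Proof.
move=> rho0 K0 gK ts uts tsr t tr.
have uws : uniq [seq u%:C | u <- ts] by rewrite map_inj_uniq//; exact: complexI.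
have wsr w : w \in [seq u%:C | u <- ts] -> normc w <= rho.
  by move=> /mapP[u uts' ->]; rewrite normc_real tsr.
have [tin|tnin] := boolP (t%:C \in [seq u%:C | u <- ts]).
  have [L gL] := gB 0; have := nb_zero gL.
  rewrite (_ : (fun x => _) = fun=> 0).
    by apply: (nb_le nb); rewrite !mulr_ge0// exprn_ge0// divr_ge0.
  by apply/funext => x; rewrite (interp_newton (g x))// newton_node// subrr.
have [_ near] := divided_diff_bound rho0 K0 gK uws wsr.
have {near} := near t%:C; rewrite normc_real => /(_ tr tnin).
move=> /(nb_scale nb (\prod_(v <- [seq u%:C | u <- ts]) (t%:C - v))).
rewrite (_ : (fun x => _) = fun x => g x t%:C - interp ts (fun u => g x u%:C) t); last first.
  apply/funext => x; rewrite (interp_newton (g x))//.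
  by rewrite [g x t%:C](newton_remainder (g x) tnin) addrAC subrr add0r.
apply: (nb_le nb); rewrite size_map big_map.
have : normc (\prod_(u <- ts) (t%:C - u%:C)) <= (2 * rho) ^+ size ts.
  elim: ts tsr {uts uws wsr tnin} => [|u ts ih] tsr; first by rewrite big_nil normc1.
  rewrite big_cons normcM exprS ler_pM ?normc_ge0 ?ih//; last first.
    by move=> v vts; rewrite tsr// mem_behead.
  rewrite -rmorphB normc_real (le_trans (ler_normB _ _))//.
  by have := tsr u (mem_head _ _); lra.
move=> /ler_wpM2r h; apply: le_trans (h _ _) _.
  by rewrite !mulr_ge0// exprn_ge0// divr_ge0// mulr_ge0// ltW.
rewrite (_ : 3 / 4 = 3 / (8 * rho) * (2 * rho)); last by field; rewrite gt_eqF.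
by rewrite (exprMn _ (3 / (8 * rho)) (2 * rho)) le_eqVlt; apply/orP; left; apply/eqP; ring.
Qed.

End family.
End interpolation.

(** * Interpolation in several variables *)

Section update.
Context {T : Type} {N : nat}.
Implicit Types (z : 'rV[T]_N) (j : 'I_N) (w : T).

Definition upd z j w : 'rV[T]_N := \row_i (if i == j then w else z ord0 i).

Lemma upd_same z j w : upd z j w ord0 j = w.
Proof. by rewrite mxE eqxx. Qed.

Lemma upd_other z j w i : i != j -> upd z j w ord0 i = z ord0 i.
Proof. by rewrite mxE => /negPf ->. Qed.

Lemma upd_id z j : upd z j (z ord0 j) = z.
Proof. by apply/rowP => i; rewrite mxE; case: eqP => [->|]. Qed.

Lemma upd_upd z j v w : upd (upd z j v) j w = upd z j w.
Proof. by apply/rowP => i; rewrite !mxE; case: eqP. Qed.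

Lemma updC z i j v w : i != j -> upd (upd z i v) j w = upd (upd z j w) i v.
Proof.
move=> ij; apply/rowP => k; rewrite !mxE; case: eqP => [->|//].
by rewrite eq_sym (negPf ij).
Qed.

End update.

Lemma map_upd (R : realType) N (z : 'rV[R]_N) j (w : R) :
  map_mx (real_complex R) (upd z j w) = upd (map_mx (real_complex R) z) j w%:C.
Proof. by apply/rowP => i; rewrite !mxE; case: ifP. Qed.

Section tensor_interpolation.
Context {R : realType} {N : nat}.
Variables (X : Type) (D : set X) (B : (X -> R[i]) -> R -> Prop).
Hypothesis nb : norm_bound D B.
Variables (rho K : R) (ts : seq R).
Hypotheses (rho0 : 0 < rho) (K0 : 0 <= K) (uts : uniq ts)
  (tsr : forall u, u \in ts -> `|u| <= rho).
Implicit Types (F : X -> 'rV[R[i]]_N -> R[i]) (z : 'rV[R[i]]_N) (i j : 'I_N).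

(** Only the values at real [z_j] matter, and taking the real part keeps the
    coefficients real. *)
Definition interp_coord j F x z : R[i] :=
  interp ts (fun u => F x (upd z j u%:C)) (complex.Re (z ord0 j)).

Definition interp_coords (J : seq 'I_N) F := foldr interp_coord F J.

Variable f : X -> 'rV[R[i]]_N -> R[i].
Hypothesis fd : forall x, D x -> forall z j p, cdiff (fun w => f x (upd z j w)) p.
Hypothesis fB : forall z, exists L, B (f ^~ z) L.
Hypothesis fK : forall z, (forall j, normc (z ord0 j) <= 21 * rho) -> B (f ^~ z) K.

Lemma interp_coords_bounded J z : exists L, B ((interp_coords J f) ^~ z) L.
Proof.
elim: J z => [|j J ih] z //=.
apply: (@nb_sum _ _ D B nb _ ts (fun u => ((lagrange_basis ts u).[complex.Re (z ord0 j)])%:C)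
  (fun u x => interp_coords J f x (upd z j u%:C))).
  by have [L] := ih z; exists (fun x => interp_coords J f x z), L.
by move=> u _; exact: ih.
Qed.

Lemma cdiff_interp_coords J x z i p : D x -> i \notin J ->
  cdiff (fun w => interp_coords J f x (upd z i w)) p.
Proof.
move=> Dx; elim: J z => [|j J ih] z /=; first by move=> _; exact: fd.
rewrite inE negb_or => /andP[ij iJ].
rewrite /interp_coord /interp; apply: cdiff_sum => u.
rewrite (_ : (fun w => _) = fun w => ((lagrange_basis ts u).[complex.Re (z ord0 j)])%:C *
    interp_coords J f x (upd (upd z j u%:C) i w)).
  by apply: cdiffZ; exact: ih.
by apply/funext => w; rewrite upd_other 1?eq_sym// updC.
Qed.

Let eta : R := (3 / 4) ^+ size ts.

Let eta1 : 0 <= eta <= 1.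
Proof. by rewrite exprn_ge0 ?divr_ge0//= exprn_ile1// ?divr_ge0//; lra. Qed.

(** Variables in [J] have been interpolated and stay real in the small
    interval; the others still range over a large disc. *)
Let box (J : seq 'I_N) z := (forall i, i \in J -> z ord0 i = (complex.Re (z ord0 i))%:C /\
    `|complex.Re (z ord0 i)| <= rho) /\
  (forall i, i \notin J -> normc (z ord0 i) <= 21 * rho).

Lemma interp_coords_step_error j J z : j \notin J ->
  (forall z, box J z -> B ((interp_coords J f) ^~ z) (3 ^+ size J * K)) ->
  box (j :: J) z ->
  B (fun x => interp_coords J f x z - interp_coords (j :: J) f x z)
    (2 * (3 ^+ size J * K) * eta).
Proof.
move=> jJ ih [zJ zJ'].
have [zj zjr] := zJ j (mem_head _ _).
have := @interp_error_bound _ _ _ _ nb (fun x w => interp_coords J f x (upd z j w)) _ _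
  rho (3 ^+ size J * K) rho0 _ _ ts uts tsr (complex.Re (z ord0 j)) zjr.
rewrite (_ : (fun x => _) = fun x => interp_coords J f x z - interp_coords (j :: J) f x z); last first.
  by apply/funext => x; rewrite -zj upd_id.
apply.
- by move=> x Dx p; exact: cdiff_interp_coords.
- by move=> w; exact: interp_coords_bounded.
- by rewrite mulr_ge0// exprn_ge0.
- move=> w wr; apply: ih; split=> i iJ.
    have ij : i != j by apply: contraNneq jJ => <-.
    by rewrite upd_other//; apply: zJ; rewrite inE iJ orbT.
  have [->|ij] := eqVneq i j; first by rewrite upd_same.
  by rewrite upd_other// zJ'// inE negb_or ij.
Qed.

(** The interpolant in one more variable differs from the previous one by at
    most twice its bound, hence the factor [3] per variable. *)
Lemma interp_coords_box_bound J z : uniq J -> box J z ->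
  B ((interp_coords J f) ^~ z) (3 ^+ size J * K).
Proof.
elim: J z => [|j J ih] z /=.
  by move=> _ [_ h]; rewrite expr0 mul1r; apply: fK => i; exact: h.
move=> /andP[jJ uJ] bz; have bz' : box J z.
  case: bz => zJ zJ'; split=> i iJ; first by apply: zJ; rewrite inE iJ orbT.
  have [->|ij] := eqVneq i j; last by apply: zJ'; rewrite inE negb_or ij.
  have [-> h] := zJ j (mem_head _ _); rewrite normc_real (le_trans h)//.
  by have := rho0; lra.
have h1 := ih z uJ bz'.
have := nb_sub nb h1 (interp_coords_step_error jJ (fun z => ih z uJ) bz).
rewrite (_ : (fun x => _) = (interp_coord j (interp_coords J f)) ^~ z); last first.
  by apply/funext => x; rewrite subKr.
apply: (nb_le nb); case/andP: eta1 => _ e1.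
have : 3 ^+ size J * K * eta <= 3 ^+ size J * K.
  by rewrite ler_piMr// mulr_ge0// exprn_ge0.
by rewrite exprS; lra.
Qed.

Lemma interp_coords_error_bound J z : uniq J ->
  (forall i, z ord0 i = (complex.Re (z ord0 i))%:C /\ `|complex.Re (z ord0 i)| <= rho) ->
  B (fun x => f x z - interp_coords J f x z) (3 ^+ size J * K * eta).
Proof.
move=> uJ zr; have bz J' : box J' z.
  split=> i _ //; have [-> h] := zr i; rewrite normc_real (le_trans h)//.
  by have := rho0; lra.
elim: J uJ => [_|j J ih /= /andP[jJ uJ]].
  have [L fL] := fB z; have := nb_zero nb fL.
  rewrite (_ : (fun=> 0) = fun x => f x z - interp_coords [::] f x z); last first.
    by apply/funext => x; rewrite subrr.
  by apply: (nb_le nb); rewrite expr0 mul1r mulr_ge0//; case/andP: eta1.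
have := nb_add nb (ih uJ) (interp_coords_step_error jJ (fun z => @interp_coords_box_bound J z uJ) (bz (j :: J))).
rewrite (_ : (fun x => _) = fun x => f x z - interp_coords (j :: J) f x z); last first.
  by apply/funext => x; rewrite addrA subrK.
by apply: (nb_le nb); rewrite exprS; lra.
Qed.

Section functional.
Variable Lam : (X -> R[i]) -> R.
Hypothesis LamD : forall u v K L, B u K -> B v L ->
  Lam (fun x => u x + v x) = Lam u + Lam v.
Hypothesis LamZ : forall (c : R) u K, B u K -> Lam (fun x => c%:C * u x) = c * Lam u.

Lemma functional_zero : Lam (fun=> 0) = 0.
Proof.
have [L h] := fB 0; rewrite -[RHS](mul0r (Lam (f ^~ 0))) -(LamZ _ h).
by congr Lam; apply/funext => x; rewrite rmorph0 mul0r.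
Qed.

Lemma functional_sum (I : eqType) (r : seq I) (c : I -> R) (u : I -> X -> R[i]) :
  (forall k, k \in r -> exists L, B (u k) L) ->
  Lam (fun x => \sum_(k <- r) (c k)%:C * u k x) = \sum_(k <- r) c k * Lam (u k).
Proof.
have nz : exists v K, B v K by have [L h] := fB 0; exists (f ^~ 0), L.
elim: r => [_|k r ih h].
  rewrite big_nil -[RHS]functional_zero; congr Lam.
  by apply/funext => x; rewrite big_nil.
have hr k' : k' \in r -> exists L, B (u k') L.
  by move=> jr; apply: h; rewrite inE jr orbT.
have [L2 h2] := h k (mem_head _ _).
have [L1 h1] := nb_sum nb (fun k => (c k)%:C) nz hr.
rewrite big_cons -ih// -(LamZ _ h2) -(LamD (nb_scale nb _ h2) h1).
by congr Lam; apply/funext => x; rewrite big_cons.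
Qed.

Definition real_interp_coord j (G : 'rV[R]_N -> R) (z : 'rV[R]_N) : R :=
  \sum_(u <- ts) (lagrange_basis ts u).[z ord0 j] * G (upd z j u).

(** Real linear functionals commute with interpolation, as the nodes and the
    evaluation points are real. *)
Lemma functional_interp_coords J (z : 'rV[R]_N) :
  Lam ((interp_coords J f) ^~ (map_mx (real_complex R) z)) =
  foldr real_interp_coord (fun z : 'rV[R]_N => Lam (f ^~ (map_mx (real_complex R) z))) J z.
Proof.
elim: J z => [|j J ih] z //=.
rewrite /real_interp_coord -[RHS]/(\sum_(u <- ts) _).
under [RHS]eq_bigr do rewrite -ih map_upd.
rewrite /interp_coord /interp mxE.
rewrite (functional_sum (fun u => (lagrange_basis ts u).[z ord0 j])
  (u := fun u x => interp_coords J f x (upd (map_mx (real_complex R) z) j u%:C)))//.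
by move=> u _; exact: interp_coords_bounded.
Qed.

End functional.

(** A function of several variables that is a polynomial of size at most [n]
    in each of them separately. *)
Definition poly_in n j (G : 'rV[R]_N -> R) := forall z : 'rV[R]_N,
  exists2 p : {poly R}, (size p <= n)%N & forall t, G (upd z j t) = p.[t].

Lemma poly_in_sum n j (I : Type) (r : seq I) (c : I -> R) (G : I -> 'rV[R]_N -> R) :
  (forall k, poly_in n j (G k)) -> poly_in n j (fun z : 'rV[R]_N => \sum_(k <- r) c k * G k z).
Proof.
move=> h z; elim: r => [|k r [p sp pE]].
  by exists 0; rewrite ?size_poly0// => t; rewrite big_nil horner0.
have [q sq qE] := h k z; exists (c k *: q + p).
  by rewrite (leq_trans (size_polyD _ _))// geq_max sp (leq_trans (size_scale_leq _ _)).
by move=> t; rewrite big_cons pE qE hornerD hornerZ.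
Qed.

Lemma poly_in_exp n j G k : poly_in n.+1 j G -> poly_in (k * n).+1 j (fun z : 'rV[R]_N => G z ^+ k).
Proof.
move=> h z; have [p sp pE] := h z; exists (p ^+ k); last by move=> t; rewrite pE horner_exp.
rewrite (leq_trans (size_poly_exp_leq _ _))// ltnS mulnC leq_mul2l; apply/orP; right.
by case: (size p) sp.
Qed.

Lemma poly_in_interp_coords J (G : 'rV[R]_N -> R) j :
  j \in J -> poly_in (size ts) j (foldr real_interp_coord G J).
Proof.
elim: J => [//|i J ih] /=; have [->|ij] := eqVneq j i => jJ z.
  exists (\sum_(u <- ts) foldr real_interp_coord G J (upd z i u) *: lagrange_basis ts u).
    rewrite big_seq; elim/big_rec : _ => [|u p uin sp]; first by rewrite size_poly0.
    rewrite (leq_trans (size_polyD _ _))// geq_max sp andbT.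
    by rewrite (leq_trans (size_scale_leq _ _))// size_lagrange_basis.
  move=> t; rewrite /real_interp_coord horner_sum; apply: eq_bigr => u _.
  by rewrite [RHS]hornerZ upd_same upd_upd [RHS]mulrC.
move: jJ; rewrite inE (negPf ij) /= => jJ.
have h u : poly_in (size ts) j (fun z' : 'rV[R]_N => foldr real_interp_coord G J (upd z' i u)).
  move=> z'; have [p sp pE] := ih jJ (upd z' i u); exists p => // t.
  by rewrite -pE updC// eq_sym.
have [p sp pE] := poly_in_sum ts (fun u => (lagrange_basis ts u).[z ord0 i]) h z.
by exists p => // t; rewrite -pE /real_interp_coord upd_other// eq_sym.
Qed.

End tensor_interpolation.

(** * Counting: dominant matrices and codes *)

Section separate_polynomials.
Context {R : realType} {N : nat}.
Implicit Types (G : 'rV[R]_N -> R) (z : 'rV[R]_N).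

(** Set the variables free one after the other: a polynomial of size at most [n]
    with [n] roots vanishes. *)
Lemma poly_in_grid_zero n G : (forall j, poly_in n j G) ->
  (forall k : {ffun 'I_N -> 'I_n}, G (\row_j (k j)%:R) = 0) -> forall z, G z = 0.
Proof.
move=> Gn G0.
suff H : forall m, (m <= N)%N -> forall z,
    (forall j : 'I_N, (m <= j)%N -> exists k : 'I_n, z ord0 j = k%:R) -> G z = 0.
  by move=> z; apply: (H N) => // j; rewrite leqNgt ltn_ord.
elim=> [_ z hz|m ih mN z hz].
  have /choice[k hk] j : exists k : 'I_n, z ord0 j = k%:R by exact: hz.
  rewrite -[RHS](G0 [ffun j => k j]); congr G.
  by apply/rowP => j; rewrite mxE ffunE -hk.
pose j := Ordinal mN.
have [p sp pE] := Gn j z.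
rewrite -(upd_id z j) pE.
suff -> : p = 0 by rewrite horner0.
pose rs : seq R := [seq (k : nat)%:R | k <- iota 0 n].
apply: (@roots_geq_poly_eq0 _ p rs).
- apply/allP => _ /mapP[k kn ->]; rewrite mem_iota add0n in kn.
  rewrite /root -pE; apply/eqP; apply: ih; first exact: ltnW.
  move=> i mi; have [->|ij] := eqVneq i j.
    by exists (Ordinal kn); rewrite upd_same.
  rewrite upd_other//; apply: hz; rewrite ltn_neqAle mi andbT.
  by apply: contra ij => /eqP h; apply/eqP/val_inj.
- by rewrite map_inj_uniq ?iota_uniq//; exact: mulrIn (oner_neq0 _).
- by rewrite size_map size_iota.
Qed.

(** The matrix of values is non singular, while functions of size at most [n] in
    each of [N] variables are determined by their values on a grid of [n ^ N]
    points. *)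
Lemma dominant_card n (A : finType) (V : A -> 'rV[R]_N -> R) (zeta : A -> 'rV[R]_N) :
  (forall a j, poly_in n j (V a)) ->
  (forall a, \sum_(b | b != a) `|V b (zeta a)| < `|V a (zeta a)|) ->
  (#|A| <= n ^ N)%N.
Proof.
move=> Vn dom; rewrite leqNgt; apply/negP => An.
pose M : 'M[R]_(#|A|, #|{: {ffun 'I_N -> 'I_n}}|) :=
  \matrix_(i, k) V (enum_val i) (\row_j ((enum_val k : {ffun 'I_N -> 'I_n}) j)%:R).
have : kermx M != 0.
  rewrite kermx_eq0 /row_free neq_ltn; apply/orP; left.
  by rewrite (leq_ltn_trans (rank_leq_col _))// card_ffun !card_ord.
case/rowV0Pn => c /sub_kermxP cM c0.
pose C a := c ord0 (enum_rank a).
have Cz z : \sum_a C a * V a z = 0.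
  apply: (@poly_in_grid_zero n (fun z => \sum_a C a * V a z)) => [j|k].
    exact: poly_in_sum.
  have /rowP/(_ (enum_rank k)) := cM; rewrite !mxE => E; rewrite -[RHS]E {E}.
  rewrite (reindex_onto enum_val enum_rank)/=; last by move=> a _; rewrite enum_rankK.
  rewrite (eq_bigl xpredT); last by move=> i; rewrite enum_valK eqxx.
  by apply: eq_bigr => i _; rewrite !mxE /C enum_valK enum_rankK.
have [i ci] : exists i, c ord0 i != 0.
  apply: contrapT => h; case/eqP: c0; apply/rowP => i; rewrite mxE.
  by apply/eqP; apply: contrapT => hi; apply: h; exists i; apply/negP.
pose a0 := enum_val i.
have [a _ amax] := @arg_maxP _ _ _ a0 xpredT (fun a => `|C a|) isT.
have Ca : 0 < `|C a|.
  by apply: lt_le_trans (amax a0 isT); rewrite normr_gt0 /C enum_valK.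
have := Cz (zeta a); rewrite (bigD1 a)//= => /eqP.
rewrite addr_eq0 => /eqP /(congr1 (fun t => `|t|)); rewrite normrN normrM => E.
have : `|C a| * `|V a (zeta a)| <= `|C a| * \sum_(b | b != a) `|V b (zeta a)|.
  rewrite E (le_trans (ler_norm_sum _ _ _))// mulr_sumr.
  by apply: ler_sum => b _; rewrite normrM ler_wpM2r//; exact: amax.
by rewrite ler_pM2l// leNgt dom.
Qed.

End separate_polynomials.

Section code.
Local Close Scope classical_set_scope.
Variable J : finType.
Implicit Types (e : {ffun J -> bool}) (S : {set {ffun J -> bool}}).

Definition hamming e e' : nat := #|[set j | e j != e' j]|.

Lemma hamming_sym e e' : hamming e e' = hamming e' e.
Proof.
rewrite /hamming; congr (#|pred_of_set _|).
by apply/finset.setP => j; rewrite !inE eq_sym.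
Qed.

Definition hamming_ball e : {set {ffun J -> bool}} :=
  [set e' | (16 * hamming e e' <= #|J|)%N].

(** The generating function of the Hamming distance at [1 / 8], multiplied by
    [8 ^ #|J|]; it is a product over the places. *)
Lemma hamming_gf e : (\sum_e' 8 ^ (#|J| - hamming e e') = 9 ^ #|J|)%N.
Proof.
transitivity (\sum_(e' : {ffun J -> bool}) \prod_j (if e' j == e j then 8 else 1))%N.
  apply: eq_bigr => e' _; rewrite -big_mkcond/= prod_nat_const; congr (_ ^ _)%N.
  rewrite /hamming -(cardC [set j | e j != e' j]) addKn.
  by apply: eq_card => j; rewrite !inE negbK eq_sym.
rewrite -(bigA_distr_bigA (fun j b => if b == e j then 8 else 1)%N)/=.
rewrite -[X in (_ ^ X)%N]cardsT -prod_nat_const.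
rewrite [RHS](eq_bigl xpredT); last by move=> j; rewrite inE.
by apply: eq_bigr => j _; rewrite big_bool; case: (e j).
Qed.

(** Chernoff's bound: a member of the ball contributes at least
    [8 ^ (#|J| - #|J| / 16)] to the generating function. *)
Lemma card_hamming_ball e : (#|hamming_ball e| ^ 16 <= 2 ^ (7 * #|J|))%N.
Proof.
set M := #|J|; set V := #|_|; pose q := (M %/ 16)%N.
have h : (V * 8 ^ M <= 9 ^ M * 8 ^ q)%N.
  rewrite -{1}(subnK (leq_div M 16)) -/q expnD mulnA leq_mul2r; apply/orP; right.
  rewrite -(hamming_gf e) -sum_nat_const.
  rewrite [leqRHS](bigID (fun e' => e' \in hamming_ball e))/=; apply: leq_trans (leq_addr _ _).
  apply: leq_sum => e'; rewrite inE => he; rewrite leq_pexp2l// leq_sub2l//.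
  by rewrite leq_divRL// mulnC.
have h2 : ((V * 8 ^ M) ^ 16 <= (9 ^ M * 8 ^ q) ^ 16)%N by rewrite leq_exp2r.
(* 9 ^ 4 <= 2 * 8 ^ 4 *)
have h3 : ((9 ^ M) ^ 16 <= (2 * 8 ^ 4) ^ (4 * M))%N.
  rewrite -expnM (_ : M * 16 = 4 * (4 * M))%N; last by lia.
  rewrite [X in (X <= _)%N]expnM; case: (posnP (4 * M)) => [->|m0]; first by rewrite !expn0.
  by rewrite leq_exp2r.
have h4 : ((8 ^ q) ^ 16 <= 8 ^ M)%N by rewrite -expnM leq_pexp2l// leq_trunc_div.
have : (V ^ 16 * (8 ^ M) ^ 16 <= (2 ^ (7 * M)) * (8 ^ M) ^ 16)%N.
  rewrite -expnMn (leq_trans h2)// expnMn (leq_trans (leq_mul h3 h4))//.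
  rewrite (_ : 8 = 2 ^ 3)%N// -!expnM -expnS -!expnM -!expnD leq_pexp2l//; lia.
by rewrite leq_pmul2r// !expn_gt0.
Qed.

(** The Gilbert-Varshamov bound: the balls around the members of a maximal code
    cover everything. *)
Lemma large_code : exists S, (forall e e', e \in S -> e' \in S -> e != e' ->
  (#|J| < 16 * hamming e e')%N) /\ (2 ^ #|J| <= #|S| ^ 2)%N.
Proof.
pose code S := [forall e, forall e', (e \in S) ==> (e' \in S) ==> (e != e') ==>
  (#|J| < 16 * hamming e e')%N].
have h0 : code finset.set0 by apply/forallP => e; apply/forallP => e'; rewrite inE.
have [S /maxsetP[/forallP cS Smax]] := ex_maxset (ex_intro (fun S => code S) _ h0).
have {}cS e e' : e \in S -> e' \in S -> e != e' -> (#|J| < 16 * hamming e e')%N.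
  by move=> h1 h2 h3; have /forallP/(_ e') := cS e; rewrite h1 h2 h3.
exists S; split=> //.
have cover e : exists2 e', e' \in S & e \in hamming_ball e'.
  apply: contrapT => h.
  have far e' : e' \in S -> (#|J| < 16 * hamming e e')%N.
    move=> e'S; rewrite ltnNge hamming_sym; apply/negP => le.
    by apply: h; exists e' => //; rewrite inE.
  have eS : e \notin S.
    apply/negP => /far; rewrite /hamming (_ : [set j | _] = finset.set0) ?cards0//.
    by apply/finset.setP => j; rewrite !inE eqxx.
  suff : e |: S = S by move=> E; move: eS; rewrite -E setU11.
  apply: Smax; last exact: finset.subsetUr.
  apply/forallP => a; apply/forallP => b; apply/implyP; rewrite !inE => ha.
  apply/implyP => hb; apply/implyP => ab.
  case/orP: ha => [/eqP ha|aS]; case/orP: hb => [/eqP hb|bS].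
  - by move: ab; rewrite ha hb eqxx.
  - by rewrite ha far.
  - by rewrite hb hamming_sym far.
  - exact: cS.
have h1 : (2 ^ #|J| <= \sum_(e in S) #|hamming_ball e|)%N.
  rewrite -[X in (X ^ _)%N]card_bool -card_ffun.
  apply: (@leq_trans #|\bigcup_(e in S) hamming_ball e|); last first.
    elim/big_rec2 : _ => [|e m A _ ih]; first by rewrite cards0.
    by rewrite (leq_trans (leq_card_setU _ _))// leq_add2l.
  apply/subset_leq_card/fintype.subsetP => e _; have [e' e'S ee'] := cover e.
  by apply/finset.bigcupP; exists e'.
have h2 : (2 ^ (16 * #|J|) <= #|S| ^ 16 * 2 ^ (7 * #|J|))%N.
  rewrite mulnC expnM; apply: (@leq_trans ((\sum_(e in S) #|hamming_ball e|) ^ 16)%N).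
    by rewrite leq_exp2r.
  have [/eqP|] := posnP #|S|.
    by rewrite cards_eq0 => /eqP ->; rewrite big_set0 cards0.
  case/card_gt0P => e0 e0S.
  have [e eS emax] := arg_maxnP (fun e => #|hamming_ball e|) e0S.
  apply: (@leq_trans ((#|S| * #|hamming_ball e|) ^ 16)%N).
    by rewrite leq_exp2r// -sum_nat_const leq_sum.
  by rewrite expnMn leq_mul2l card_hamming_ball orbT.
rewrite -(@leq_exp2r _ _ 8)// -!expnM.
rewrite -(@leq_pmul2r (2 ^ (7 * #|J|)))%N ?expn_gt0//; apply: leq_trans h2.
by rewrite -expnD leq_pexp2l//; lia.
Qed.

End code.

(** * Approximable families of sign patterns *)

Lemma bernoulli_ineq (R : realType) (x : R) n : 0 <= x -> 1 + n%:R * x <= (1 + x) ^+ n.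
Proof.
move=> x0; elim: n => [|n ih]; first by rewrite mul0r addr0 expr0.
rewrite exprS -natr1; apply: (@le_trans _ _ ((1 + x) * (1 + n%:R * x))).
  have : 0 <= n%:R * (x * x) by rewrite !mulr_ge0.
  lra.
by rewrite ler_wpM2l// addr_ge0.
Qed.

Section separation.
Context {R : realType} {N : nat}.
Variables (X : Type) (D : set X) (B : (X -> R[i]) -> R -> Prop).
Hypothesis nb : norm_bound D B.
Variables (rho K theta kappa : R) (ts : seq R).
Hypotheses (rho0 : 0 < rho) (K0 : 0 <= K) (uts : uniq ts)
  (tsr : forall u, u \in ts -> `|u| <= rho).
Variable f : X -> 'rV[R[i]]_N -> R[i].
Hypothesis fd : forall x, D x -> forall z j p, cdiff (fun w => f x (upd z j w)) p.
Hypothesis fB : forall z, exists L, B (f ^~ z) L.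
Hypothesis fK : forall z : 'rV[R[i]]_N, (forall j, normc (z ord0 j) <= 21 * rho) -> B (f ^~ z) K.
Variable J : finType.
Hypothesis J0 : (0 < #|J|)%N.
Variable Lam : J -> (X -> R[i]) -> R.
Hypothesis LamD : forall j u v K L, B u K -> B v L ->
  Lam j (fun x => u x + v x) = Lam j u + Lam j v.
Hypothesis LamZ : forall j (c : R) u K, B u K ->
  Lam j (fun x => c%:C * u x) = c * Lam j u.
Hypothesis LamB : forall u K, B u K ->
  \sum_j `|Lam j u| <= #|J|%:R * (kappa * K).
Variable h : {ffun J -> bool} -> X -> R.
Hypothesis Lamh : forall e j, Lam j (fun x => (h e x)%:C) = (-1) ^+ e j.
Hypothesis approx : forall e, exists2 zeta : 'rV[R]_N,
  forall i, `|zeta ord0 i| <= rho &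
  B (fun x => (h e x)%:C - f x (map_mx (real_complex R) zeta)) theta.
Hypothesis small : kappa * (theta + 3 ^+ N * K * (3 / 4) ^+ size ts) <= 1 / 32.

Let M : R := #|J|%:R.
Let M0 : 0 < M. Proof. by rewrite ltr0n. Qed.

Let Lame (e : {ffun J -> bool}) (u : X -> R[i]) : R :=
  M^-1 * \sum_j (-1) ^+ e j * Lam j u.

Let LameD e u v a b : B u a -> B v b ->
  Lame e (fun x => u x + v x) = Lame e u + Lame e v.
Proof.
move=> hu hv; rewrite /Lame -mulrDr -big_split/=; congr (_ * _).
by apply: eq_bigr => j _; rewrite (LamD _ hu hv) mulrDr.
Qed.

Let LameZ e (c : R) u a : B u a -> Lame e (fun x => c%:C * u x) = c * Lame e u.
Proof.
move=> hu; rewrite /Lame [RHS]mulrCA; congr (_ * _); rewrite mulr_sumr.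
by apply: eq_bigr => j _; rewrite (LamZ _ _ hu) mulrCA.
Qed.

Let LameB e u a : B u a -> `|Lame e u| <= kappa * a.
Proof.
move=> /LamB hu; rewrite /Lame normrM gtr0_norm ?invr_gt0//.
rewrite ler_pdivrMl//; apply: le_trans hu; apply: le_trans (ler_norm_sum _ _ _) _.
by apply: ler_sum => j _; rewrite normrM normrX normrN1 expr1n mul1r.
Qed.

Let Lameh e e' : Lame e (fun x => (h e' x)%:C) = 1 - 2 * (hamming e e')%:R / M.
Proof.
rewrite /Lame.
have -> : \sum_j (-1) ^+ e j * Lam j (fun x => (h e' x)%:C) =
    \sum_j (1 - 2 * (e j != e' j)%:R) :> R.
  by apply: eq_bigr => j _; rewrite Lamh; case: (e j); case: (e' j) => /=; ring.
have -> : \sum_j (1 - 2 * (e j != e' j)%:R) = M - 2 * (hamming e e')%:R :> R.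
  rewrite sumrB sumr_const -mulr_sumr -natr_sum -/M; congr (_ - _ * _%:R).
  rewrite -big_mkcond sum1_card /hamming; apply: eq_card => j.
  by rewrite unfold_in [RHS]inE.
by field; rewrite gt_eqF.
Qed.

(** The pairing of [e] with the interpolant of [f]. *)
Let U e : 'rV[R]_N -> R := foldr (real_interp_coord ts)
  (fun z : 'rV[R]_N => Lame e (f ^~ (map_mx (real_complex R) z))) (enum 'I_N).

Let U_approx e e' (zeta : 'rV[R]_N) : (forall i, `|zeta ord0 i| <= rho) ->
  B (fun x => (h e' x)%:C - f x (map_mx (real_complex R) zeta)) theta ->
  `|U e zeta - (1 - 2 * (hamming e e')%:R / M)| <= 1 / 32.
Proof.
move=> zr hB; rewrite -Lameh.
have -> : U e zeta = Lame e ((interp_coords ts (enum 'I_N) f) ^~ (map_mx (real_complex R) zeta)).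
  by rewrite (functional_interp_coords nb ts fB (@LameD e) (@LameZ e)).
set F := interp_coords ts (enum 'I_N) f; set z := map_mx _ zeta in hB *.
have [L FL] := interp_coords_bounded nb ts fB (enum 'I_N) z.
have uN : uniq (enum 'I_N) by exact: enum_uniq.
have := @interp_coords_error_bound R N X D B nb rho K ts rho0 K0 uts tsr f fd fB fK _ z uN.
rewrite size_enum_ord => /(_ _)/(nb_add nb hB).
have -> : (fun x => (h e' x)%:C - f x z + (f x z - interp_coords ts (enum 'I_N) f x z)) =
    fun x => (h e' x)%:C - F x z by apply/funext => x; rewrite addrA subrK.
move=> hF; have {}hF := hF _; set E := theta + _ in hF.
have {}hF : B (fun x => (h e' x)%:C - F x z) E.
  by apply: hF => i; rewrite /z !mxE/=; split => //; exact: zr.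
have -> : Lame e (fun x => (h e' x)%:C) = Lame e (fun x => (h e' x)%:C - F x z) + Lame e (F ^~ z).
  by rewrite -(LameD _ hF FL); congr Lame; apply/funext => x; rewrite subrK.
rewrite opprD addrCA subrr addr0 normrN.
by apply: le_trans (LameB e hF) _.
Qed.

(** The shift makes the values at far members of the code small in absolute
    value, and not only bounded above. *)
Let V k e z : R := (2^-1 * (1 + U e z)) ^+ k.

Let V_poly k e i : poly_in (k * size ts).+1 i (V k e).
Proof.
apply: (poly_in_exp (G := fun z => 2^-1 * (1 + U e z))) => z.
have [p sp pE] := @poly_in_interp_coords R N ts (enum 'I_N)
  (fun z : 'rV[R]_N => Lame e (f ^~ (map_mx (real_complex R) z))) i (mem_enum _ i) z.
exists (2^-1 *: (1 + p)); last by move=> t; rewrite hornerZ hornerD hornerC -pE.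
rewrite (leq_trans (size_scale_leq _ _))// (leq_trans (size_polyD _ _))//.
by rewrite geq_max size_poly1/= ltnW.
Qed.

(** The values of [(1 + U_e) / 2] are at least [63 / 64] at the own point of [e]
    and at most [61 / 64] in absolute value at the points of the other members of
    the code; the [k]-th power turns this gap into diagonal dominance. *)
Lemma sign_patterns_bound :
  (2 ^ #|J| <= ((31 * #|J|.+1 * size ts).+1 ^ N) ^ 2)%N.
Proof.
have [S [codeS bigS]] := large_code J; apply: (leq_trans bigS).
(* [(63 / 61) ^ 31 >= 2], so that the gap beats the size of the code. *)
rewrite leq_exp2r//; pose k := (31 * #|J|.+1)%N.
have /choice[zeta hz] e : exists zeta : 'rV[R]_N, (forall i, `|zeta ord0 i| <= rho) /\
    B (fun x => (h e x)%:C - f x (map_mx (real_complex R) zeta)) theta.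
  by have [z h1 h2] := approx e; exists z.
have -> : #|S| = #|{: {e | e \in S}}| by rewrite card_sig; apply: eq_card.
apply: (@dominant_card R N _ _ (fun e => V k (val e)) (fun e => zeta (val e))).
  by move=> e i; exact: V_poly.
move=> [e eS] /=.
have diag : (63 / 64) ^+ k <= `|V k e (zeta e)|.
  rewrite normrX lerXn2r// ?nnegrE//.
  have [h1 h2] := hz e; have := U_approx e h1 h2.
  rewrite (_ : hamming e e = 0%N); last first.
    by apply: eq_card0 => j; rewrite inE eqxx.
  rewrite mulr0 mul0r subr0 ler_norml => /andP[h3 h4].
  by apply: le_trans (ler_norm _); lra.
have off e' : e' \in S -> e' != e -> `|V k e' (zeta e)| <= (61 / 64) ^+ k.
  move=> e'S ee'; rewrite normrX lerXn2r// ?nnegrE//.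
  have [h1 h2] := hz e; have := U_approx e' h1 h2.
  have d1 : 1 / 16 <= (hamming e' e)%:R / M.
    rewrite ler_pdivlMr// mulrC mulrA mulr1 ler_pdivrMr// -natrM ler_nat mulnC.
    exact/ltnW/codeS.
  have d2 : (hamming e' e)%:R / M <= 1.
    by rewrite ler_pdivrMr// mul1r ler_nat max_card.
  rewrite -mulrA ler_norml => /andP[h3 h4]; rewrite ler_norml; apply/andP; split; lra.
apply: lt_le_trans diag.
have cardS : (#|S| <= 2 ^ #|J|)%N.
  by rewrite (leq_trans (max_card _))// card_ffun card_bool.
apply: (@le_lt_trans _ _ (2 ^+ #|J| * (61 / 64) ^+ k)).
  apply: (@le_trans _ _ (\sum_(b : {e | e \in S}) (61 / 64) ^+ k)).
    rewrite [leRHS](bigID (fun b => b != exist _ e eS))/= ler_wpDr//.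
      by apply: sumr_ge0 => b _; rewrite exprn_ge0// divr_ge0.
    apply: ler_sum => -[e' e'S] /= ee'; apply: off => //.
  rewrite sumr_const -[_ *+ _]mulr_natl ler_wpM2r ?exprn_ge0 ?divr_ge0//.
  by rewrite card_sig -natrX ler_nat; apply: leq_trans cardS; apply: subset_leq_card; apply/fintype.subsetP.
have E : (63 / 64 : R) = 63 / 61 * (61 / 64) by field.
rewrite E (exprMn k (63 / 61) (61 / 64)) ltr_pM2r; last by rewrite exprn_gt0// divr_gt0.
apply: (@lt_le_trans _ _ (2 ^+ #|J|.+1)); first by rewrite exprS ltr_pMl ?exprn_gt0// ltr1n.
rewrite /k exprM; apply: lerXn2r; rewrite ?nnegrE ?exprn_ge0 ?divr_ge0//.
rewrite (_ : 63 / 61 = 1 + 2 / 61); last by field.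
by apply: le_trans (bernoulli_ineq _ _); rewrite ?divr_ge0//; lra.
Qed.

End separation.

(** * A spline bump *)

Section spline_functions.
Context {R : realType}.
Implicit Types (t u x : R).

Definition pos u : R := Num.max 0 u.

Lemma pos_ge0 u : 0 <= pos u. Proof. by rewrite le_max lexx. Qed.

Lemma is_derive_pos2 u : is_derive u 1 (fun u => pos u ^+ 2) (2 * pos u).
Proof.
apply/is_derive1_caratheodory.
exists (fun v => if v == u then 2 * pos u else (pos v ^+ 2 - pos u ^+ 2) / (v - u)).
split.
- move=> v /=; case: eqP => [->|/eqP vu]; first by rewrite !subrr mulr0.
  by rewrite divfK// subr_eq0.
- apply/cvgrPdist_le => e e0; rewrite eqxx; near=> v.
  case: eqP => [_|/eqP vu]; first by rewrite subrr normr0 ltW.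
  have vu0 : v - u != 0 by rewrite subr_eq0.
  have -> : 2 * pos u - (pos v ^+ 2 - pos u ^+ 2) / (v - u) =
      (2 * pos u * (v - u) - (pos v ^+ 2 - pos u ^+ 2)) / (v - u) by field.
  rewrite normrM normfV ler_pdivrMr ?normr_gt0//.
  have ve : `|v - u| <= e.
    by rewrite distrC; near: v; apply: cvgr_dist_le => //; exact: cvg_id.
  apply: (@le_trans _ _ ((v - u) ^+ 2)); last first.
    by rewrite -real_normK ?num_real// expr2 ler_wpM2r.
  rewrite ler_norml /pos /Num.max; case: ltP => v0; case: ltP => u0; apply/andP; split; nra.
- by rewrite eqxx.
Unshelve. all: by end_near. Qed.

Lemma posXS u p : pos u ^+ p.+2 = u * pos u ^+ p.+1.
Proof. by rewrite exprS /pos; case: ltP; rewrite // exprS !mul0r mulr0. Qed.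

Lemma is_derive_posX u p : is_derive u 1 (fun u => pos u ^+ p.+2) (p.+2%:R * pos u ^+ p.+1).
Proof.
elim: p => [|p ih]; first by rewrite expr1; exact: is_derive_pos2.
rewrite (_ : (fun u => _) = (fun u => u) * (fun u => pos u ^+ p.+2)); last first.
  by apply/funext => v; rewrite posXS.
apply: is_derive_eq.
rewrite /GRing.scale/= mulr1 mulrCA -posXS.
by rewrite (_ : p.+3%:R = p.+2%:R + 1 :> R) ?natr1//; ring.
Qed.

Variable m : nat.

(** Differentiating [pos (t - t ^ 2) ^ q * Q] lowers [q] by one and changes the
    polynomial [Q] as follows. *)
Fixpoint spline_poly k : {poly R} :=
  if k is k'.+1 then
    (m.+2 - k')%:R *: ((1 - 2 *: 'X) * spline_poly k') + ('X - 'X ^+ 2) * (spline_poly k')^`()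
  else 1.

(** For [k <= m + 1], the [k]-th derivative of [pos (t - t ^ 2) ^ (m + 2)], a
    bump supported by the unit interval. *)
Definition spline k t : R := pos (t - t ^+ 2) ^+ (m.+2 - k) * (spline_poly k).[t].

Lemma is_derive_spline k t : (k <= m)%N -> is_derive t 1 (spline k) (spline k.+1 t).
Proof.
move=> km; have [p pE] : exists p, (m.+2 - k = p.+2)%N.
  by exists (m - k)%N; rewrite subSn ?subSn// leqW.
have d1 : is_derive t 1 (fun t : R => t - t ^+ 2) (1 - 2 * t).
  by apply: is_derive_eq; rewrite /GRing.scale/=; ring.
have d2 : is_derive t 1 (fun t : R => pos (t - t ^+ 2) ^+ p.+2)
    (p.+2%:R * pos (t - t ^+ 2) ^+ p.+1 * (1 - 2 * t)).
  exact: (@is_derive1_comp R (fun u => pos u ^+ p.+2) (fun t => t - t ^+ 2) t _ _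
    (is_derive_posX (t - t ^+ 2) p) d1).
have d3 := is_derive_poly (spline_poly k) t.
rewrite (_ : spline k = (fun t : R => pos (t - t ^+ 2) ^+ p.+2) * horner (spline_poly k)); last first.
  by apply/funext => v; rewrite /spline pE.
apply: is_derive_eq; rewrite /GRing.scale/= /spline /= subnS pE/=.
rewrite hornerD hornerZ !hornerM !hornerD !hornerN hornerZ hornerXn hornerX hornerC.
rewrite [pos _ ^+ p.+2]posXS; ring.
Qed.

Lemma spline_out k t : (k <= m.+1)%N -> ~ (0 < t < 1) -> spline k t = 0.
Proof.
move=> km t01; rewrite /spline; have [p ->] : exists p, (m.+2 - k = p.+1)%N.
  by exists (m.+1 - k)%N; rewrite subSn.
have -> : pos (t - t ^+ 2) = 0; last by rewrite exprS !mul0r.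
rewrite /pos; apply/max_idPl; rewrite leNgt; apply/negP => h; apply: t01.
apply/andP; split; nra.
Qed.

Lemma spline_bounded : exists2 c, 0 < c & forall k t, (k <= m.+1)%N -> `|spline k t| <= c.
Proof.
pose c k := \sum_(i < size (spline_poly k)) `|(spline_poly k)`_i|.
exists (1 + \sum_(k < m.+2) c k).
  by rewrite ltr_pwDl// !sumr_ge0// => k _; rewrite sumr_ge0.
move=> k t km; have [t01|t01] := pselect (0 < t < 1); last first.
  rewrite spline_out// normr0 addr_ge0// sumr_ge0// => i _; exact: sumr_ge0.
have ck : `|spline k t| <= c k.
  rewrite /spline normrM; apply: (@le_trans _ _ (1 * `|(spline_poly k).[t]|)).
    apply: ler_wpM2r => //; rewrite ger0_norm ?exprn_ge0 ?pos_ge0//.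
    apply: exprn_ile1; first exact: pos_ge0.
    by rewrite /pos ge_max ler01/=; nra.
  rewrite mul1r horner_coef; apply: le_trans (ler_norm_sum _ _ _) _.
  apply: ler_sum => i _; rewrite normrM ler_piMr// normrX exprn_ile1//.
  by rewrite ger0_norm; case/andP: t01 => *; lra.
rewrite (le_trans ck)// (bigD1 (Ordinal (km : (k < m.+2)%N)))//= addrCA lerDl addr_ge0//.
by rewrite sumr_ge0// => i _; rewrite sumr_ge0.
Qed.

Lemma spline_ge t : 1 / 4 <= t <= 3 / 4 -> (3 / 16) ^+ m.+2 <= spline 0 t.
Proof.
move=> /andP[t1 t2]; rewrite /spline subn0 /= hornerC mulr1.
by apply: lerXn2r; rewrite ?nnegrE ?divr_ge0 ?pos_ge0// /pos le_max; apply/orP; right; nra.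
Qed.

End spline_functions.

(** * Sums of bumps and their partial derivatives *)

Section sum_of_bumps.
Context {R : realType}.
Variables (s m n : nat) (A : R).
Let J := {ffun 'I_s -> 'I_n}.
Variable e : {ffun J -> bool}.
Implicit Types (x y : 'rV[R]_s) (i : 'I_s) (K : 'I_s -> nat) (w : seq 'I_s).

(** [K] is a multi-index: the spline and its derivatives are rescaled to the
    cells [j] of side [1 / n], with signs [e]. *)
Definition bump_sum K x : R :=
  \sum_(j : J) (-1) ^+ e j * \prod_i spline m (K i) (n%:R * x ord0 i - (j i)%:R).

Definition incr K i : 'I_s -> nat := fun i' => ((i == i') + K i')%N.

(** At most one translate is non zero at a given point. *)
Lemma bump_shift_sum_le c k t : (k <= m.+1)%N -> (forall t, `|spline m k t| <= c) ->
  \sum_(j < n) `|spline m k (t - j%:R) : R| <= c.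
Proof.
move=> km hc; have [[j0 h0]|none] := pselect (exists j : 'I_n, 0 < t - j%:R < 1); last first.
  rewrite big1 ?(le_trans _ (hc 0))// => j _; rewrite spline_out ?normr0// => h.
  by apply: none; exists j.
rewrite (bigD1 j0)//= big1 ?addr0 ?hc// => j jj0; rewrite spline_out ?normr0//.
move=> /andP[h1 h2]; case/andP: h0 => h3 h4; case/negP: jj0; apply/eqP/val_inj => /=.
have k1 : (j < j0.+1)%N by rewrite -(@ltr_nat R) -natr1; lra.
have k2 : (j0 < j.+1)%N by rewrite -(@ltr_nat R) -natr1; lra.
by apply/eqP; rewrite eqn_leq -ltnS k1 -ltnS k2.
Qed.

Lemma bump_sum_le c K x : (forall i, (K i <= m.+1)%N) ->
  (forall k t, (k <= m.+1)%N -> `|spline m k t| <= c) -> `|bump_sum K x| <= c ^+ s.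
Proof.
move=> Km hc; apply: le_trans (ler_norm_sum _ _ _) _.
apply: (@le_trans _ _ (\sum_(j : J) \prod_i `|spline m (K i) (n%:R * x ord0 i - (j i)%:R)|)).
  apply: ler_sum => j _; rewrite normrM normrX normrN1 expr1n mul1r.
  by rewrite normr_prod.
rewrite -(bigA_distr_bigA (fun i (k : 'I_n) => `|spline m (K i) (n%:R * x ord0 i - k%:R)|)).
rewrite (_ : c ^+ s = \prod_(i < s) c); last by rewrite prodr_const card_ord.
apply: ler_prod => i _; apply/andP; split.
  by apply: sumr_ge0.
by apply: bump_shift_sum_le => // t; exact: hc.
Qed.

Lemma is_derive_bigsum (I : Type) (r : seq I) (F : I -> R -> R) (F' : I -> R) (t : R) :
  (forall k, is_derive t 1 (F k) (F' k)) ->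
  is_derive t 1 (fun t => \sum_(k <- r) F k t) (\sum_(k <- r) F' k).
Proof.
move=> h; elim: r => [|k r ih].
  rewrite big_nil (_ : (fun t => _) = cst 0); last by apply/funext => v; rewrite big_nil.
  exact: is_derive_cst.
rewrite big_cons (_ : (fun t => _) = F k + (fun t => \sum_(k <- r) F k t)); last first.
  by apply/funext => v; rewrite big_cons.
exact: is_deriveD.
Qed.

Lemma is_derive_bump_sum K i x (t : R) : (K i <= m)%N ->
  is_derive t 1 (fun t => bump_sum K (upd x i t)) (n%:R * bump_sum (incr K i) (upd x i t)).
Proof.
move=> Ki; rewrite /bump_sum mulr_sumr; apply: is_derive_bigsum => j.
pose C : R := (-1) ^+ e j * \prod_(i' | i' != i) spline m (K i') (n%:R * x ord0 i' - (j i')%:R).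
rewrite (_ : (fun t => _) = C *: (spline m (K i) \o (fun t => n%:R * t - (j i)%:R))); last first.
  apply/funext => v; rewrite (bigD1 i)//= upd_same.
  rewrite (eq_bigr (fun i' => spline m (K i') (n%:R * x ord0 i' - (j i')%:R))); last first.
    by move=> i' i'i; rewrite upd_other.
  by rewrite -[RHS]/(C * spline m (K i) (n%:R * v - (j i)%:R)) /C mulrA [LHS]mulrAC.
rewrite (bigD1 i)//= upd_same.
rewrite (eq_bigr (fun i' => spline m (K i') (n%:R * x ord0 i' - (j i')%:R))); last first.
  by move=> i' i'i; rewrite upd_other// /incr eq_sym (negPf i'i).
rewrite /incr eqxx add1n.
have d1 : is_derive t 1 (fun t : R => n%:R * t - (j i)%:R) n%:R.
  by apply: is_derive_eq; rewrite /GRing.scale/=; ring.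
have d2 := @is_derive1_comp R (spline m (K i)) (fun t : R => n%:R * t - (j i)%:R) t _ _
  (is_derive_spline (n%:R * t - (j i)%:R) Ki) d1.
have d3 := is_deriveZ C d2.
set S := spline m (K i).+1 _ in d3 *.
rewrite (_ : n%:R * _ = C * (S * n%:R)); first exact: d3.
have aux (a1 a2 a3 a4 : R) : a1 * (a2 * (a3 * a4)) = a2 * a4 * (a3 * a1) by ring.
exact: aux.
Qed.

Definition multi_deg K := (\sum_i K i)%N.

(** The partial derivative of order [K] of the sum of bumps of amplitude [A]. *)
Definition bump_fun K x : R := A * n%:R ^+ multi_deg K * bump_sum K x.

Lemma is_derive_bump_fun K i x (t : R) : (K i <= m)%N ->
  is_derive t 1 (fun t => bump_fun K (upd x i t)) (bump_fun (incr K i) (upd x i t)).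
Proof.
move=> Ki; have d := is_deriveZ (A * n%:R ^+ multi_deg K) (is_derive_bump_sum x t Ki).
rewrite /bump_fun (_ : multi_deg (incr K i) = (multi_deg K).+1); last first.
  rewrite /multi_deg /incr big_split/= -add1n; congr (_ + _)%N.
  by rewrite (bigD1 i)//= eqxx big1 ?addn0// => i' /negPf h; rewrite eq_sym h.
rewrite (_ : A * n%:R ^+ _.+1 * _ = (A * n%:R ^+ multi_deg K) *:
  (n%:R * bump_sum (incr K i) (upd x i t))); first exact: d.
have aux (a1 a2 a3 a4 : R) : a1 * (a2 * a3) * a4 = a1 * a3 * (a2 * a4) by ring.
by rewrite exprS; exact: aux.
Qed.

Lemma cube_shift x i h : x + h *: delta_mx ord0 i = upd x i (x ord0 i + h).
Proof.
apply/rowP => i'; rewrite !mxE eqxx/= eq_sym; case: eqVneq => [->|_]; first by rewrite mulr1.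
by rewrite mulr0 addr0.
Qed.

Lemma cube_dnbhs_filter i x : Filter (cube_dnbhs i x).
Proof. by rewrite /cube_dnbhs; apply: within_filter. Qed.

(** From any point of the cube one can move inwards along each axis. *)
Lemma cube_dnbhs_proper i x : cube x -> ProperFilter (cube_dnbhs i x).
Proof.
move=> cx; apply: Build_ProperFilter_ex.
move=> P; rewrite /cube_dnbhs /within/= => /nbhs_ballP[d /= d0 dP].
have [x1 x2] := andP (cx i).
have [mn [m0 md m2]] : exists mn : R, [/\ 0 < mn, mn < d & mn <= 1 / 2].
  exists (Num.min (d / 2) (1 / 2)); split; first by rewrite lt_min !divr_gt0.
    by rewrite gt_min; apply/orP; left; lra.
  by rewrite ge_min lexx orbT.
pose h := (if x ord0 i <= 1 / 2 then 1 else -1) * mn.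
exists h; apply: (dP h).
- rewrite /ball/= sub0r normrN /h normrM (gtr0_norm m0).
  by case: ifP => _; rewrite ?normrN1 ?normr1 mul1r.
- by rewrite /h; case: ifP => _; rewrite ?mul1r ?mulN1r ?oppr_eq0 gt_eqF.
- rewrite cube_shift => i'; rewrite mxE; case: eqP => _; last exact: cx.
  rewrite /h; case: ifPn => [x3|]; first by apply/andP; split; lra.
  by rewrite -ltNge => x3; apply/andP; split; lra.
Qed.

Lemma diff_quotient_bump_fun K f i x : (K i <= m)%N -> cube x ->
  (forall y, cube y -> f y = bump_fun K y) ->
  diff_quotient f i x @ cube_dnbhs i x --> bump_fun (incr K i) x.
Proof.
move=> Ki cx fE; have [d1 d2] := is_derive_bump_fun x (x ord0 i) Ki.
rewrite upd_id in d2; rewrite -d2.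
have F : Filter (cube_dnbhs i x) by exact: cube_dnbhs_filter.
apply: (@cvg_trans _ ((fun h : R => h^-1 *: (((fun t => bump_fun K (upd x i t)) \o shift (x ord0 i))
   (h *: 1) - bump_fun K (upd x i (x ord0 i)))) @ cube_dnbhs i x)).
  apply: near_eq_cvg; near=> h.
  rewrite /diff_quotient cube_shift upd_id !fE//; last first.
    by rewrite -cube_shift; near: h; exact: withinT.
  by rewrite /= [_%:A]mulr1 [h + _]addrC.
by apply: cvg_trans d1; apply: cvg_app; exact: cvg_within.
Unshelve. all: by end_near. Qed.

Definition mult w : 'I_s -> nat := fun i => count_mem i w.

Lemma mult_le w i : (mult w i <= size w)%N. Proof. exact: count_size. Qed.

Lemma multi_deg_mult w : multi_deg (mult w) = size w.
Proof.
rewrite /multi_deg /mult; elim: w => [|i w ih]; first by rewrite big1.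
rewrite /= big_split/= ih -add1n; congr (_ + _)%N.
by rewrite (bigD1 i)//= eqxx big1 ?addn0// => i' /negPf h; rewrite eq_sym h.
Qed.

Lemma partials_bump_fun w : (size w <= m.+1)%N -> forall x, cube x ->
  partials w (bump_fun (fun=> 0%N)) x = bump_fun (mult w) x.
Proof.
elim: w => [//|i w ih] /= wm x cx.
have FF := cube_dnbhs_proper i cx.
apply: cvg_lim => //.
apply: (@diff_quotient_bump_fun (mult w)) => //.
  exact: leq_trans (mult_le _ _) wm.
by apply: ih; exact: ltnW.
Qed.

Section bounded_splines.
Variable c : R.
Hypothesis hc : forall k t, (k <= m.+1)%N -> `|spline m k t| <= c.

Let c0 : 0 <= c. Proof. exact: le_trans (hc 0 (leq0n _)). Qed.

Lemma bump_sum_lip1 K i x (a b : R) : (forall i, (K i <= m)%N) ->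
  `|bump_sum K (upd x i b) - bump_sum K (upd x i a)| <= n%:R * c ^+ s * `|b - a|.
Proof.
move=> Km; wlog ab : a b / a <= b.
  move=> h; have [ab|/ltW ba] := leP a b; first exact: h.
  by rewrite distrC [`|b - a|]distrC; exact: h.
have [t _ ->] := @MVT_segment R (fun t => bump_sum K (upd x i t))
  (fun t => n%:R * bump_sum (incr K i) (upd x i t)) a b ab
  (fun t _ => is_derive_bump_sum x t (Km i))
  (continuous_subspaceT (fun t => differentiable_continuous
    ((derivable1_diffP _ _).1 (@ex_derive _ _ _ _ _ _ _ (is_derive_bump_sum x t (Km i)))))).
rewrite !normrM ler_wpM2r// ger0_norm// ler_wpM2l//; apply: bump_sum_le => // i'.
by rewrite /incr -add1n leq_add// leq_b1.
Qed.

Lemma bump_sum_lip K x y d : (forall i, (K i <= m)%N) ->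
  (forall i, `|x ord0 i - y ord0 i| <= d) ->
  `|bump_sum K x - bump_sum K y| <= s%:R * n%:R * c ^+ s * d.
Proof.
move=> Km xyd; pose z r := foldr (fun i v => upd v i (x ord0 i)) y r.
have zE r i : z r ord0 i = if i \in r then x ord0 i else y ord0 i.
  elim: r => [//|j r ih]; rewrite mxE in_cons; case: eqP => [->//|_] /=.
  exact: ih.
have -> : x = z (enum 'I_s) by apply/rowP => i; rewrite zE mem_enum.
rewrite [X in X%:R * n%:R](_ : s = size (enum 'I_s)); last by rewrite size_enum_ord.
elim: (enum 'I_s) (enum_uniq 'I_s) => [_|i r ih /= /andP[ir ur]].
  by rewrite subrr normr0 !mul0r.
rewrite -(subrK (bump_sum K (z r)) (bump_sum K (upd _ _ _))) -addrA.
rewrite (le_trans (ler_normD _ _))// -natr1 !mulrDl [leRHS]addrC lerD// ?ih//.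
rewrite -{2}(upd_id (z r) i) (le_trans (bump_sum_lip1 _ _ _ _ _))// -mulrA mul1r mulrA.
by rewrite ler_wpM2l ?mulr_ge0 ?exprn_ge0// zE (negPf ir).
Qed.

(** Interpolation between the Lipschitz bound, for near points, and the uniform
    bound, for far ones. *)
Lemma bump_sum_holder K x y d (alpha : R) : (0 < s)%N -> (forall i, (K i <= m)%N) ->
  0 < alpha <= 1 -> 0 <= d -> (forall i, `|x ord0 i - y ord0 i| <= d) ->
  `|bump_sum K x - bump_sum K y| <= 2 * s%:R * c ^+ s * (n%:R * d) `^ alpha.
Proof.
move=> s0 Km /andP[a0 a1] d0 xyd.
have s1 : 1 <= s%:R :> R by rewrite ler1n.
have cs0 : 0 <= s%:R * c ^+ s by rewrite mulr_ge0// exprn_ge0.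
have nd0 : 0 <= n%:R * d by rewrite mulr_ge0.
have [nd1|nd1] := leP (n%:R * d) 1.
  apply: (le_trans (bump_sum_lip Km xyd)).
  rewrite (_ : s%:R * n%:R * c ^+ s * d = s%:R * c ^+ s * (n%:R * d)); last by ring.
  have p0 := powR_ge0 (n%:R * d) alpha.
  have : n%:R * d <= (n%:R * d) `^ alpha.
    move: nd0; rewrite le_eqVlt => /orP[/eqP <-|nd0]; first exact: powR_ge0.
    by apply: ger1_powR => //; rewrite nd0.
  move=> /(ler_wpM2l cs0)/le_trans; apply; rewrite -[2 * _ * _]mulrA -mulrA.
  have : 0 <= s%:R * c ^+ s * (n%:R * d) `^ alpha by rewrite mulr_ge0.
  by rewrite !mulrA; lra.
have p1 : 1 <= (n%:R * d) `^ alpha.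
  by have := ler_powR (ltW nd1) (ltW a0); rewrite powRr0.
have Km1 i : (K i <= m.+1)%N by apply: leqW.
apply: (le_trans (ler_normB _ _)).
have h1 := bump_sum_le x Km1 hc; have h2 := bump_sum_le y Km1 hc.
have cs1 : c ^+ s <= s%:R * c ^+ s by rewrite ler_peMl// exprn_ge0.
have : s%:R * c ^+ s <= s%:R * c ^+ s * (n%:R * d) `^ alpha by rewrite ler_peMr.
rewrite -[2 * _ * _]mulrA -[2 * _ * _]mulrA; lra.
Qed.

End bounded_splines.

Lemma continuous_spline k : (k <= m)%N -> continuous (spline m k : R -> R).
Proof.
move=> km t; apply/differentiable_continuous/derivable1_diffP.
by have [] := is_derive_spline t km.
Qed.

Lemma continuous_bump_fun K : (forall i, (K i <= m)%N) ->
  continuous (bump_fun K : 'rV[R]_s -> R).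
Proof.
move=> Km.
have cc : continuous (fun z : R * R => z.1 + z.2) by move=> z; exact: add_continuous.
have cm : continuous (fun z : R * R => z.1 * z.2) by move=> z; exact: mul_continuous.
have cb : continuous (bump_sum K : 'rV[R]_s -> R).
  apply: (@continuous_big _ _ _ _ _ cc _ (index_enum J)
    (fun j y => (-1) ^+ e j * \prod_i spline m (K i) (n%:R * y ord0 i - (j i)%:R))) => //.
  move=> j _ x; apply: (@continuousM _ _ (fun=> (-1) ^+ e j)
    (fun y : 'rV[R]_s => \prod_i spline m (K i) (n%:R * y ord0 i - (j i)%:R))).
    exact: cst_continuous.
  apply: (@continuous_big _ _ _ _ _ cm _ (index_enum _)
    (fun i y => spline m (K i) (n%:R * y ord0 i - (j i)%:R))) => //.
  move=> i _ {}x; apply: (@continuous_comp _ _ _ (fun y : 'rV[R]_s => n%:R * y ord0 i - (j i)%:R)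
    (spline m (K i) : R -> R)); last exact: continuous_spline.
  apply: (@continuousB _ _ _ (fun y : 'rV[R]_s => n%:R * y ord0 i) (fun=> (j i)%:R));
    last exact: cst_continuous.
  apply: (@continuousM _ _ (fun=> n%:R) (fun y : 'rV[R]_s => y ord0 i));
    [exact: cst_continuous|exact: coord_continuous].
move=> x; apply: (@continuousM _ _ (fun=> A * n%:R ^+ multi_deg K) (bump_sum K));
  [exact: cst_continuous|exact: cb].
Qed.

End sum_of_bumps.

(** * Sums of bumps in the Hoelder class *)

Section holder_class.
Context {R : realType}.
Variables (s m n : nat) (l alpha c : R).
Hypotheses (s0 : (0 < s)%N) (n0 : (0 < n)%N) (c0 : 0 < c)
  (hc : forall k t, (k <= m.+1)%N -> `|spline m k t| <= c)
  (lE : l = m%:R + alpha) (a01 : 0 < alpha <= 1).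

(** Chosen so that the derivatives of a sum of bumps up to order [m], and the
    Hoelder seminorms of those of order [m], are at most [1]. *)
Definition amplitude : R := (2 * s%:R * c ^+ s)^-1 / n%:R `^ l.

Let n1 : 1 <= n%:R :> R. Proof. by rewrite ler1n. Qed.
Let npos : 0 < n%:R :> R. Proof. by rewrite ltr0n. Qed.
Let s1 : 1 <= s%:R :> R. Proof. by rewrite ler1n. Qed.
Let cs0 : 0 < c ^+ s. Proof. by rewrite exprn_gt0. Qed.
Let den0 : 0 < 2 * s%:R * c ^+ s. Proof. by rewrite !mulr_gt0// ltr0n. Qed.

Lemma amplitude_gt0 : 0 < amplitude.
Proof. by rewrite /amplitude mulr_gt0 ?invr_gt0// powR_gt0. Qed.

Lemma enorm_ge (x : 'rV[R]_s) i : `|x ord0 i| <= enorm x.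
Proof.
rewrite -sqrtr_sqr ler_wsqrtr// (bigD1 i)//= lerDl sumr_ge0// => j _.
exact: sqr_ge0.
Qed.

Lemma enorm_gt0 (x : 'rV[R]_s) : x != 0 -> 0 < enorm x.
Proof.
move=> x0; rewrite lt0r sqrtr_ge0 andbT; apply: contra x0 => /eqP h.
by apply/eqP/rowP => i; rewrite mxE; apply/eqP; rewrite -normr_le0 -h enorm_ge.
Qed.

Lemma bump_fun_Lambda (e : {ffun {ffun 'I_s -> 'I_n} -> bool}) :
  Lambda s l (bump_fun m amplitude e (fun=> 0%N)).
Proof.
have [a0 a1] := andP a01.
have km (w : seq 'I_s) i : (size w <= m)%N -> (mult w i <= m)%N by exact: leq_trans (mult_le w i).
have km1 (w : seq 'I_s) i : (size w <= m)%N -> (mult w i <= m.+1)%N by move=> /km h; exact: leqW.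
have pE w x : (size w <= m)%N -> cube x -> partials w (bump_fun m amplitude e (fun=> 0%N)) x =
    bump_fun m amplitude e (mult w) x.
  by move=> wm cx; rewrite partials_bump_fun// leqW.
have An : amplitude * n%:R `^ l * (2 * s%:R * c ^+ s) = 1.
  by rewrite /amplitude divfK ?gt_eqF ?powR_gt0// mulVf// gt_eqF.
have nm : n%:R ^+ m <= n%:R `^ l :> R.
  by rewrite -powR_mulrn// ler_powR// lE lerDl ltW.
exists m, alpha; split => //.
- split.
    move=> w wm; apply: (@subspace_eq_continuous _ _ _
      (bump_fun m amplitude e (mult w) : subspace (@cube R s) -> R)).
      by move=> x; rewrite inE => cx; exact: (esym (pE w x wm cx)).
    by apply: continuous_subspaceT; apply: continuous_bump_fun => i; exact: km.
  move=> w i x wm cx.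
  have := @diff_quotient_bump_fun R s m n amplitude e (mult w) _ i x
    (km w i (ltnW wm)) cx (fun y => pE w y (ltnW wm)).
  by move=> /cvgP.
- move=> w wm; apply: ge_ereal_sup => _ [x cx <-]; rewrite lee_fin pE//.
  rewrite /bump_fun multi_deg_mult normrM.
  have h := bump_sum_le e x (km1 w ^~ wm) hc.
  apply: (@le_trans _ _ (amplitude * n%:R `^ l * c ^+ s)).
    rewrite ler_pM// ger0_norm; last by rewrite mulr_ge0 ?exprn_ge0 ?(ltW amplitude_gt0).
    rewrite ler_pM2l ?amplitude_gt0//; apply: le_trans nm.
    by rewrite ler_weXn2l.
  rewrite -[leRHS]An ler_wpM2l//; first by rewrite mulr_ge0 ?powR_ge0 ?(ltW amplitude_gt0).
  by rewrite ler_peMl ?(ltW cs0)//; have := s1; lra.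
- move=> w wm; apply: ge_ereal_sup => _ [x [y [cx cy xy ->]]]; rewrite lee_fin.
  have wm' : (size w <= m)%N by rewrite wm.
  have xy0 : 0 < enorm (x - y) by apply: enorm_gt0; rewrite subr_eq0.
  rewrite !pE// ler_pdivrMr ?powR_gt0// mul1r.
  rewrite /bump_fun multi_deg_mult wm -mulrBr normrM gtr0_norm; last first.
    by rewrite mulr_gt0 ?amplitude_gt0// exprn_gt0.
  have xyd i : `|x ord0 i - y ord0 i| <= enorm (x - y).
    by apply: le_trans (enorm_ge (x - y) i); rewrite !mxE.
  have h := bump_sum_holder e hc s0 (km w ^~ wm') a01 (ltW xy0) xyd.
  apply: (le_trans (ler_wpM2l _ h)).
    by rewrite mulr_ge0 ?exprn_ge0// (ltW amplitude_gt0).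
  rewrite powRM ?(ltW xy0)//.
  have E : n%:R ^+ m * n%:R `^ alpha = n%:R `^ l :> R.
    rewrite lE powRD; last by rewrite (gt_eqF npos) implybT.
    by rewrite powR_mulrn// ltW.
  rewrite [leLHS](_ : _ = amplitude * (n%:R ^+ m * n%:R `^ alpha) * (2 * s%:R * c ^+ s) * enorm (x - y) `^ alpha); last by ring.
  by rewrite E An mul1r.
Qed.

End holder_class.

(** * The two norms *)

Section limn_einf.
Context {R : realType}.
Implicit Types u : (\bar R)^nat.

Lemma limn_einf_sup_inf u : limn_einf u = ereal_sup (range (einfs u)).
Proof. by rewrite limn_einf_lim; apply: cvg_lim => //; exact: cvg_einfs_sup. Qed.

Lemma limn_einf_ge_near u (a : \bar R) n0 : (forall n, (n0 <= n)%N -> (a <= u n)%E) ->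
  (a <= limn_einf u)%E.
Proof.
move=> h; rewrite limn_einf_sup_inf; apply: (@le_trans _ _ (einfs u n0)).
  by apply: le_ereal_inf_tmp => _ [n /= n0n <-]; exact: h.
by apply: ereal_sup_ubound; exists n0.
Qed.

Lemma limn_einf_le_bound u (c : \bar R) : (forall n, (u n <= c)%E) -> (limn_einf u <= c)%E.
Proof.
move=> h; rewrite limn_einf_sup_inf; apply: ge_ereal_sup => _ [n _ <-].
apply: le_trans (h n); apply: ereal_inf_lbound; exists n => //=.
Qed.

End limn_einf.

Section sup_bound.
Context {R : realType}.
Variables (X : Type) (D : set X).

Definition sup_bound (u : X -> R[i]) (K : R) := forall x, D x -> normc (u x) <= K.

Lemma norm_bound_sup : norm_bound D sup_bound.
Proof.
split.
- move=> u v K L hu hv x Dx; rewrite (le_trans (le_normcD _ _))// lerD//; [exact: hu|exact: hv].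
- by move=> c u K hu x Dx; rewrite normcM ler_wpM2l ?normc_ge0// hu.
- by move=> u K L KL hu x Dx; rewrite (le_trans (hu x Dx)).
- move=> u _ K s v _ sn hv h x Dx; apply/ler_addgt0Pr => e e0.
  have [n0 hn] := h x Dx e e0; apply: (le_trans (hn n0 (leqnn _))); rewrite lerD2r.
  have s0 : 0 < (size (s n0))%:R :> R by rewrite ltr0n.
  rewrite -mulrA ler_pM2l// ler_pdivrMl//.
  apply: (@le_trans _ _ (\sum_(z <- s n0) K)).
    by rewrite big_seq [leRHS]big_seq; apply: ler_sum => z zs; exact: (hv n0 z zs x Dx).
  by rewrite big_const_seq count_predT iter_addr addr0 mulr_natl.
Qed.

End sup_bound.

Section L1_bound.
Context d (T : measurableType d) {R : realType} (mu : {measure set T -> \bar R}).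
Variables (X : Type) (r : T -> X) (D : set X).
Hypothesis mD : measurable (r @^-1` D).

Definition L1_bound (u : X -> R[i]) (K : R) :=
  [/\ measurable_fun (r @^-1` D) (fun t => complex.Re (u (r t))),
      measurable_fun (r @^-1` D) (fun t => complex.Im (u (r t))) &
      (\int[mu]_(t in r @^-1` D) (normc (u (r t)))%:E <= K%:E)%E].

Lemma measurable_normc (E : set T) (u : X -> R[i]) : measurable E ->
  measurable_fun E (fun t => complex.Re (u (r t))) ->
  measurable_fun E (fun t => complex.Im (u (r t))) ->
  measurable_fun E (fun t => (normc (u (r t)))%:E).
Proof.
move=> mE mR mI; apply/measurable_EFinP.
rewrite (_ : (fun t => _) = Num.sqrt \o
   (fun t => complex.Re (u (r t)) ^+ 2 + complex.Im (u (r t)) ^+ 2)); last first.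
  by apply/funext => t /=; case: (u (r t)).
apply: (measurableT_comp (continuous_measurable_fun (@sqrt_continuous R))).
by apply: measurable_funD; apply: measurable_funX.
Qed.

Lemma L1_bound_normc u K : L1_bound u K ->
  measurable_fun (r @^-1` D) (fun t => (normc (u (r t)))%:E).
Proof. by case=> mR mI _; exact: measurable_normc. Qed.

(** Fatou's lemma gives the last of the four properties. *)
Lemma norm_bound_L1 : norm_bound D L1_bound.
Proof.
have ReM (z w : R[i]) : complex.Re (z * w) =
    complex.Re z * complex.Re w - complex.Im z * complex.Im w by case: z w => [? ?] [? ?].
have ImM (z w : R[i]) : complex.Im (z * w) =
    complex.Re z * complex.Im w + complex.Im z * complex.Re w by case: z w => [? ?] [? ?].
have RD (z w : R[i]) : complex.Re (z + w) = complex.Re z + complex.Re w by case: z w => [? ?] [? ?].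
have ID (z w : R[i]) : complex.Im (z + w) = complex.Im z + complex.Im w by case: z w => [? ?] [? ?].
split.
- move=> u v K L hu hv; have [u1 u2 u3] := hu; have [v1 v2 v3] := hv.
  have muv1 : measurable_fun (r @^-1` D) (fun t => complex.Re (u (r t) + v (r t))).
    by under eq_fun do rewrite RD; exact: measurable_funD.
  have muv2 : measurable_fun (r @^-1` D) (fun t => complex.Im (u (r t) + v (r t))).
    by under eq_fun do rewrite ID; exact: measurable_funD.
  split => //; rewrite EFinD; apply: (le_trans _ (leeD u3 v3)).
  rewrite -ge0_integralD//; last 4 first.
  + by move=> t _; rewrite lee_fin normc_ge0.
  + exact: L1_bound_normc hu.
  + by move=> t _; rewrite lee_fin normc_ge0.
  + exact: L1_bound_normc hv.
  apply: ge0_le_integral => //.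
  + by move=> t _; rewrite lee_fin normc_ge0.
  + exact: (@measurable_normc _ (fun x => u x + v x)).
  + by apply: emeasurable_funD; [exact: L1_bound_normc hu|exact: L1_bound_normc hv].
  + by move=> t _; rewrite -EFinD lee_fin le_normcD.
- move=> c u K hu; have [u1 u2 u3] := hu; split.
  + under eq_fun do rewrite ReM.
    by apply: measurable_funB; apply: measurable_funM => //; exact: measurable_cst.
  + under eq_fun do rewrite ImM.
    by apply: measurable_funD; apply: measurable_funM => //; exact: measurable_cst.
  + under eq_integral do rewrite normcM EFinM.
    rewrite ge0_integralZl//.
    * by rewrite EFinM lee_wpmul2l// lee_fin normc_ge0.
    * exact: L1_bound_normc hu.
    * by move=> t _; rewrite lee_fin normc_ge0.
    * by rewrite lee_fin normc_ge0.
- by move=> u K L KL [u1 u2 u3]; split => //; apply: (le_trans u3); rewrite lee_fin.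
- move=> u L K s v [u1 u2 _] sn hv h; split => //.
  pose f n t : \bar R := (2 / (size (s n))%:R * \sum_(z <- s n) normc (v z (r t)))%:E.
  have f0 n t : (0 <= f n t)%E.
    by rewrite lee_fin mulr_ge0// sumr_ge0// => z _; exact: normc_ge0.
  have msum n : measurable_fun (r @^-1` D) (fun t => \sum_(z <- s n) normc (v z (r t))).
    have := hv n; elim: (s n) => [_|z r' ih hr].
      by under eq_fun do rewrite big_nil; exact: measurable_cst.
    under eq_fun do rewrite big_cons; apply: measurable_funD.
      by apply/measurable_EFinP; apply: L1_bound_normc (hr z (mem_head _ _)).
    by apply: ih => w wr; apply: hr; rewrite inE wr orbT.
  have mf n : measurable_fun (r @^-1` D) (f n).
    by apply/measurable_EFinP; apply: measurable_funM => //; exact: measurable_cst.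
  apply: (@le_trans _ _ (\int[mu]_(t in r @^-1` D) limn_einf (f ^~ t))%E).
    apply: ge0_le_integral => //.
    + by move=> t _; rewrite lee_fin normc_ge0.
    + exact: measurable_normc.
    + have H : measurable_fun (r @^-1` D) (fun t => limn_esup (fun n => - f n t)%E).
        apply: (@measurable_fun_limn_esup _ _ _ _ (fun n t => - f n t)%E) => n.
        exact: (measurableT_comp (@oppe_measurable R setT) (mf n)).
      exact: (measurableT_comp (@oppe_measurable R setT) H).
    + move=> t Dt; apply/lee_addgt0Pr => e e0.
      have [n0 hn] := h (r t) Dt e e0.
      rewrite -leeBlDr//; apply: (@limn_einf_ge_near _ _ _ n0) => n /hn.
      by rewrite -EFinB lee_fin lerBlDr.
  apply: (le_trans (fatou _ _ _ _)) => //.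
  apply: limn_einf_le_bound => n; rewrite /f.
  have s0 : 0 < (size (s n))%:R :> R by rewrite ltr0n.
  under eq_integral do rewrite EFinM.
  rewrite ge0_integralZl//; last 2 first.
  + exact/measurable_EFinP.
  + by move=> t _; rewrite lee_fin sumr_ge0// => z _; exact: normc_ge0.
  apply: (@le_trans _ _ ((2 / (size (s n))%:R)%:E * ((size (s n))%:R * K)%:E)%E); last first.
    by rewrite -EFinM lee_fin mulrA divfK// gt_eqF.
  rewrite lee_wpmul2l//; have := hv n; elim: (s n) {s0} => [_|z r' ih hr].
    under eq_integral do rewrite big_nil.
    by rewrite integral0 mul0r.
  under eq_integral do rewrite big_cons EFinD.
  have hz := hr z (mem_head _ _); have [z1 z2 z3] := hz.
  have hr' w : w \in r' -> L1_bound (v w) K by move=> wr; apply: hr; rewrite inE wr orbT.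
  rewrite ge0_integralD//.
  + rewrite /= -natr1 mulrDl mul1r addrC EFinD leeD//; exact: ih.
  + by move=> t _; rewrite lee_fin normc_ge0.
  + exact: L1_bound_normc hz.
  + by move=> t _; rewrite lee_fin sumr_ge0// => w _; exact: normc_ge0.
  + apply/measurable_EFinP; elim: r' hr' {ih hr} => [_|w r' ih hr].
      by under eq_fun do rewrite big_nil; exact: measurable_cst.
    under eq_fun do rewrite big_cons; apply: measurable_funD.
      by apply/measurable_EFinP; apply: L1_bound_normc (hr w (mem_head _ _)).
    by apply: ih => w' wr; apply: hr; rewrite inE wr orbT.
Qed.

End L1_bound.

(** * Functionals reading signs *)

(** Functionals that read the signs of the bumps while being bounded by the norm
    on average over the cells. *)
Definition reads_signs (R : realType) (X : Type) (J : finType)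
    (B : (X -> R[i]) -> R -> Prop) (h : {ffun J -> bool} -> X -> R) (kappa : R)
    (Lam : J -> (X -> R[i]) -> R) : Prop :=
  [/\ forall j u v K L, B u K -> B v L -> Lam j (fun x => u x + v x) = Lam j u + Lam j v,
      forall j (c : R) u K, B u K -> Lam j (fun x => c%:C * u x) = c * Lam j u,
      forall u K, B u K -> \sum_j `|Lam j u| <= #|J|%:R * (kappa * K) &
      forall e j, Lam j (fun x => (h e x)%:C) = (-1) ^+ e j].

Section sup_functionals.
Context {R : realType}.
Variables (X : Type) (D : set X) (J : finType) (x_ : J -> X) (b : X -> R) (bmin : R).
Variable h : {ffun J -> bool} -> X -> R.
Hypotheses (xD : forall j, D (x_ j)) (bmin0 : 0 < bmin)
  (bx : forall j, bmin <= b (x_ j)) (hx : forall e j, h e (x_ j) = (-1) ^+ e j * b (x_ j)).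

Lemma sup_reads_signs : reads_signs (sup_bound D) h bmin^-1
  (fun j u => (b (x_ j))^-1 * complex.Re (u (x_ j))).
Proof.
have b0 j : 0 < b (x_ j) by exact: lt_le_trans (bx j).
split.
- move=> j u v K L _ _; rewrite -mulrDr; congr (_ * _).
  by case: (u _) (v _) => [? ?] [? ?].
- move=> j c u K _; rewrite mulrCA; congr (_ * _).
  by case: (u _) => ? ? /=; ring.
- move=> u K hu; apply: (@le_trans _ _ (\sum_(j : J) bmin^-1 * K)).
    apply: ler_sum => j _; rewrite normrM ger0_norm ?invr_ge0 ?(ltW (b0 j))//.
    apply: ler_pM => //; first by rewrite invr_ge0 ltW.
      by rewrite lef_pV2 ?posrE.
    by rewrite (le_trans (normr_Re _))//; apply: hu.
  by rewrite sumr_const -[_ *+ _]mulr_natl.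
- by move=> e j /=; rewrite hx mulrC mulfK// gt_eqF.
Qed.

End sup_functionals.

Section L1_functionals.
Context d (T : measurableType d) {R : realType} (mu : {measure set T -> \bar R}).
Variables (X : Type) (r : T -> X) (D : set X) (J : finType) (Q : J -> set T).
Variables (b : X -> R) (bmin bmax v : R) (h : {ffun J -> bool} -> X -> R).
Hypotheses (mD : measurable (r @^-1` D)) (mQ : forall j, measurable (Q j))
  (QD : forall j, Q j `<=` r @^-1` D)
  (Qdisj : forall j j' t, Q j t -> Q j' t -> j = j')
  (bmin0 : 0 < bmin) (v0 : 0 < v) (Qv : forall j, (v%:E <= mu (Q j))%E)
  (Qfin : forall j, (mu (Q j) < +oo)%E)
  (mb : measurable_fun setT (b \o r)) (bQ : forall j t, Q j t -> bmin <= b (r t) <= bmax)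
  (hQ : forall e j t, Q j t -> h e (r t) = (-1) ^+ e j * b (r t)).

Let beta j := Rintegral mu (Q j) (fun t => b (r t)).

Let b_int j : mu.-integrable (Q j) (EFin \o (fun t => b (r t))).
Proof.
apply: measurable_bounded_integrable => //; first exact: measurable_funTS.
exists bmax; split; first exact: num_real.
move=> M bM t Qt; case/andP: (bQ Qt) => b1 b2.
by rewrite /= ger0_norm ?(le_trans b2) ?(ltW bM)// (le_trans _ b1)// ltW.
Qed.

Let beta_ge j : bmin * v <= beta j.
Proof.
have c_int : mu.-integrable (Q j) (EFin \o (fun=> bmin)).
  apply: measurable_bounded_integrable => //.
  exists bmin; split; first exact: num_real.
  by move=> M bM t _ /=; rewrite ger0_norm ltW.
apply: (@le_trans _ _ (Rintegral mu (Q j) (fun=> bmin))).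
  rewrite Rintegral_cst// ler_wpM2l ?(ltW bmin0)//.
  by rewrite -lee_fin fineK// ge0_fin_numE.
by apply: le_Rintegral => // t Qt; case/andP: (bQ Qt).
Qed.

Let beta_gt0 j : 0 < beta j.
Proof. by apply: lt_le_trans (beta_ge j); rewrite mulr_gt0. Qed.

Lemma L1_bound_Re_integrable u K j : L1_bound mu r D u K ->
  mu.-integrable (Q j) (EFin \o (fun t => complex.Re (u (r t)))).
Proof.
move=> hu; have [u1 u2 u3] := hu.
apply: (@integrableS _ _ _ _ (r @^-1` D)) => //; apply/integrableP; split.
  exact/measurable_EFinP.
apply: (@le_lt_trans _ _ K%:E); last exact: ltry.
apply: le_trans u3; apply: ge0_le_integral => //.
- by apply: measurableT_comp => //; exact/measurable_EFinP.
- exact: L1_bound_normc hu.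
- by move=> t _; rewrite /= lee_fin normr_Re.
Qed.

Lemma L1_reads_signs : reads_signs (L1_bound mu r D) h (#|J|%:R * bmin * v)^-1
  (fun j u => (beta j)^-1 * Rintegral mu (Q j) (fun t => complex.Re (u (r t)))).
Proof.
split.
- move=> j u u' K L hu hv; rewrite -mulrDr; congr (_ * _).
  rewrite -RintegralD//; [|exact: L1_bound_Re_integrable hu|exact: L1_bound_Re_integrable hv].
  by apply: eq_Rintegral => t _; case: (u _) (u' _) => [? ?] [? ?].
- move=> j c u K hu; rewrite mulrCA; congr (_ * _).
  rewrite -RintegralZl//; last exact: L1_bound_Re_integrable hu.
  by apply: eq_Rintegral => t _; case: (u _) => ? ? /=; ring.
- move=> u K hu; have [u1 u2 u3] := hu.
  have K0 : 0 <= K.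
    by rewrite -lee_fin; apply: le_trans u3; apply: integral_ge0 => t _; rewrite lee_fin normc_ge0.
  have mn := L1_bound_normc mD hu.
  have [J0|J0] := posnP #|J|.
    rewrite J0 mul0r big1// => j _.
    by have /card0_eq/(_ j) := J0; rewrite inE.
  have Jne : #|J|%:R != 0 :> R by rewrite pnatr_eq0 -lt0n.
  have -> : #|J|%:R * ((#|J|%:R * bmin * v)^-1 * K) = (bmin * v)^-1 * K.
    by field; rewrite Jne !gt_eqF.
  have Qn j : ((`|Rintegral mu (Q j) (fun t => complex.Re (u (r t)))|)%:E <=
      \int[mu]_(t in Q j) (normc (u (r t)))%:E)%E.
    rewrite EFin_normr_Rintegral//; last exact: L1_bound_Re_integrable hu.
    apply: (le_trans (le_abse_integral _ _ _)) => //.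
      by apply/measurable_EFinP; apply: measurable_funS u1.
    apply: ge0_le_integral => //.
    + apply: measurableT_comp => //; apply/measurable_EFinP.
      exact: measurable_funS u1.
    + exact: measurable_funS mn.
    + by move=> t _; rewrite /= lee_fin normr_Re.
  apply: (@le_trans _ _ (\sum_j (bmin * v)^-1 * `|Rintegral mu (Q j) (fun t => complex.Re (u (r t)))|)).
    apply: ler_sum => j _; rewrite normrM ler_wpM2r// ger0_norm ?invr_ge0 ?(ltW (beta_gt0 j))//.
    by rewrite lef_pV2 ?posrE ?mulr_gt0.
  rewrite -mulr_sumr ler_pM2l ?invr_gt0 ?mulr_gt0//.
  rewrite -lee_fin; apply: le_trans u3; rewrite -sumEFin.
  apply: (@le_trans _ _ (\sum_(j : J) \int[mu]_(t in Q j) (normc (u (r t)))%:E)%E).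
    by apply: lee_sum => j _; exact: Qn.
  have QU : \big[setU/set0]_(j <- index_enum J) Q j `<=` r @^-1` D.
    by rewrite -bigcup_seq => t [j _ Qt]; exact: QD Qt.
  have mU : measurable (\big[setU/set0]_(j <- index_enum J) Q j).
    by apply: bigsetU_measurable.
  rewrite -(@ge0_integral_bigsetU _ _ _ mu _ Q) ?index_enum_uniq//.
  + by apply: ge0_subset_integral => // t _; rewrite lee_fin normc_ge0.
  + by move=> j j' _ _ [t [Qt Qt']]; exact: Qdisj Qt Qt'.
  + exact: measurable_funS mn.
  + by move=> t _; rewrite lee_fin normc_ge0.
- move=> e j /=.
  rewrite (@eq_Rintegral _ _ _ mu _ (fun t => (-1) ^+ e j * b (r t))); last first.
    by move=> t; rewrite inE => Qt; exact: hQ.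
  by rewrite RintegralZl// mulrCA mulVf ?mulr1// gt_eqF.
Qed.

End L1_functionals.

(** * Lebesgue measure of boxes *)

Section boxes.
Context {R : realType}.
Local Notation Rm := (measurableTypeR R).

Definition box n (a : nat -> R) (w : R) : set (n.-tuple Rm) :=
  [set t | forall i : 'I_n, a i <= tnth t i <= a i + w].

Arguments box : clear implicits.

Lemma measurable_box n a w : measurable (box n a w).
Proof.
rewrite (_ : box n a w = \bigcap_(i in [set: 'I_n]) ((fun t => tnth t i) @^-1` `[a i, a i + w])).
  apply: fin_bigcap_measurable => // i _; rewrite -[X in measurable X]setTI.
  exact: measurable_tnth.
apply/seteqP; split=> t /= h i; first by move=> _; rewrite /= in_itv/=; exact: h.
by have := h i I; rewrite /= in_itv.
Qed.

Lemma lebesgue_tuple_box n a w : 0 <= w -> lebesgue_tuple R n (box n a w) = (w ^+ n)%:E.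
Proof.
move=> w0; elim: n a => [|n ih] a /=.
  rewrite expr0 diracE (_ : _ \in _ = true)//.
  by apply/mem_set => -[].
rewrite /lebesgue_step /pushforward.
rewrite (_ : _ @^-1` _ = `[a 0%N, a 0%N + w]%classic `*` box n (a \o succn) w).
  rewrite product_measure1E//; last exact: measurable_box.
  have E : (lebesgue_measure : set Rm -> \bar R) `[a 0%N, a 0%N + w]%classic = w%:E.
    rewrite lebesgue_measure_itv/= lte_fin.
    case: ifPn => [_|]; first by rewrite -EFinB addrAC subrr add0r.
    by rewrite ltrDl -leNgt => w0'; congr EFin; apply/le_anti; rewrite w0 w0'.
  rewrite ih exprS EFinM.
  exact: (congr1 (fun t => t * (w ^+ n)%:E)%E E).
apply/seteqP; split=> -[x t] /=.
  move=> h; split; first by have := h ord0; rewrite in_itv.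
  by move=> i; have := h (lift ord0 i); rewrite (tnth_nth 0) [in X in _ -> X](tnth_nth 0).
move=> [h1 h2] i; case: (unliftP ord0 i) => [i'|] ->.
  by have := h2 i'; rewrite (tnth_nth 0) [in X in _ -> X](tnth_nth 0).
by move: h1; rewrite in_itv.
Qed.

Lemma measurable_lebesgue n (A : set (n.-tuple Rm)) : measurable A ->
  ((lebesgue_tuple R n)^*)%mu.-cara.-measurable A.
Proof. by move=> mA; apply: sub_caratheodory; apply: sub_sigma_algebra. Qed.

Lemma lebesgue_box n a w : 0 <= w -> lebesgue R n (box n a w) = (w ^+ n)%:E.
Proof.
move=> w0; rewrite -(lebesgue_tuple_box n a w0).
by rewrite /lebesgue /completed_measure_extension /= measurable_mu_extE//; exact: measurable_box.
Qed.

End boxes.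

(** * Cells of the cube *)

Section cells.
Context {R : realType}.
Variables (s m n : nat).
Local Notation J := {ffun 'I_s -> 'I_n}.
Implicit Types (j : J) (e : {ffun J -> bool}) (x : 'rV[R]_s).

(** Middle parts of the cells, where the bumps are bounded below. *)
Definition core_cell j : set 'rV[R]_s :=
  [set x | forall i, 1 / 4 <= n%:R * x ord0 i - (j i)%:R <= 3 / 4].

Lemma core_cell_disjoint j j' x : core_cell j x -> core_cell j' x -> j = j'.
Proof.
move=> h h'; apply/ffunP => i; apply/val_inj/eqP => /=.
have /andP[h1 h2] := h i; have /andP[h3 h4] := h' i.
rewrite eqn_leq; apply/andP; split; rewrite -ltnS -(ltr_nat R) -natr1; lra.
Qed.

Lemma core_cell_cube j x : core_cell j x -> cube x.
Proof.
move=> h i; have /andP[h1 h2] := h i.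
have j0 : 0 <= (j i)%:R :> R by [].
have jn : (j i)%:R + 1 <= n%:R :> R by rewrite natr1 ler_nat ltn_ord.
have n0 : 0 < n%:R :> R by lra.
apply/andP; split; first by rewrite -(pmulr_rge0 _ n0); lra.
by rewrite -(ler_pM2l n0) mulr1; lra.
Qed.

Definition centre j : 'rV[R]_s := \row_i (((j i)%:R + 1 / 2) / n%:R).

Lemma centre_cell j : core_cell j (centre j).
Proof.
move=> i; rewrite mxE mulrCA mulfV ?mulr1; first by apply/andP; split; lra.
by rewrite pnatr_eq0 -lt0n; case: (j i) => k kn; exact: leq_ltn_trans kn.
Qed.

Lemma bump_sum_cell e j x K : (forall i, (K i <= m.+1)%N) -> core_cell j x ->
  bump_sum m e K x =
  (-1) ^+ e j * \prod_i spline m (K i) (n%:R * x ord0 i - (j i)%:R) :> R.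
Proof.
move=> Km h; rewrite /bump_sum (bigD1 j)//= [X in _ + X]big1 ?addr0// => j' jj'.
have [i ji] : exists i, j' i != j i.
  apply: contrapT => hn; case/eqP: jj'; apply/ffunP => i; apply/eqP.
  by apply: contrapT => hi; apply: hn; exists i; apply/negP.
rewrite (bigD1 i)//= spline_out ?mul0r ?mulr0// => /andP[h3 h4].
have /andP[h1 h2] := h i; case/eqP: ji; apply/val_inj/eqP => /=.
rewrite eqn_leq; apply/andP; split; rewrite -ltnS -(ltr_nat R) -natr1; lra.
Qed.

Variable A : R.

(** The sum of bumps with all signs positive. *)
Definition base_bump : 'rV[R]_s -> R :=
  bump_fun m A ([ffun=> false] : {ffun J -> bool}) (fun=> 0%N).

Lemma bump_fun_cell e j x : core_cell j x ->
  bump_fun m A e (fun=> 0%N) x = (-1) ^+ e j * base_bump x.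
Proof.
move=> h; rewrite /base_bump /bump_fun !(bump_sum_cell _ _ h)// ffunE expr0 mul1r.
by rewrite [RHS]mulrCA.
Qed.

Hypothesis A0 : 0 < A.

Lemma base_bump_ge j x : core_cell j x ->
  A * (3 / 16) ^+ m.+2 ^+ s <= base_bump x.
Proof.
move=> h; rewrite /base_bump /bump_fun (bump_sum_cell _ _ h)// ffunE expr0 mul1r.
rewrite /multi_deg big1// expr0 mulr1 ler_pM2l//.
rewrite [leLHS](_ : _ = \prod_(i < s) (3 / 16) ^+ m.+2); last by rewrite prodr_const card_ord.
apply: ler_prod => i _; rewrite exprn_ge0 ?divr_ge0//=.
exact: spline_ge.
Qed.

Lemma base_bump_le c x : (forall k t, (k <= m.+1)%N -> `|spline m k t| <= c) ->
  base_bump x <= A * c ^+ s.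
Proof.
move=> hc; rewrite /base_bump /bump_fun /multi_deg big1// expr0 mulr1 ler_pM2l//.
by apply: le_trans (ler_norm _) _; exact: bump_sum_le.
Qed.

End cells.

Section settings.
Context {R : realType} {s : nat}.
Local Notation Rm := (measurableTypeR R).
Implicit Types (k : setting) (g : 'rV[R]_s -> R[i]).

Definition setting_bound k : ('rV[R]_s -> R[i]) -> R -> Prop :=
  match k with
  | ContinuousCase => sup_bound (@cube R s)
  | IntegrableCase => L1_bound (lebesgue R s) (@row_of_tuple R s) (@cube R s)
  end.

Lemma tuple_cube_box : @row_of_tuple R s @^-1` @cube R s = @box R s (fun=> 0) 1.
Proof.
by apply/seteqP; split=> t /= h i; have := h i; rewrite mxE add0r.
Qed.

Lemma measurable_tuple_cube :
  ((lebesgue_tuple R s)^*)%mu.-cara.-measurable (@row_of_tuple R s @^-1` @cube R s).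
Proof. by rewrite tuple_cube_box; apply: measurable_lebesgue; exact: measurable_box. Qed.

Lemma setting_norm_bound k : norm_bound (@cube R s) (setting_bound k).
Proof.
case: k => /=; first exact: norm_bound_sup.
by apply: norm_bound_L1; exact: measurable_tuple_cube.
Qed.

Lemma fnorm_setting_bound k g L : admissible k g -> (fnorm k g <= L%:E)%E ->
  setting_bound k g L.
Proof.
case: k => /=.
  move=> _ h x cx; rewrite -lee_fin; apply: le_trans h.
  by apply: ereal_sup_ubound; exists x.
move=> [/integrableP[mR _] /integrableP[mI _]] h; split => //; exact/measurable_EFinP.
Qed.

Lemma core_cell_box n (j : {ffun 'I_s -> 'I_n}) : (0 < n)%N ->
  @row_of_tuple R s @^-1` core_cell j =
  @box R s (fun i => ((if insub i is Some i' then j i' : nat else 0%N)%:R + 1 / 4) / n%:R) (1 / 2 / n%:R).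
Proof.
move=> n0; have n0' : 0 < n%:R :> R by rewrite ltr0n.
have E (i : 'I_s) (y : R) : (1 / 4 <= n%:R * y - (j i)%:R <= 3 / 4) =
    (((j i)%:R + 1 / 4) / n%:R <= y <= ((j i)%:R + 1 / 4) / n%:R + 1 / 2 / n%:R).
  rewrite -mulrDl [in RHS]ler_pdivrMr// [in RHS]ler_pdivlMr//.
  by apply/andP/andP => -[h1 h2]; split; lra.
by apply/seteqP; split=> t /= h i; have := h i; rewrite mxE valK E.
Qed.

Lemma measurable_bump_fun m n A (e : {ffun {ffun 'I_s -> 'I_n} -> bool}) :
  measurable_fun [set: s.-tuple Rm] (bump_fun m A e (fun=> 0%N) \o @row_of_tuple R s).
Proof.
apply: measurable_funM; first exact: measurable_cst.
apply: (@measurable_sum _ _ _ _ _ _ (fun j t => (-1) ^+ e j *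
  \prod_i spline m 0 (n%:R * (row_of_tuple t) ord0 i - (j i)%:R))) => j.
apply: measurable_funM; first exact: measurable_cst.
apply: (@measurable_prod _ _ _ _ _ _
  (fun i t => spline m 0 (n%:R * (row_of_tuple t) ord0 i - (j i)%:R))) => i _.
apply: (measurableT_comp (continuous_measurable_fun (continuous_spline (leq0n m)))).
apply: measurable_funB; last exact: measurable_cst.
apply: measurable_funM; first exact: measurable_cst.
under eq_fun do rewrite mxE.
exact: measurable_tnth.
Qed.

Lemma measurable_fun_lebesgue (g : s.-tuple Rm -> R) : measurable_fun setT g ->
  @measurable_fun _ _ (caratheodory_type ((lebesgue_tuple R s)^*)%mu) R setT g.
Proof.
move=> mg _ Y mY; apply: measurable_lebesgue.
exact: mg.
Qed.

End settings.

Section setting_functionals.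
Context {R : realType} {s : nat}.

(** A directional derivative along a coordinate axis is a derivative of the
    slice. *)
Lemma entire_slice N (g : 'rV[R[i]]_N -> R[i]) : entire g ->
  forall z j p, cdiff (fun w => g (upd z j w)) p.
Proof.
move=> eg z j p; set a := upd z j p.
pose v : 'rV[R[i]]_N := delta_mx ord0 j.
have updE w : upd z j w = (w - p) *: v + a.
  apply/rowP => i; rewrite /a !mxE eqxx/=.
  by case: (i == j); rewrite ?mulr1 ?subrK// mulr0 add0r.
have := @diff_derivable _ _ _ (g : 'rV[R[i]]_N -> R[i]^o) a v (eg a).
rewrite /derivable => /cvg_ex[/= c hc].
exists (fun w => if w == p then c else (g (upd z j w) - g a) / (w - p)); last first.
  move=> w; case: eqP => [->|/eqP wp]; first by rewrite subrr mulr0 addr0.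
  by rewrite divfK ?subr_eq0// addrC subrK.
move=> e e0.
have nE y : `|y : R[i]^o| = (normc y)%:C by case: y.
have F : Filter (0 : R[i]^o)^' by apply: within_filter; exact: nbhs_filter.
have H := @cvgrPdist_le R[i] R[i]^o _ (0 : R[i]^o)^' F
  (fun h : R[i]^o => h^-1 *: (((g : 'rV[R[i]]_N -> R[i]^o) \o shift a) (h *: v) - g a)) c.
have /nbhs_ballP[[d d'] /=] := H.1 hc e%:C ltac:(by rewrite ltcR).
rewrite ltcE/= => /andP[/eqP -> d0] hd.
exists d => // w wd; rewrite eqxx; case: eqP => [_|/eqP wp].
  by rewrite subrr normc0 ltW.
have wp0 : w - p != 0 by rewrite subr_eq0.
have := hd (w - p); rewrite -ball_normE/= sub0r normrN nE ltcR => /(_ wd wp0).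
by rewrite nE lecR -updE normcB_sym /GRing.scale/= mulrC.
Qed.

(** Evaluation at the centres of the cells in the continuous case, normalised
    integrals over their middle parts in the integrable case. The constant does
    not depend on the number of cells. *)
Lemma setting_reads_signs (k : setting) m : exists2 kappa : R, 0 < kappa &
  forall n A, (0 < n)%N -> 0 < A -> exists Lam, reads_signs (@setting_bound R s k)
    (fun e : {ffun {ffun 'I_s -> 'I_n} -> bool} => bump_fun m A e (fun=> 0%N)) (kappa / A) Lam.
Proof.
pose beta : R := (3 / 16) ^+ m.+2 ^+ s.
have beta0 : 0 < beta by rewrite !exprn_gt0// divr_gt0.
case: k => /=.
  exists beta^-1; first by rewrite invr_gt0.
  move=> n A n0 A0; rewrite -invfM mulrC; eexists.
  apply: (@sup_reads_signs _ _ _ _ (@centre R s n) (base_bump m n A)).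
  - by move=> j; exact: core_cell_cube (centre_cell j).
  - by rewrite mulr_gt0.
  - by move=> j; exact: base_bump_ge (centre_cell j).
  - by move=> e j; exact: bump_fun_cell (centre_cell j).
have [c c0 hc] := @spline_bounded R m.
exists (2 ^+ s / beta); first by rewrite divr_gt0// exprn_gt0.
move=> n A n0 A0; have n0' : 0 < n%:R :> R by rewrite ltr0n.
pose v : R := (1 / 2 / n%:R) ^+ s.
have v0 : 0 < v by rewrite exprn_gt0// !divr_gt0.
have Qv (j : {ffun 'I_s -> 'I_n}) :
    lebesgue R s (@row_of_tuple R s @^-1` core_cell j) = v%:E.
  by rewrite core_cell_box// lebesgue_box// !divr_ge0.
rewrite (_ : _ / A = (#|{ffun 'I_s -> 'I_n}|%:R * (A * beta) * v)^-1); last first.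
  rewrite card_ffun !card_ord natrX /v expr_div_n expr_div_n expr1n.
  by field; rewrite !expf_neq0 ?gt_eqF.
eexists.
apply: (@L1_reads_signs _ _ R (lebesgue R s) _ _ _ _
  (fun j => @row_of_tuple R s @^-1` core_cell j) (base_bump m n A) (A * beta) (A * c ^+ s) v).
- exact: measurable_tuple_cube.
- by move=> j; rewrite core_cell_box//; apply: measurable_lebesgue; exact: measurable_box.
- by move=> j t; exact: core_cell_cube.
- by move=> j j' t; exact: core_cell_disjoint.
- by rewrite mulr_gt0.
- exact: v0.
- by move=> j; exact: (eq_ind_r (fun t => v%:E <= t)%E (lexx _) (Qv j)).
- by move=> j; exact: (eq_ind_r (fun t => t < +oo)%E (ltry v) (Qv j)).
- by apply: measurable_fun_lebesgue; exact: measurable_bump_fun.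
- by move=> j t h; apply/andP; split; [exact: (base_bump_ge m A0 h)|exact: base_bump_le].
- by move=> e j t h; exact: bump_fun_cell.
Qed.

Lemma distance_setting_bound (k : setting) m n A (e : {ffun {ffun 'I_s -> 'I_n} -> bool})
    N (f : 'rV[R]_s -> 'rV[R[i]]_N -> R[i]) (z : 'rV[R]_N) theta :
  admissible k (f ^~ (map_mx (real_complex R) z)) ->
  (distance k (bump_fun m A e (fun=> 0%N)) f z <= theta%:E)%E ->
  setting_bound k (fun x => (bump_fun m A e (fun=> 0%N) x)%:C -
    f x (map_mx (real_complex R) z)) theta.
Proof.
case: k => /=.
  move=> _ h x cx; rewrite -lee_fin; apply: le_trans h.
  by apply: ereal_sup_ubound; exists x.
move=> [/integrableP[mR _] /integrableP[mI _]] h.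
have mh := measurable_fun_lebesgue (measurable_bump_fun m A e).
split; last exact: h.
- rewrite (_ : (fun t => _) = (bump_fun m A e (fun=> 0%N) \o @row_of_tuple R s) \-
    (fun t => complex.Re (f (row_of_tuple t) (map_mx (real_complex R) z)))).
    apply: measurable_funB; first exact: measurable_funTS.
    exact/measurable_EFinP.
  by apply/funext => t /=; case: (f _ _).
- rewrite (_ : (fun t => _) = cst 0 \-
    (fun t => complex.Im (f (row_of_tuple t) (map_mx (real_complex R) z)))).
    by apply: measurable_funB; [exact: measurable_cst|exact/measurable_EFinP].
  by apply/funext => t /=; case: (f _ _) => ? ? /=; rewrite sub0r.
Qed.

End setting_functionals.

(** * Choice of the parameters *)

Section sizes.
Context {R : realType}.

(** An integer of the order of [log2 N], which keeps the arithmetic of the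
    parameters within the integers. *)
Lemma bit_length (N : nat) : (2 <= N)%N -> exists L : nat,
  [/\ (0 < L <= N)%N, (N <= 2 ^ L)%N & L%:R <= 2 * log2 N%:R :> R].
Proof.
move=> N2; have N0 : (0 < N)%N by exact: ltnW.
pose k := trunc_log 2 N; have /andP[k1 k2] := trunc_log_bounds (ltnSn 1) N0.
have k0 : (0 < k)%N by rewrite trunc_log_gt0.
exists k.+1; split; [|exact: ltnW|].
  by rewrite /= (leq_trans _ k1)// ltn_expl.
have ln20 : 0 < ln 2 :> R by rewrite ln_gt0// ltr1n.
have : k%:R <= log2 N%:R :> R.
  rewrite /log2 ler_pdivlMr// mulr_natl -lnXn// ler_ln ?posrE ?exprn_gt0 ?ltr0n//.
  by rewrite -natrX ler_nat.
have : 1 <= k%:R :> R by rewrite ler1n.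
by rewrite -natr1; lra.
Qed.

Lemma least_root (s M : nat) : (0 < s)%N -> (0 < M)%N ->
  exists n : nat, [/\ (0 < n)%N, (M <= n ^ s)%N & (n ^ s <= 2 ^ s * M)%N].
Proof.
move=> s0 M0; have ex : exists n, (M <= n ^ s)%N.
  by exists M; rewrite -{1}(expn1 M) leq_pexp2l.
case: (ex_minnP ex) => n nM nmin.
have n0 : (0 < n)%N.
  by rewrite lt0n; apply: contraTneq nM => ->; rewrite exp0n// -ltnNge.
exists n; split=> //; have [n1|n1] := leqP n 1.
  by rewrite (_ : n = 1%N) ?exp1n ?muln_gt0 ?expn_gt0 ?M0//; apply/eqP; rewrite eqn_leq n1.
have nM' : (n.-1 ^ s < M)%N by rewrite ltnNge; apply/negP => /nmin; rewrite leqNgt prednK// leqnn.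
apply: (@leq_trans ((2 * n.-1) ^ s)); first by rewrite leq_exp2r//; lia.
by rewrite expnMn leq_mul2l (ltnW nM') orbT.
Qed.

Lemma le_expR (x : R) : x <= expR x.
Proof. by apply: le_trans (expR_ge1Dx x); rewrite lerDr. Qed.

Lemma powR_le_natX (N p : nat) (x : R) : (1 <= N)%N -> x <= p%:R -> N%:R `^ x <= N%:R ^+ p.
Proof. by move=> N1 xp; rewrite -powR_mulrn// ler_powR// ler1n. Qed.

(** The growth bound of the class on the polydisc of radius [y]. *)
Definition growth (A u v b t d y : R) (N : nat) : R :=
  A * expR (u * N%:R `^ v) * expR (b * N%:R `^ t * (N%:R * y) `^ d).

(** On polydiscs of polynomial radius the logarithm of the growth bound is
    polynomial in [N]. *)
Lemma growth_le (A u v b t d B r : R) :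
  1 <= A -> 1 <= u -> 1 <= v -> 1 <= b -> 1 <= t -> 1 <= d -> 1 <= B -> 1 <= r ->
  exists p : nat, exists2 c : R, 0 < c & forall N, (1 <= N)%N ->
    growth A u v b t d (21 * (B * N%:R `^ r)) N <= expR (c * N%:R ^+ p.+1).
Proof.
move=> A1 u1 v1 b1 t1 d1 B1 r1.
pose w := v + (t + (1 + r) * d).
have w0 : 0 <= w by rewrite !addr_ge0 ?mulr_ge0 ?addr_ge0//; lra.
exists (Num.trunc w), (A + u + b * (21 * B) `^ d).
  by rewrite !addr_gt0 ?mulr_gt0 ?powR_gt0 ?mulr_gt0//; lra.
move=> N N1; set p := (Num.trunc w).+1.
have wp : w <= p%:R by exact/ltW/truncnS_gt.
have rd0 : 0 <= (1 + r) * d by rewrite mulr_ge0//; lra.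
have N0 : 0 < N%:R :> R by rewrite ltr0n.
have NX1 : 1 <= N%:R ^+ p :> R by rewrite exprn_ege1// ler1n.
rewrite /growth (mulrDl (A + u)) (mulrDl A) !expRD; apply: ler_pM; rewrite ?mulr_ge0 ?expR_ge0//; try lra.
  apply: ler_pM; rewrite ?expR_ge0//; try lra.
    apply: (le_trans (le_expR A)); rewrite ler_expR ler_peMr//; lra.
  by rewrite ler_expR ler_wpM2l ?powR_le_natX//; rewrite /w in wp; lra.
rewrite ler_expR -mulrA -[leRHS]mulrA ler_wpM2l//; first lra.
rewrite (_ : N%:R * (21 * (B * N%:R `^ r)) = (21 * B) * N%:R `^ (1 + r)); last first.
  by rewrite powRD ?powRr1 ?(ltW N0)//; [ring|rewrite (gt_eqF N0) implybT].
rewrite powRM ?powR_ge0 ?mulr_ge0//; last lra.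
rewrite -powRrM mulrCA ler_wpM2l ?powR_ge0// -powRD; last by rewrite (gt_eqF N0) implybT.
by rewrite powR_le_natX//; rewrite /w in wp; lra.
Qed.

(** The number [n ^ s] of cells is [2 ^ E] times [N log N] up to a constant
    factor, and the number [T] of nodes is of the order of [(E + 1) * N ^ (p + 1)].
    The logarithm of the number of sign patterns is then linear in [E], up to the
    factor [N log N], and [2 ^ E] outgrows it for some [E] independent of [N]. *)
Lemma parameters (s : nat) (l q A u v b t d B r : R) : (0 < s)%N -> 0 < l -> 0 < q ->
  1 <= A -> 1 <= u -> 1 <= v -> 1 <= b -> 1 <= t -> 1 <= d -> 1 <= B -> 1 <= r ->
  exists2 C : R, 0 < C & forall N, (2 <= N)%N -> exists n T : nat,
  [/\ (0 < n)%N, (0 < T)%N, (((31 * (n ^ s).+1 * T).+1 ^ N) ^ 2 < 2 ^ (n ^ s))%N,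
   q * n%:R `^ l * (C / (N%:R * log2 N%:R) `^ (l / s%:R)) <= 1 / 64 &
   q * n%:R `^ l * (3 ^+ N * growth A u v b t d (21 * (B * N%:R `^ r)) N * (3 / 4) ^+ T) <= 1 / 64].
Proof.
move=> s0 l0 q0 A1 u1 v1 b1 t1 d1 B1 r1.
have [p [c c0 hc]] := growth_le A1 u1 v1 b1 t1 d1 B1 r1.
have [G0 G00 G0E] : exists2 G0 : nat, (0 < G0)%N &
    4 * (64 * q + l * (s%:R + 3) + 2 + c) <= G0%:R.
  by eexists; last exact/ltW/truncnS_gt.
pose G := (4 * (8 + s + G0 + p.+1))%N.
have [E EG] : exists E, (4 * E + G < 2 ^ E)%N.
  exists (G + 5)%N; rewrite expnD (_ : 2 ^ 5 = 32)%N//.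
  have := ltn_expl G (ltnSn 1); lia.
exists ((64 * q * (2 ^+ (s + 1 + E)) `^ (l / s%:R))^-1).
  by rewrite invr_gt0 !mulr_gt0// powR_gt0// exprn_gt0.
move=> N N2; have N1 : (1 <= N)%N by exact: ltnW.
have [L [/andP[L0 LN] NL Llog]] := bit_length N2.
have M0 : (0 < 2 ^ E * N * L)%N by rewrite muln_gt0 L0 andbT muln_gt0 expn_gt0 N1.
have [n [n0 nM nM']] := least_root s0 M0.
pose T := (G0 * E.+1 * N ^ p.+1)%N.
exists n, T.
have T0 : (0 < T)%N by rewrite /T muln_gt0 expn_gt0 N1 andbT muln_gt0 G00.
have ML : (n ^ s <= 2 ^ (s + E + 2 * L))%N.
  apply: (leq_trans nM'); rewrite (expnD _ (s + E)) (expnD _ s) -[leqRHS]mulnA.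
  apply: leq_mul => //; rewrite -mulnA; apply: leq_mul => //.
  by rewrite mul2n -addnn expnD; apply: leq_mul => //; exact/ltnW/ltn_expl.
split => //.
- have TL : (T <= 2 ^ (G0 + E + p.+1 * L))%N.
    rewrite /T (expnD _ (G0 + E)) (expnD _ G0); apply: leq_mul.
      by apply: leq_mul; [exact/ltnW/ltn_expl|exact: ltn_expl].
    by rewrite mulnC expnM leq_exp2r.
  pose w := (6 + (s + E + 2 * L) + (G0 + E + p.+1 * L))%N.
  have W : ((31 * (n ^ s).+1 * T).+1 <= 2 ^ w)%N.
    rewrite /w expnD (expnD _ 6) (_ : 2 ^ 6 = 64)%N//.
    apply: (@leq_trans (64 * n ^ s * T)); last by rewrite leq_mul// leq_mul.
    have : (0 < n ^ s)%N by rewrite expn_gt0 n0.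
    move: (n ^ s)%N (T) T0 => a a' {w} a0' a0; clear -a0 a0'; nia.
  apply: (@leq_ltn_trans (((2 ^ w) ^ N) ^ 2)).
    by rewrite !leq_exp2r.
  rewrite -!expnM ltn_exp2l//; apply: leq_trans nM.
  have : (2 * w < 2 ^ E * L)%N.
    apply: (@leq_ltn_trans ((4 * E + G) * L)); last by rewrite ltn_mul2r L0.
    have := leq_pmulr (6 + s + E + E + G0) L0.
    by rewrite /w /G; move: (E) => E'; clear; lia.
  move: (2 ^ E)%N => a wa; clear -wa N1.
  rewrite (_ : w * (N * 2) = N * (2 * w))%N; last by lia.
  by rewrite (_ : a * N * L = N * (a * L))%N ?ltn_mul2l ?N1//; lia.
- have s0' : 0 < s%:R :> R by rewrite ltr0n.
  have lg : 0 < N%:R * log2 N%:R :> R.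
    rewrite mulr_gt0 ?ltr0n//; have : 1 <= L%:R :> R by rewrite ler1n.
    lra.
  have nl : n%:R `^ l <= (2 ^+ (s + 1 + E)) `^ (l / s%:R) * (N%:R * log2 N%:R) `^ (l / s%:R).
    rewrite -powRM ?exprn_ge0 ?(ltW lg)//.
    rewrite (_ : n%:R `^ l = (n%:R ^+ s) `^ (l / s%:R)); last first.
      by rewrite -powR_mulrn// -powRrM mulrC divfK// gt_eqF.
    apply: ge0_ler_powR.
    - by rewrite divr_ge0// ltW.
    - by rewrite nnegrE exprn_ge0.
    - by rewrite nnegrE mulr_ge0 ?exprn_ge0// ltW.
    apply: (@le_trans _ _ (2 ^ s * (2 ^ E * N * L))%:R); first by rewrite -natrX ler_nat.
    rewrite !natrM !natrX (exprD _ (s + 1)) (exprD _ s) expr1.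
    have : 2 ^+ s * 2 ^+ E * N%:R * L%:R <= 2 ^+ s * 2 ^+ E * N%:R * (2 * log2 N%:R) :> R.
      by rewrite ler_wpM2l// !mulr_ge0// exprn_ge0.
    lra.
  set P := (2 ^+ _) `^ _ in nl *; set Q := (_ * log2 _) `^ _ in nl *.
  have P0 : 0 < P by rewrite powR_gt0// exprn_gt0.
  have Q0 : 0 < Q by rewrite powR_gt0.
  rewrite mulrA ler_pdivrMr// ler_pdivrMr ?mulr_gt0//.
  rewrite (_ : 1 / 64 * Q * (64 * q * P) = q * (P * Q)); last by field.
  by rewrite ler_pM2l.
- have N0 : 0 < N%:R :> R by rewrite ltr0n.
  pose X : R := N%:R ^+ p.+1.
  have X1 : 1 <= X by rewrite exprn_ege1// ler1n.
  have NX : N%:R <= X by rewrite /X exprS ler_peMr ?exprn_ege1 ?ler1n.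
  have E1 : 1 <= E.+1%:R :> R by rewrite ler1n.
  have two : (2 : R) <= expR 1 by apply: le_trans (expR_ge1Dx _); lra.
  have h1 : q <= expR (64 * q) / 64.
    by rewrite ler_pdivlMr// mulrC le_expR.
  have h2 : n%:R `^ l <= expR (l * (s%:R + E%:R + 2 * L%:R)).
    apply: (@le_trans _ _ ((2 ^+ (s + E + 2 * L)) `^ l)).
      apply: ge0_ler_powR; rewrite ?nnegrE ?exprn_ge0 ?(ltW l0)//.
      apply: (@le_trans _ _ (n ^ s)%:R); last by rewrite -natrX ler_nat.
      by rewrite ler_nat -{1}(expn1 n) leq_pexp2l.
    rewrite -natrM -!natrD -powR_mulrn// -powRrM [l * _]mulrC.
    rewrite -[X in expR X]mul1r expRM; apply: ge0_ler_powR => //.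
    - by rewrite mulr_ge0// ltW.
    - by rewrite nnegrE.
    - by rewrite nnegrE expR_ge0.
  have h3 : 3 ^+ N <= expR (2 * N%:R) :> R.
    rewrite expRM_natr; apply: lerXn2r; rewrite ?nnegrE ?expR_ge0//.
    by apply: le_trans (expR_ge1Dx _); lra.
  have h4 := hc N N1.
  have h5 : (3 / 4) ^+ T <= expR (- (1 / 4) * T%:R) :> R.
    rewrite expRM_natr; apply: lerXn2r; rewrite ?nnegrE ?expR_ge0 ?divr_ge0//.
    by apply: le_trans (expR_ge1Dx _); lra.
  have g0 : 0 <= growth A u v b t d (21 * (B * N%:R `^ r)) N.
    by rewrite /growth !mulr_ge0 ?expR_ge0//; lra.
  apply: (@le_trans _ _ (expR (64 * q) / 64 * expR (l * (s%:R + E%:R + 2 * L%:R)) *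
     (expR (2 * N%:R) * expR (c * X) * expR (- (1 / 4) * T%:R)))).
    apply: ler_pM; first by rewrite mulr_ge0 ?powR_ge0// ltW.
    - by rewrite mulr_ge0 ?exprn_ge0 ?divr_ge0// mulr_ge0 ?exprn_ge0.
    - by apply: ler_pM => //; exact: ltW.
    apply: ler_pM => //.
    - by rewrite mulr_ge0 ?exprn_ge0.
    - by apply: ler_pM => //; rewrite exprn_ge0.
  rewrite [leLHS](_ : _ = expR (64 * q + l * (s%:R + E%:R + 2 * L%:R) +
    (2 * N%:R + c * X + - (1 / 4) * T%:R)) * (1 / 64)); last first.
    by rewrite !expRD; field.
  rewrite -[leRHS]mul1r ler_pM2r; last by rewrite divr_gt0.
  rewrite expR_le1.
  pose Y : R := E.+1%:R * X.
  have TY : T%:R = G0%:R * Y by rewrite /T !natrM natrX mulrA.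
  have XY : X <= Y by rewrite /Y ler_peMl// (le_trans _ X1).
  have EY : E.+1%:R <= Y by rewrite /Y ler_peMr.
  have Y1 : 1 <= Y by exact: le_trans XY.
  have k1 : 4 * (64 * q + l * (s%:R + 3) + 2 + c) * Y <= G0%:R * Y.
    by rewrite ler_wpM2r// (le_trans _ Y1).
  have k2 : 64 * q <= 64 * q * Y by rewrite ler_peMr// mulr_ge0// ltW.
  have k3 : s%:R + E%:R + 2 * L%:R <= (s%:R + 3) * Y.
    have : L%:R <= N%:R :> R by rewrite ler_nat.
    have : s%:R <= s%:R * Y by rewrite ler_peMr.
    have : E%:R <= E.+1%:R :> R by rewrite ler_nat.
    lra.
  have k4 : l * (s%:R + E%:R + 2 * L%:R) <= l * ((s%:R + 3) * Y) by rewrite ler_pM2l.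
  have k5 : c * X <= c * Y by rewrite ler_pM2l.
  rewrite TY; lra.
Qed.

End sizes.

(** * The lower bound *)

Section main.
Context {R : realType} {s : nat}.
Variables (k : setting) (A u v b t d B r : R).
Hypotheses (A1 : 1 <= A) (b1 : 1 <= b) (d1 : 1 <= d) (B1 : 1 <= B).

Lemma class_E_norm N (f : 'rV[R]_s -> 'rV[R[i]]_N -> R[i]) (y : R) (z : 'rV[R[i]]_N) :
  class_E k A u v b t d N f -> 0 <= y -> (forall j, normc (z ord0 j) <= y) ->
  setting_bound k (f ^~ z) (growth A u v b t d y N).
Proof.
move=> [_ fa fb] y0 zy; apply: fnorm_setting_bound => //; apply: (le_trans (fb z)).
rewrite lee_fin /growth ler_wpM2l//.
  by rewrite mulr_ge0 ?expR_ge0// (le_trans _ A1).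
rewrite ler_expR ler_wpM2l//; first by rewrite mulr_ge0 ?powR_ge0// (le_trans _ b1).
have z0 : 0 <= norm1 z by apply: sumr_ge0 => j _; exact: normc_ge0.
apply: ge0_ler_powR; rewrite ?nnegrE ?mulr_ge0//; first by rewrite (le_trans _ d1).
apply: (@le_trans _ _ (\sum_(j < N) y)); first by apply: ler_sum => j _; exact: zy.
by rewrite sumr_const card_ord mulr_natl.
Qed.

(** Interpolation at [T] equidistant nodes of the parameter interval. *)
Lemma approximable_bound N m n T (a kappa theta : R)
    (f : 'rV[R]_s -> 'rV[R[i]]_N -> R[i])
    (Lam : {ffun 'I_s -> 'I_n} -> ('rV[R]_s -> R[i]) -> R) :
  (1 <= N)%N -> (0 < n)%N -> (0 < T)%N ->
  class_E k A u v b t d N f ->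
  reads_signs (@setting_bound R s k)
    (fun e : {ffun {ffun 'I_s -> 'I_n} -> bool} => bump_fun m a e (fun=> 0%N)) kappa Lam ->
  kappa * (theta + 3 ^+ N * growth A u v b t d (21 * (B * N%:R `^ r)) N * (3 / 4) ^+ T)
    <= 1 / 32 ->
  (forall e : {ffun {ffun 'I_s -> 'I_n} -> bool}, exists2 z : 'rV[R]_N, param_box B r N z &
    (distance k (bump_fun m a e (fun=> 0%N)) f z <= theta%:E)%E) ->
  (2 ^ (n ^ s) <= ((31 * (n ^ s).+1 * T).+1 ^ N) ^ 2)%N.
Proof.
move=> N1 n0 T0 fE [LD LZ LB Lh] small approx.
pose rho := B * N%:R `^ r.
have rho0 : 0 < rho.
  by rewrite mulr_gt0 ?powR_gt0 ?ltr0n//; apply: lt_le_trans B1.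
pose ts : seq R := [seq rho * (i%:R / T%:R) | i <- iota 0 T].
have T0' : 0 < T%:R :> R by rewrite ltr0n.
have szts : size ts = T by rewrite size_map size_iota.
have uts : uniq ts.
  rewrite map_inj_uniq ?iota_uniq// => i j /(mulfI (lt0r_neq0 rho0)).
  by move=> /(mulIf (invr_neq0 (lt0r_neq0 T0')))/(mulrIn (oner_neq0 _)).
have tsr x : x \in ts -> `|x| <= rho.
  case/mapP => i; rewrite mem_iota add0n => /andP[_ iT] ->.
  rewrite ger0_norm; last by apply: mulr_ge0; [exact: ltW|exact: divr_ge0].
  by rewrite ler_piMr ?(ltW rho0)// ler_pdivrMr// mul1r ler_nat ltnW.
have card : #|{ffun 'I_s -> 'I_n}| = (n ^ s)%N by rewrite card_ffun !card_ord.
have J0 : (0 < #|{ffun 'I_s -> 'I_n}|)%N by rewrite card expn_gt0 n0.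
have [fe fa fb] := fE.
have r21 : 0 <= 21 * rho by apply: mulr_ge0 => //; exact: ltW.
rewrite -card -szts.
apply: (@sign_patterns_bound R N _ _ _ (setting_norm_bound k) rho
  (growth A u v b t d (21 * rho) N) theta kappa ts rho0 _ uts tsr f _ _ _ _ J0 Lam LD LZ LB _ Lh).
- by rewrite /growth !mulr_ge0 ?expR_ge0// (le_trans _ A1).
- by move=> x cx z j p; apply: entire_slice; exact: fe.
- move=> z; exists (growth A u v b t d (norm1 z) N); apply: class_E_norm => //.
    by apply: sumr_ge0 => j _; exact: normc_ge0.
  move=> j; rewrite /norm1 (bigD1 j)//= lerDl; apply: sumr_ge0 => i _; exact: normc_ge0.
- by move=> z zr; exact: class_E_norm.
- move=> e; have [z zb hz] := approx e; exists z => //.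
  by apply: distance_setting_bound => //; exact: fa.
- by rewrite szts.
Qed.

End main.

Theorem mainTheorem2 (R : realType) (k : setting) (l : R) (s : nat)
    (A u v b t d B r : R) :
  0 < l -> (1 <= s)%N ->
  1 <= A -> 1 <= u -> 1 <= v -> 1 <= b -> 1 <= t -> 1 <= d -> 1 <= B -> 1 <= r ->
  exists C : R, 0 < C /\ forall N : nat, (2 <= N)%N ->
    (forall f : 'rV[R]_s -> 'rV[R[i]]_N -> R[i],
       class_E k A u v b t d N f ->
       exists h : 'rV[R]_s -> R, Lambda s l h /\
         forall z : 'rV[R]_N, param_box B r N z ->
           ((C / (N%:R * log2 N%:R) `^ (l / s%:R))%:E <= distance k h f z)%E)
    /\
    ((C / (N%:R * log2 N%:R) `^ (l / s%:R))%:E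
       <= DN k A u v b t d B r N (Lambda s l))%E.
Proof.
move=> l0 s0 A1 u1 v1 b1 t1 d1 B1 r1.
have [m [alpha [lE a01]]] : exists (m : nat) (alpha : R), l = m%:R + alpha /\ 0 < alpha <= 1.
  have [M] : exists M : nat, l <= M%:R by exists (Num.trunc l).+1; exact/ltW/truncnS_gt.
  elim: M => [|M ih] lM; first by move: lM; rewrite leNgt l0.
  have [/ih//|Ml] := leP l M%:R.
  exists M, (l - M%:R); rewrite addrC subrK; split=> //.
  by apply/andP; split; move: lM; rewrite -natr1; lra.
have [c c0 hc] := @spline_bounded R m.
have [kappa kappa0 hk] := @setting_reads_signs R s k m.
pose q := kappa * (2 * s%:R * c ^+ s).
have q0 : 0 < q by rewrite !mulr_gt0 ?exprn_gt0 ?ltr0n.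
have [C C0 hC] := parameters s0 l0 q0 A1 u1 v1 b1 t1 d1 B1 r1.
exists C; split => // N N2.
have main f : class_E k A u v b t d N f ->
    exists h : 'rV[R]_s -> R, Lambda s l h /\
      forall z : 'rV[R]_N, param_box B r N z ->
        ((C / (N%:R * log2 N%:R) `^ (l / s%:R))%:E <= distance k h f z)%E.
  move=> fE; have [n [T [n0 T0 count h1 h2]]] := hC N N2.
  have a0 := @amplitude_gt0 R s n l c s0 n0 c0.
  have [Lam hL] := hk n _ n0 a0.
  apply: contrapT => no_h.
  have := @approximable_bound R s k A u v b t d B r A1 b1 d1 B1 N m n T _ _
    (C / (N%:R * log2 N%:R) `^ (l / s%:R)) f Lam (ltnW N2) n0 T0 fE hL.
  rewrite leqNgt count => H; suff: false by []; apply: H.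
    have -> : kappa / amplitude s n l c = q * n%:R `^ l.
      by rewrite /amplitude /q invf_div invrK mulrCA mulrC.
    by rewrite mulrDr; lra.
  move=> e; apply: contrapT => far; apply: no_h.
  exists (bump_fun m (amplitude s n l c) e (fun=> 0%N)); split.
    exact: (bump_fun_Lambda s0 n0 c0 hc lE a01).
  move=> z zb; rewrite leNgt; apply/negP => hz; apply: far.
  by exists z => //; exact: ltW.
split; first exact: main.
apply: le_ereal_inf_tmp => _ [f fE <-]; have [h [hL hz]] := main f fE.
apply: (@le_trans _ _ (ereal_inf [set distance k h f z | z in param_box B r N])%E).
  by apply: le_ereal_inf_tmp => _ [z zb <-]; exact: hz.
by apply: ereal_sup_ubound; exists h.
Qed.
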